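(* Let $\mathbb{K}$ be a computable field for which there is an algorithm that decides whether a given polynomial $p\in\mathbb{K}[x]$ in one variable has a root in $\mathbb{K}$ and, if so, produces all roots of $p$ in $\mathbb{K}$. Then there is an algorithm which, given a $G$-algebra $\mathcal{G}$ over $\mathbb{K}$ (by its defining data $n$, $c_{ij}$, $d_{ij}$), an admissible monomial ordering $\prec$ on $\mathcal{G}$, and an element $g\in\mathcal{G}\setminus\mathbb{K}$ that is monic with respect to $\prec$, terminates after finitely many steps and outputs the set $$\{(g_1,\ldots,g_m)\mid m\in\mathbb{N},\ g_i\in\mathcal{G}\setminus\mathbb{K}\text{ for } i\in\{1,\ldots,m\},\ g_1\cdots g_m=g\}$$ up to multiplication of each factor by a central unit. That is, the output is a finite set $R$ of tuples of elements of $\mathcal{G}\setminus\mathbb{K}$ such that each $(g_1,\ldots,g_m)\in R$ satisfies $g_1\cdots g_m=g$, and for every $m\in\mathbb{N}$ and all $h_1,\ldots,h_m\in\mathcal{G}\setminus\mathbb{K}$ with $h_1\cdots h_m=g$ there are $(g_1,\ldots,g_m)\in R$ and central units $c_1,\ldots,c_m$ of $\mathcal{G}$ with $h_i=c_ig_i$ for all $i$.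
   Context: $G$-algebra: for $n\in\mathbb{N}$ and $1\le i<j\le n$ let $c_{ij}\in\mathbb{K}^*=\mathbb{K}\setminus\{0\}$ and $d_{ij}\in\mathbb{K}[x_1,\ldots,x_n]$. Suppose there is a monomial total well-ordering $\prec$ on $\mathbb{K}[x_1,\ldots,x_n]$ such that for all $1\le i<j\le n$ either $d_{ij}=0$ or the leading monomial of $d_{ij}$ is smaller than $x_ix_j$ with respect to $\prec$. The $\mathbb{K}$-algebra $$\mathbb{K}\langle x_1,\ldots,x_n\mid x_jx_i=c_{ij}x_ix_j+d_{ij},\ 1\le i<j\le n\rangle$$ (where each $d_{ij}$ is read as a linear combination of standard monomials $x_1^{\alpha_1}\cdots x_n^{\alpha_n}$) is called a $G$-algebra if the standard monomials $x^\alpha=x_1^{\alpha_1}\cdots x_n^{\alpha_n}$, $\alpha\in\mathbb{N}_0^n$, form a $\mathbb{K}$-basis of it. A monomial total well-ordering $\prec$ on $\mathbb{K}[x_1,\ldots,x_n]$ such that for all $1\le i<j\le n$ either $d_{ij}=0$ or the leading monomial of $d_{ij}$ is smaller than $x_ix_j$ with respect to $\prec$ is called an admissible monomial ordering on the $G$-algebra. Every nonzero $g\in\mathcal{G}$ can be written uniquely as $g=c_\alpha x^\alpha+t_g$ with $c_\alpha\in\mathbb{K}^*$ and either $t_g=0$ or every monomial occurring in $t_g$ with nonzero coefficient is smaller than $x^\alpha$ with respect to $\prec$. The element $g$ is monic if $c_\alpha=1$. The units of a $G$-algebra are exactly the nonzero scalars in $\mathbb{K}^*$, and they are central. *)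

(* Defs.v *)
From HB Require Import structures.
From mathcomp Require Import all_boot all_order all_algebra.
(* [monalg] and [mpoly] define clashing notations; only those of [mpoly] are
   used here. *)
From mathcomp Require Import -(notations) monalg.
From mathcomp Require Import mpoly.

Set Implicit Arguments.
Unset Strict Implicit.
Unset Printing Implicit Defensive.

Import GRing.Theory.
Local Open Scope ring_scope.

(* Algorithms are programs of a WHILE language over binary trees (N. D. Jones,
   "Computability and Complexity: From a Programming Perspective"), a
   Turing-complete model whose data are S-expressions.  [Oracle] is one call to
   an external function [o : tree -> tree], as in relative computability. *)

Inductive tree : Type := Leaf | Node of tree & tree.

Definition lson (t : tree) : tree := if t is Node a _ then a else Leaf.
Definition rson (t : tree) : tree := if t is Node _ b then b else Leaf.
Definition is_node (t : tree) : bool := if t is Node _ _ then true else false.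

Inductive prog : Type :=
| Id
| Nil
| Cons of prog & prog
| Fst
| Snd
| Comp of prog & prog
| If of prog & prog & prog
| While of prog & prog
| Oracle.

(* [eval o p t u]: with oracle [o], the program [p] run on [t] halts with
   output [u].  [Comp p q] runs [q] first; a test succeeds when its value is
   not [Leaf]. *)
Inductive eval (o : tree -> tree) : prog -> tree -> tree -> Prop :=
| eval_id t : eval o Id t t
| eval_nil t : eval o Nil t Leaf
| eval_cons p q t u v :
    eval o p t u -> eval o q t v -> eval o (Cons p q) t (Node u v)
| eval_fst t : eval o Fst t (lson t)
| eval_snd t : eval o Snd t (rson t)
| eval_comp p q t u v :
    eval o q t u -> eval o p u v -> eval o (Comp p q) t v
| eval_if b p q t u v :
    eval o b t u -> eval o (if is_node u then p else q) t v ->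
    eval o (If b p q) t v
| eval_while_stop b p t :
    eval o b t Leaf -> eval o (While b p) t t
| eval_while_step b p t u v w :
    eval o b t u -> is_node u ->
    eval o p t v -> eval o (While b p) v w -> eval o (While b p) t w
| eval_oracle t : eval o Oracle t (o t).

(* A constant oracle provides no information: this is computability without
   an oracle. *)
Definition eval0 : prog -> tree -> tree -> Prop := eval (fun=> Leaf).

Definition enc_bool (b : bool) : tree := if b then Node Leaf Leaf else Leaf.
Definition enc_nat (k : nat) : tree := iter k (Node Leaf) Leaf.
Definition enc_list (T : Type) (f : T -> tree) (s : seq T) : tree :=
  foldr (fun a => Node (f a)) Leaf s.

Definition computable1 (T : Type) (enc : T -> tree) (f : T -> T) : Prop :=
  exists p : prog, forall a : T, eval0 p (enc a) (enc (f a)).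

Definition computable2 (T : Type) (enc : T -> tree) (f : T -> T -> T) : Prop :=
  exists p : prog, forall a b : T,
    eval0 p (Node (enc a) (enc b)) (enc (f a b)).

(* A computable field in the sense of Rabin: an injective coding with a
   decidable image for which the field operations are computable.  Equality is
   then decidable, because distinct elements have distinct codes. *)
Record computable_field (K : fieldType) (enc : K -> tree) : Prop := {
  cf_inj : injective enc;
  cf_dom : exists p : prog, forall t : tree,
      (exists a : K, enc a = t) /\ eval0 p t (enc_bool true) \/
      ~ (exists a : K, enc a = t) /\ eval0 p t (enc_bool false);
  cf_add : computable2 enc +%R;
  cf_opp : computable1 enc -%R;
  cf_mul : computable2 enc *%R;
  cf_inv : computable1 enc GRing.inv }.

(* The zero polynomial is excluded: over an infinite field its roots cannot be
   listed.  An empty output means that there is no root. *)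
Definition has_root_algorithm (K : fieldType) (enc : K -> tree) : Prop :=
  exists r : prog, forall p : {poly K}, p != 0 ->
    exists s : seq K,
      eval0 r (enc_list enc (p : seq K)) (enc_list enc s) /\
      (forall a : K, (a \in s) = root p a).

Section MonomialOrderings.
Variables (K : fieldType) (n : nat).
Implicit Types (lt : rel 'X_{1..n}) (p : {mpoly K[n]}).

Record monomial_ordering lt : Prop := {
  mo_irr : irreflexive lt;
  mo_trans : transitive lt;
  mo_total : forall a b, a != b -> lt a b || lt b a;
  mo_mul : forall a b m, lt a b -> lt (a + m)%MM (b + m)%MM;
  mo_wf : well_founded (fun a b => lt a b) }.

Definition lead_monomial lt p (a : 'X_{1..n}) : Prop :=
  a \in msupp p /\ forall b, b \in msupp p -> b != a -> lt b a.

Definition admissible (d : 'I_n -> 'I_n -> {mpoly K[n]}) lt : Prop :=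
  monomial_ordering lt /\
  forall i j : 'I_n, (i < j)%N ->
    d i j = 0 \/
    exists2 a, lead_monomial lt (d i j) a & lt a (U_(i) + U_(j))%MM.

End MonomialOrderings.

(* The product is taken in increasing order of the index. *)
Definition stdmon (R : pzRingType) (n : nat) (x : 'I_n -> R)
    (a : 'X_{1..n}) : R :=
  \prod_(i < n) x i ^+ a i.

Definition stdpoly (K : fieldType) (R : lalgType K) (n : nat) (x : 'I_n -> R)
    (p : {mpoly K[n]}) : R :=
  \sum_(a <- msupp p) p@_a *: stdmon x a.

Definition in_ideal (R : pzRingType) (S : R -> Prop) (f : R) : Prop :=
  exists s : seq (R * R * R),
    (forall u, u \in s -> S u.1.2) /\
    f = \sum_(u <- s) u.1.1 * u.1.2 * u.2.

Section GAlgebras.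
Variables (K : fieldType) (n : nat).

(* The free algebra K<x_0, ..., x_(n-1)>, as the monoid algebra of the free
   monoid on 'I_n. *)
Definition freealg : lalgType K := @malg (fmonom 'I_n) K.

Definition fvar (i : 'I_n) : freealg := mkmalgU (fmu i) 1.

Definition freeval (A : algType K) (x : 'I_n -> A) (f : freealg) : A :=
  monalg.mmap (in_alg A) (fun w : fmonom 'I_n => \prod_(i <- fmonom_val w) x i)
    f.

Variables (c : 'I_n -> 'I_n -> K) (d : 'I_n -> 'I_n -> {mpoly K[n]}).

Definition G_relation (f : freealg) : Prop :=
  exists i j : 'I_n, (i < j)%N /\
    f = fvar j * fvar i
        - (c i j *: (fvar i * fvar j) + stdpoly fvar (d i j)).

(* [A], with generators [x], is the quotient of the free algebra by the
   two-sided ideal generated by the relations (up to isomorphism). *)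
Definition presented (A : algType K) (x : 'I_n -> A) : Prop :=
  (forall a : A, exists f : freealg, freeval x f = a) /\
  (forall f : freealg, freeval x f = 0 <-> in_ideal G_relation f).

(* A polynomial is a finitely supported family of coefficients, so the last
   clause says that the family of standard monomials is a basis. *)
Definition G_algebra (A : algType K) (x : 'I_n -> A) : Prop :=
  [/\ forall i j : 'I_n, (i < j)%N -> c i j != 0,
      exists lt : rel 'X_{1..n}, admissible d lt,
      presented x
    & forall a : A, exists! p : {mpoly K[n]}, stdpoly x p = a].

End GAlgebras.

Definition nonscalar (K : fieldType) (A : algType K) (a : A) : Prop :=
  forall k : K, a <> k%:A.

Definition central_unit (A : pzRingType) (u : A) : Prop :=
  (exists v : A, u * v = 1 /\ v * u = 1) /\ (forall a : A, u * a = a * u).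

Definition monic_for (K : fieldType) (A : algType K) (n : nat) (x : 'I_n -> A)
    (lt : rel 'X_{1..n}) (g : A) : Prop :=
  exists (p : {mpoly K[n]}) (a : 'X_{1..n}),
    [/\ stdpoly x p = g, lead_monomial lt p a & p@_a = 1].

(* Polynomials, and elements of a G-algebra, are given to and returned by
   programs as arbitrary lists of terms. *)
Definition terms (K : fieldType) (n : nat) : Type := seq (K * 'X_{1..n}).

Definition poly_of_terms (K : fieldType) (n : nat) (s : terms K n) :
    {mpoly K[n]} :=
  \sum_(u <- s) u.1 *: 'X_[u.2].

Section Encodings.
Variables (K : fieldType) (enc : K -> tree) (n : nat).

Definition enc_mon (a : 'X_{1..n}) : tree :=
  enc_list enc_nat [seq a i | i <- enum 'I_n].

Definition enc_terms (s : terms K n) : tree :=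
  enc_list (fun u => Node (enc u.1) (enc_mon u.2)) s.

(* Only the entries with i < j are listed, grouped by j. *)
Definition enc_upper (T : Type) (f : T -> tree) (F : 'I_n -> 'I_n -> T) :
    tree :=
  enc_list (enc_list f)
    [seq [seq F i j | i : 'I_n <- enum 'I_n & (i < j)%N] | j : 'I_n <- enum 'I_n].

Definition enc_input (c : 'I_n -> 'I_n -> K) (ds : 'I_n -> 'I_n -> terms K n)
    (gs : terms K n) : tree :=
  Node (enc_nat n)
    (Node (enc_upper enc c) (Node (enc_upper enc_terms ds) (enc_terms gs))).

(* A monomial ordering is an infinite object; a program accesses it through
   comparisons of monomials.  Other queries may be answered arbitrarily. *)
Definition ordering_oracle (lt : rel 'X_{1..n}) (o : tree -> tree) : Prop :=
  forall a b : 'X_{1..n}, o (Node (enc_mon a) (enc_mon b)) = enc_bool (lt a b).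

End Encodings.

Arguments enc_terms {K} enc {n} s.

(* [R] is the set of factorizations of [g] into non-scalar factors, up to
   multiplication of each factor by a central unit. *)
Definition all_factorizations (K : fieldType) (A : algType K) (g : A)
    (R : seq (seq A)) : Prop :=
  (forall gs : seq A, gs \in R ->
     (forall a, a \in gs -> nonscalar a) /\ \prod_(a <- gs) a = g) /\
  (forall hs : seq A,
     (forall h, h \in hs -> nonscalar h) -> \prod_(h <- hs) h = g ->
     exists gs : seq A,
       [/\ gs \in R, size gs = size hs
         & forall i, (i < size hs)%N ->
             exists2 u : A, central_unit u & nth 0 hs i = u * nth 0 gs i]).

(* Main.v *)
(** The ordering only serves to see that the standard monomials behave well: by
    Gordan's theorem there are positive integer weights [w] such that every
    monomial of [d i j] has weight at most [w i + w j], and refining the weight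
    by the ordering gives an admissible ordering for which only finitely many
    monomials lie below a given one. The factors of [g] are then combinations of
    an explicit finite set [S] of monomials, and there are at most [D] of them,
    where [D] bounds the weight of [g].

    Pad a factorization with ones to [D] factors and give the factors
    indeterminate coefficients [X k a]. Modulo the equations saying that the
    product is [g], every product [z] of one coefficient from each factor is
    integral over [K]: this follows from a Dedekind-Mertens lemma, which
    bounds the length of the words in the [z] that are needed to span all of
    them. So one nonzero polynomial [p] annihilates all the [z], and this has a
    finite certificate (an ideal membership). The coefficients of a suitably
    scaled factorization are values of the [z] or quotients of two such values,
    hence taken in a finite list computed from the roots of [p].

    The program searches through all trees for the weights, for the normal forms
    of products of monomials and for [p], together with certificates of their
    correctness, calls the root algorithm once on [p], and tests the finitely
    many candidates. It never calls the ordering. *)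

From HB Require Import structures.
From Stdlib Require Import ClassicalEpsilon.
From mathcomp Require Import all_boot all_order all_algebra.
From mathcomp Require Import ring.
From mathcomp Require finmap.
From mathcomp Require Import -(notations) monalg.
From mathcomp Require Import mpoly.
Require Import Defs.

Set Implicit Arguments.
Unset Strict Implicit.
Unset Printing Implicit Defensive.

Import GRing.Theory.
Local Open Scope ring_scope.

(** A factorization can be rescaled by nonzero scalars with product 1, so over an infinite field a
    single coefficient can take infinitely many values and no nonzero polynomial annihilates them
    all. A product of one coefficient from each factor is invariant under this rescaling, which is
    why the [z] and not the [X k a] are shown to be integral; ratios of the [z] then recover each
    factor up to a scalar. Padding fixes the number of unknown factors, so one system of equations
    serves all lengths. Computing normal forms and integral equations directly would call for
    explicit bounds on cofactors. An unbounded search only asks that some certificate exists, which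
    may be proved with classical choice. The certificate found may differ from the one whose
    existence is proved, so soundness is derived from the checks alone. Completeness argues with
    generic coefficients in a free commutative algebra; soundness evaluates the checked identities
    at the coefficients of one factorization in [K]. *)

(** * Computable functions between coded types *)

(* Programs for the field operations are only specified for the trivial oracle. *)
Fixpoint plain (p : prog) : prog :=
  match p with
  | Oracle => Nil
  | Cons p q => Cons (plain p) (plain q)
  | Comp p q => Comp (plain p) (plain q)
  | If b p q => If (plain b) (plain p) (plain q)
  | While b p => While (plain b) (plain p)
  | p => p
  end.

Lemma eval_plain o p t u : eval0 p t u -> eval o (plain p) t u.
Proof.
rewrite /eval0; elim=> //=; try by (intros; econstructor; eauto).
move=> b {}p q {}t {}u v _ Hb _ Hpq; apply: eval_if Hb _.
by case: (is_node u) Hpq.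
Qed.

(** [decode] is total, and [codec_decode] asks for a program that replaces any tree by a valid code.
    The search can thus treat every tree as a candidate certificate. *)
Class Codec (T : Type) := MkCodec {
  code : T -> tree;
  decode : tree -> T;
  codeK : cancel code decode;
  codec_decode :
    exists p, forall o t, eval o p t (code (decode t)) }.

Lemma code_inj T (cT : Codec T) : injective (@code T cT).
Proof. exact: can_inj codeK. Qed.

(** One program must work under every oracle, because the final program runs with an ordering oracle
    whose other answers are arbitrary. *)
Definition computable X Y (cX : Codec X) (cY : Codec Y) (f : X -> Y) : Prop :=
  exists p, forall o x, eval o p (code x) (code (f x)).
Arguments computable {X Y cX cY} f.

#[export] Instance codec_tree : Codec tree.
Proof. by exists id id => //; exists Id => o t; constructor. Defined.

#[export] Instance codec_bool : Codec bool.
Proof.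
exists enc_bool is_node; first by case.
exists (If Id (Cons Nil Nil) Nil) => o t.
by case: t => [|a b]; (apply: eval_if; first exact: eval_id) => /=;
  repeat constructor.
Defined.

#[export] Instance codec_pair X Y (cX : Codec X) (cY : Codec Y) : Codec (X * Y).
Proof.
exists (fun x => Node (code x.1) (code x.2))
  (fun t => (decode (lson t), decode (rson t))).
- by case=> x y /=; rewrite !codeK.
- case: (@codec_decode X cX) => p Hp; case: (@codec_decode Y cY) => q Hq.
  exists (Cons (Comp p Fst) (Comp q Snd)) => o t /=.
  by constructor; econstructor; try apply: Hp; try apply: Hq; constructor.
Defined.

Fixpoint spine (t : tree) : seq tree :=
  if t is Node a b then a :: spine b else [::].

Lemma spineK t : enc_list id (spine t) = t.
Proof. by elim: t => //= a _ b ->. Qed.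

Lemma enc_listK T (f : T -> tree) (s : seq T) :
  spine (enc_list f s) = map f s.
Proof. by elim: s => //= a s ->. Qed.

(* State of the loop: [Node (Node env rest) acc]. *)
Definition fold_prog (b : prog) : prog :=
  While (Comp Snd Fst)
    (Cons (Cons (Comp Fst Fst) (Comp Snd (Comp Snd Fst)))
       (Comp b (Cons (Cons (Comp Fst Fst) Snd) (Comp Fst (Comp Snd Fst))))).

(** The encodings are plain functions and not codecs, because folding already serves to build the
    codecs of lists and numbers. *)
Lemma eval_fold E X A (e : E -> tree) (cx : X -> tree) (ca : A -> tree)
    (F : E -> A -> X -> A) o b :
  (forall v a x, eval o b (Node (Node (e v) (ca a)) (cx x)) (ca (F v a x))) ->
  forall v s a, eval o (fold_prog b) (Node (Node (e v) (enc_list cx s)) (ca a))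
    (Node (Node (e v) Leaf) (ca (foldl (F v) a s))).
Proof.
move=> Hb v; elim=> [|x s IHs] a /=.
  by apply: eval_while_stop; econstructor; constructor.
apply: eval_while_step (IHs _).
- by econstructor; constructor.
- by [].
- constructor.
    by constructor; econstructor; try econstructor; constructor.
  econstructor; last exact: Hb.
  constructor; last by econstructor; try econstructor; constructor.
  by constructor; [econstructor; constructor|constructor].
Qed.

#[export] Instance codec_seq X (cX : Codec X) : Codec (seq X).
Proof.
exists (enc_list code) (fun t => map decode (spine t)).
- by move=> s; rewrite enc_listK -map_comp (eq_map (@codeK X cX)) map_id.
- case: (@codec_decode X cX) => p Hp.
  (* Folding onto an accumulator reverses a list: one pass reverses the raw list, the next decodes
     the entries and restores their order. *)
  pose rv (q : prog) := Comp Snd (Comp (fold_prog q) (Cons (Cons Nil Id) Nil)).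
  exists (Comp (rv (Cons (Comp p Snd) (Comp Snd Fst)))
               (rv (Cons Snd (Comp Snd Fst)))) => o t.
  rewrite -[in X in eval _ _ X](spineK t).
  set s := spine t.
  pose F T := fun (_ : unit) (a : seq T) x => x :: a.
  pose G := fun (_ : unit) (a : seq X) (x : tree) => @decode X cX x :: a.
  have foldF T (a s' : seq T) : foldl (F T tt) a s' = rev s' ++ a.
    by elim: s' a => //= x s' IHs a; rewrite IHs rev_cons cat_rcons.
  have foldG a s' : foldl (G tt) a s' = map decode (rev s') ++ a.
    elim: s' a => //= x s' IHs a.
    by rewrite IHs rev_cons map_rcons cat_rcons.
  apply: (@eval_comp _ _ _ _ (enc_list id (rev s))).
    apply: eval_comp (eval_snd _ (Node _ _)).
    apply: eval_comp; first by repeat constructor.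
    rewrite -[rev s]cats0 -foldF.
    apply: (@eval_fold _ _ _ (fun=> Leaf) id (enc_list id) (F tree) o _ _
              tt s [::]) => _ a x /=.
    by repeat (econstructor; try constructor).
  apply: eval_comp (eval_snd _ (Node _ _)).
  apply: eval_comp; first by repeat constructor.
  rewrite -[map _ s]cats0 -[s]revK -foldG revK.
  apply: (@eval_fold _ _ _ (fun=> Leaf) id (enc_list code) G o _ _
            tt (rev s) [::]) => _ a x /=.
  constructor; first by econstructor; [constructor|exact: Hp].
  by repeat (econstructor; try constructor).
Defined.

#[export] Instance codec_nat : Codec nat.
Proof.
exists enc_nat (fun t => size (spine t)).
- by elim=> //= k ->.
- pose b := Cons Nil (Comp Snd Fst).
  exists (Comp Snd (Comp (fold_prog b) (Cons (Cons Nil Id) Nil))) => o t.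
  rewrite -[in X in eval _ _ X](spineK t).
  apply: eval_comp (eval_snd _ (Node _ _)).
  apply: eval_comp; first by repeat constructor.
  have -> : size (spine t) = foldl (fun a (_ : tree) => a.+1) 0%N (spine t).
    rewrite -[LHS]addn0; elim: (spine t) 0%N => //= x s IHs a.
    by rewrite addSnnS IHs.
  apply: (@eval_fold _ _ _ (fun=> Leaf) id enc_nat (fun=> fun a (_ : tree) => a.+1)
    o _ _ tt (spine t) 0%N) => _ a x /=.
  by repeat (econstructor; try constructor).
Defined.

(** * Closure properties of computable functions *)

Section Combinators.
Context {E : Type} {cE : Codec E}.
Implicit Types (X Y Z : Type).

Lemma computable_id : computable (fun e : E => e).
Proof. by exists Id => o x; constructor. Qed.

Fixpoint const_prog (t : tree) : prog :=
  if t is Node a b then Cons (const_prog a) (const_prog b) else Nil.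

Lemma computable_const Y {cY : Codec Y} (y : Y) : computable (fun _ : E => y).
Proof.
exists (const_prog (code y)) => o x.
by elim: (code y) => /= *; constructor.
Qed.

Lemma computable_comp X Y {cX : Codec X} {cY : Codec Y} (g : X -> Y) (f : E -> X) :
  computable g -> computable f -> computable (fun e => g (f e)).
Proof.
by move=> [p Hp] [q Hq]; exists (Comp p q) => o x; econstructor; eauto.
Qed.

Lemma computable_pair X Y {cX : Codec X} {cY : Codec Y}
    (f : E -> X) (g : E -> Y) :
  computable f -> computable g -> computable (fun e => (f e, g e)).
Proof. by move=> [p Hp] [q Hq]; exists (Cons p q) => o x; constructor. Qed.

Lemma computable_fst X Y {cX : Codec X} {cY : Codec Y} (f : E -> X * Y) :
  computable f -> computable (fun e => (f e).1).
Proof.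
move=> [p Hp]; exists (Comp Fst p) => o x; econstructor; first exact: Hp.
exact: (eval_fst o (Node _ _)).
Qed.

Lemma computable_snd X Y {cX : Codec X} {cY : Codec Y} (f : E -> X * Y) :
  computable f -> computable (fun e => (f e).2).
Proof.
move=> [p Hp]; exists (Comp Snd p) => o x; econstructor; first exact: Hp.
exact: (eval_snd o (Node _ _)).
Qed.

Lemma computable_if Y {cY : Codec Y} (b : E -> bool) (f g : E -> Y) :
  computable b -> computable f -> computable g ->
  computable (fun e => if b e then f e else g e).
Proof.
move=> [r Hr] [p Hp] [q Hq]; exists (If r p q) => o x.
apply: eval_if; first exact: Hr.
by rewrite /=; case: (b x) => /=.
Qed.

Lemma computable_cons Y {cY : Codec Y} (f : E -> Y) (g : E -> seq Y) :
  computable f -> computable g -> computable (fun e => f e :: g e).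
Proof. by move=> [p Hp] [q Hq]; exists (Cons p q) => o x; constructor. Qed.

Lemma computable_behead Y {cY : Codec Y} (f : E -> seq Y) :
  computable f -> computable (fun e => behead (f e)).
Proof.
move=> [p Hp]; exists (Comp Snd p) => o x; econstructor; first exact: Hp.
have -> : code (behead (f x)) = rson (code (f x)) by case: (f x).
exact: eval_snd.
Qed.

Lemma computable_nilp Y {cY : Codec Y} (f : E -> seq Y) :
  computable f -> computable (fun e => nilp (f e)).
Proof.
move=> [p Hp]; exists (If p Nil (Cons Nil Nil)) => o x.
apply: eval_if; first exact: Hp.
by case: (f x) => /= *; repeat constructor.
Qed.

Lemma computable_head Y {cY : Codec Y} (d : Y) (f : E -> seq Y) :
  computable f -> computable (fun e => head d (f e)).
Proof.
move=> [p Hp]; exists (If p (Comp Fst p) (const_prog (code d))) => o x.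
apply: eval_if; first exact: Hp.
case E1: (f x) => [|y s] /=.
  by elim: (code d) => /= *; constructor.
econstructor; first exact: Hp.
by rewrite E1; exact: (eval_fst o (Node _ _)).
Qed.

Lemma computable_foldl A X {cA : Codec A} {cX : Codec X}
    (F : E -> A -> X -> A) (a : E -> A) (s : E -> seq X) :
  computable (fun e : (E * A) * X => F e.1.1 e.1.2 e.2) ->
  computable a -> computable s ->
  computable (fun e => foldl (F e) (a e) (s e)).
Proof.
move=> [b Hb] [p Hp] [q Hq].
exists (Comp Snd (Comp (fold_prog b) (Cons (Cons Id q) p))) => o x.
apply: eval_comp (eval_snd _ (Node _ _)).
apply: eval_comp.
  by constructor; [constructor; [constructor|exact: Hq]|exact: Hp].
apply: eval_fold => v a' x'; exact: (Hb o ((v, a'), x')).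
Qed.

End Combinators.

Section Loops.
Context {X : Type} {cX : Codec X}.

Lemma eval_while_iter (b : X -> bool) (f : X -> X) o pb pf :
  (forall x, eval o pb (code x) (code (b x))) ->
  (forall x, eval o pf (code x) (code (f x))) ->
  forall k x, (forall j, (j < k)%N -> b (iter j f x)) -> ~~ b (iter k f x) ->
  eval o (While pb pf) (code x) (code (iter k f x)).
Proof.
move=> Hb Hf; elim=> [|k IHk] x Hlt Hk.
  apply: eval_while_stop; move: (Hb x).
  by rewrite /= in Hk; rewrite (negbTE Hk).
apply: eval_while_step (Hb x) _ (Hf x) _; first by rewrite (Hlt 0%N).
rewrite iterSr; apply: IHk; last by rewrite -iterSr.
by move=> j lt_jk; rewrite -iterSr; apply: Hlt.
Qed.

(** [g] is described by its loop equation, so the number of iterations stays implicit; the measure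
    [r] makes the loop stop. *)
Lemma computable_while (b : X -> bool) (f g : X -> X) (r : X -> nat) :
  computable b -> computable f ->
  (forall x, b x -> (r (f x) < r x)%N) ->
  (forall x, g x = if b x then g (f x) else x) ->
  computable g.
Proof.
move=> [pb Hb] [pf Hf] decr gE; exists (While pb pf) => o x.
have [k] := ubnP (r x); elim: k x => // k IHk x; rewrite ltnS => le_k.
rewrite gE; have := Hb o x; case: ifP => bx Hbx.
  apply: eval_while_step Hbx _ (Hf o x) (IHk _ _) => //.
  exact: leq_trans (decr _ bx) le_k.
exact: eval_while_stop.
Qed.

End Loops.

Lemma eq_computable {E : Type} {cE : Codec E} X {cX : Codec X} (f g : E -> X) :
  f =1 g -> computable f -> computable g.
Proof. by move=> eqfg [p Hp]; exists p => o x; rewrite -eqfg. Qed.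

Lemma computable_comp2 {E : Type} {cE : Codec E} X Y Z
    {cX : Codec X} {cY : Codec Y} {cZ : Codec Z}
    (h : X -> Y -> Z) (f : E -> X) (g : E -> Y) :
  computable (fun u : X * Y => h u.1 u.2) -> computable f -> computable g ->
  computable (fun e => h (f e) (g e)).
Proof.
move=> Ch Cf Cg; apply: (computable_comp Ch (f := fun e => (f e, g e))).
exact: computable_pair.
Qed.

Lemma computable_negb {E : Type} {cE : Codec E} (b : E -> bool) :
  computable b -> computable (fun e => ~~ b e).
Proof.
move=> Cb; apply: (@eq_computable _ _ _ _ (fun e => if b e then false else true)).
  by move=> e; case: (b e).
by apply: computable_if => //; apply: computable_const.
Qed.

Lemma computable_andb {E : Type} {cE : Codec E} (b c : E -> bool) :
  computable b -> computable c -> computable (fun e => b e && c e).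
Proof.
move=> Cb Cc; apply: (@eq_computable _ _ _ _ (fun e => if b e then c e else false)).
  by move=> e; case: (b e).
by apply: computable_if => //; apply: computable_const.
Qed.

Lemma computable_orb {E : Type} {cE : Codec E} (b c : E -> bool) :
  computable b -> computable c -> computable (fun e => b e || c e).
Proof.
move=> Cb Cc; apply: (@eq_computable _ _ _ _ (fun e => if b e then true else c e)).
  by move=> e; case: (b e).
by apply: computable_if => //; apply: computable_const.
Qed.

(* The hooks [computable_list], [computable_nat], ... are redefined below as more
   combinators become available. *)
Ltac computable_list := fail.
Ltac computable_step :=
  cbn beta;
  lazymatch goal with
  | |- computable (fun _ => ?y) => apply: (computable_const y)
  | |- computable (fun e => e) => apply: computable_id
  | |- computable fst => exact: (computable_fst computable_id)
  | |- computable snd => exact: (computable_snd computable_id)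
  | |- computable (fun e => (@?f e).1) => apply: (computable_fst (f := f))
  | |- computable (fun e => (@?f e).2) => apply: (computable_snd (f := f))
  | |- computable (fun e => (@?f e, @?g e)) =>
      apply: (computable_pair (f := f) (g := g))
  | |- computable (fun e => ~~ (@?b e)) => apply: (computable_negb (b := b))
  | |- computable (fun e => (@?b e) && (@?c e)) =>
      apply: (computable_andb (b := b) (c := c))
  | |- computable (fun e => (@?b e) || (@?c e)) =>
      apply: (computable_orb (b := b) (c := c))
  | |- computable (fun _ => if _ then _ else _) => apply: computable_if
  | |- computable (fun e => (@?f e) :: (@?g e)) =>
      apply: (computable_cons (f := f) (g := g))
  | |- computable (fun e => behead (@?f e)) =>
      apply: (computable_behead (f := f))
  | |- computable (fun e => nilp (@?f e)) => apply: (computable_nilp (f := f))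
  | |- computable (fun e => head ?d (@?f e)) =>
      apply: (computable_head d (f := f))
  | |- computable (fun e => foldl (@?F e) (@?a e) (@?s e)) =>
      apply: (computable_foldl (F := F) (a := a) (s := s))
  | |- _ => first [ assumption | computable_list ]
  end.
Ltac computability := repeat computable_step.

Lemma computable_rev {E : Type} {cE : Codec E} X {cX : Codec X} (s : E -> seq X) :
  computable s -> computable (fun e => rev (s e)).
Proof.
move=> Cs.
apply: (@eq_computable _ _ _ _ (fun e => foldl (fun a x => x :: a) [::] (s e))).
  move=> e; rewrite -[RHS]cats0; elim: (s e) [::] => //= x t IHt a.
  by rewrite IHt rev_cons cat_rcons.
by computability.
Qed.

Lemma computable_foldr {E : Type} {cE : Codec E} A X {cA : Codec A} {cX : Codec X}
    (F : E -> X -> A -> A) (a : E -> A) (s : E -> seq X) :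
  computable (fun e : (E * A) * X => F e.1.1 e.2 e.1.2) ->
  computable a -> computable s ->
  computable (fun e => foldr (F e) (a e) (s e)).
Proof.
move=> CF Ca Cs; apply: (@eq_computable _ _ _ _
  (fun e => foldl (fun b x => F e x b) (a e) (rev (s e)))).
  by move=> e; rewrite foldl_rev.
by computability; apply: computable_rev.
Qed.

Lemma computable_map {E : Type} {cE : Codec E} X Y {cX : Codec X} {cY : Codec Y}
    (F : E -> X -> Y) (s : E -> seq X) :
  computable (fun e : E * X => F e.1 e.2) -> computable s ->
  computable (fun e => map (F e) (s e)).
Proof.
move=> CF Cs; apply: (@eq_computable _ _ _ _
  (fun e => foldr (fun x a => F e x :: a) [::] (s e))).
  by move=> e; elim: (s e) => //= x t ->.
apply: computable_foldr; computability.
by apply: (computable_comp2 CF); computability.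
Qed.

Lemma computable_filter {E : Type} {cE : Codec E} X {cX : Codec X}
    (F : E -> X -> bool) (s : E -> seq X) :
  computable (fun e : E * X => F e.1 e.2) -> computable s ->
  computable (fun e => filter (F e) (s e)).
Proof.
move=> CF Cs; apply: (@eq_computable _ _ _ _
  (fun e => foldr (fun x a => if F e x then x :: a else a) [::] (s e))).
  by move=> e; elim: (s e) => //= x t ->.
apply: computable_foldr; computability.
by apply: (computable_comp2 CF); computability.
Qed.

Lemma computable_cat {E : Type} {cE : Codec E} X {cX : Codec X} (s t : E -> seq X) :
  computable s -> computable t -> computable (fun e => s e ++ t e).
Proof.
move=> Cs Ct; apply: (@eq_computable _ _ _ _
  (fun e => foldr (fun x a => x :: a) (t e) (s e))).
  by move=> e; elim: (s e) => //= x u ->.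
by apply: computable_foldr; computability.
Qed.

Lemma computable_flatten {E : Type} {cE : Codec E}
    X {cX : Codec X} (s : E -> seq (seq X)) :
  computable s -> computable (fun e => flatten (s e)).
Proof.
move=> Cs; apply: computable_foldr; computability.
by apply: computable_cat; computability.
Qed.

Lemma computable_all {E : Type} {cE : Codec E}
    X {cX : Codec X} (F : E -> X -> bool) (s : E -> seq X) :
  computable (fun e : E * X => F e.1 e.2) -> computable s ->
  computable (fun e => all (F e) (s e)).
Proof.
move=> CF Cs; apply: (@eq_computable _ _ _ _
  (fun e => foldr (fun x a => F e x && a) true (s e))).
  by move=> e; elim: (s e) => //= x t ->.
apply: computable_foldr; computability.
by apply: (computable_comp2 CF); computability.
Qed.

Lemma computable_has {E : Type} {cE : Codec E}
    X {cX : Codec X} (F : E -> X -> bool) (s : E -> seq X) :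
  computable (fun e : E * X => F e.1 e.2) -> computable s ->
  computable (fun e => has (F e) (s e)).
Proof.
move=> CF Cs; apply: (@eq_computable _ _ _ _
  (fun e => ~~ all (fun x => ~~ F e x) (s e))).
  by move=> e; rewrite all_predC negbK.
by computability; apply: computable_all; computability.
Qed.

Ltac computable_nat := fail.
Ltac computable_list ::=
  lazymatch goal with
  | |- computable (fun e => rev (@?s e)) => apply: (computable_rev (s := s))
  | |- computable (fun e => (@?s e) ++ (@?t e)) =>
      apply: (computable_cat (s := s) (t := t))
  | |- computable (fun e => flatten (@?s e)) =>
      apply: (computable_flatten (s := s))
  | |- computable (fun e => map (@?F e) (@?s e)) =>
      apply: (computable_map (F := F) (s := s))
  | |- computable (fun e => filter (@?F e) (@?s e)) =>
      apply: (computable_filter (F := F) (s := s))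
  | |- computable (fun e => all (@?F e) (@?s e)) =>
      apply: (computable_all (F := F) (s := s))
  | |- computable (fun e => has (@?F e) (@?s e)) =>
      apply: (computable_has (F := F) (s := s))
  | |- computable (fun e => foldr (@?F e) (@?a e) (@?s e)) =>
      apply: (computable_foldr (F := F) (a := a) (s := s))
  | |- _ => computable_nat
  end.

(* A natural number is coded as the list [nseq k Leaf] of trees. *)

Lemma code_natE k : code k = code (nseq k Leaf).
Proof. by rewrite /=; elim: k => //= k ->. Qed.

Lemma computable_nat_of_seq {E : Type} {cE : Codec E} (s : E -> seq tree) :
  computable (fun e => nseq (size (s e)) Leaf) -> computable (fun e => size (s e)).
Proof. by case=> p Hp; exists p => o e; rewrite code_natE. Qed.

Lemma computable_seq_of_nat {E : Type} {cE : Codec E} (f : E -> nat) :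
  computable f -> computable (fun e => nseq (f e) Leaf).
Proof. by case=> p Hp; exists p => o e; rewrite -code_natE. Qed.

Lemma computable_succn {E : Type} {cE : Codec E}
    (f : E -> nat) : computable f -> computable (fun e => (f e).+1).
Proof.
move=> Cf; apply: (@eq_computable _ _ _ _ (fun e => size (Leaf :: nseq (f e) Leaf))).
  by move=> e; rewrite /= size_nseq.
apply: computable_nat_of_seq; apply: (@eq_computable _ _ _ _
  (fun e => Leaf :: nseq (f e) Leaf)).
  by move=> e; rewrite /= size_nseq.
by computability; apply: computable_seq_of_nat.
Qed.

Lemma computable_predn {E : Type} {cE : Codec E}
    (f : E -> nat) : computable f -> computable (fun e => (f e).-1).
Proof.
move=> Cf; apply: (@eq_computable _ _ _ _
  (fun e => size (behead (nseq (f e) Leaf)))).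
  by move=> e; rewrite size_behead size_nseq.
apply: computable_nat_of_seq; apply: (@eq_computable _ _ _ _
  (fun e => behead (nseq (f e) Leaf))).
  by move=> e; case: (f e) => //= k; rewrite size_nseq.
by computability; apply: computable_seq_of_nat.
Qed.

Lemma computable_eqn0 {E : Type} {cE : Codec E}
    (f : E -> nat) : computable f -> computable (fun e => f e == 0%N).
Proof.
move=> Cf; apply: (@eq_computable _ _ _ _ (fun e => nilp (nseq (f e) Leaf))).
  by move=> e; case: (f e).
by computability; apply: computable_seq_of_nat.
Qed.

Lemma computable_iter {E : Type} {cE : Codec E}
    X {cX : Codec X} (k : E -> nat) (F : E -> X -> X) (x : E -> X) :
  computable (fun e : E * X => F e.1 e.2) -> computable k -> computable x ->
  computable (fun e => iter (k e) (F e) (x e)).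
Proof.
move=> CF Ck Cx; apply: (@eq_computable _ _ _ _
  (fun e => foldr (fun _ a => F e a) (x e) (nseq (k e) Leaf))).
  by move=> e; elim: (k e) => //= j ->.
computability; last exact: computable_seq_of_nat.
by apply: (computable_comp2 CF); computability.
Qed.

Lemma computable_size {E : Type} {cE : Codec E} X {cX : Codec X} (s : E -> seq X) :
  computable s -> computable (fun e => size (s e)).
Proof.
move=> Cs; apply: (@eq_computable _ _ _ _
  (fun e => foldr (fun _ a => a.+1) 0%N (s e))).
  by move=> e; elim: (s e) => //= x t ->.
by computability; apply: computable_succn; computability.
Qed.

Lemma computable_nseq {E : Type} {cE : Codec E}
    X {cX : Codec X} (k : E -> nat) (x : E -> X) :
  computable k -> computable x -> computable (fun e => nseq (k e) (x e)).
Proof.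
move=> Ck Cx; apply: (@eq_computable _ _ _ _
  (fun e => map (fun _ => x e) (nseq (k e) Leaf))).
  by move=> e; elim: (k e) => //= j ->.
computability; last exact: computable_seq_of_nat.
exact: (computable_comp Cx (computable_fst (computable_id (E := E * tree)))).
Qed.

Lemma computable_addn {E : Type} {cE : Codec E} (f g : E -> nat) :
  computable f -> computable g -> computable (fun e => (f e + g e)%N).
Proof.
move=> Cf Cg; apply: (@eq_computable _ _ _ _ (fun e => iter (f e) succn (g e))).
  by move=> e; rewrite iter_succn addnC.
by apply: computable_iter => //; apply: computable_succn; computability.
Qed.

Lemma computable_subn {E : Type} {cE : Codec E} (f g : E -> nat) :
  computable f -> computable g -> computable (fun e => (f e - g e)%N).
Proof.
move=> Cf Cg; apply: (@eq_computable _ _ _ _ (fun e => iter (g e) predn (f e))).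
  by move=> e; rewrite iter_predn.
by apply: computable_iter => //; apply: computable_predn; computability.
Qed.

Lemma computable_muln {E : Type} {cE : Codec E} (f g : E -> nat) :
  computable f -> computable g -> computable (fun e => (f e * g e)%N).
Proof.
move=> Cf Cg; apply: (@eq_computable _ _ _ _ (fun e => iter (f e) (addn (g e)) 0%N)).
  by move=> e; rewrite iter_addn_0 mulnC.
apply: computable_iter; computability; apply: computable_addn; computability.
exact: (computable_comp Cg (computable_fst (computable_id (E := E * nat)))).
Qed.

Lemma computable_leq {E : Type} {cE : Codec E} (f g : E -> nat) :
  computable f -> computable g -> computable (fun e => (f e <= g e)%N).
Proof. by move=> Cf Cg; apply: computable_eqn0; apply: computable_subn. Qed.

Lemma computable_drop {E : Type} {cE : Codec E}
    X {cX : Codec X} (k : E -> nat) (s : E -> seq X) :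
  computable k -> computable s -> computable (fun e => drop (k e) (s e)).
Proof.
move=> Ck Cs; apply: (@eq_computable _ _ _ _ (fun e => iter (k e) behead (s e))).
  by move=> e; elim: (k e) => [|j IHj]; rewrite ?drop0 //= IHj -drop1 drop_drop.
by apply: computable_iter => //; computability.
Qed.

Lemma computable_nth {E : Type} {cE : Codec E}
    X {cX : Codec X} (d : X) (s : E -> seq X) (k : E -> nat) :
  computable s -> computable k -> computable (fun e => nth d (s e) (k e)).
Proof.
move=> Cs Ck; apply: (@eq_computable _ _ _ _ (fun e => head d (drop (k e) (s e)))).
  by move=> e; rewrite -nth0 nth_drop addn0.
by computability; apply: computable_drop.
Qed.

Lemma computable_iota {E : Type} {cE : Codec E} (k l : E -> nat) :
  computable k -> computable l -> computable (fun e => iota (k e) (l e)).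
Proof.
move=> Ck Cl; apply: (@eq_computable _ _ _ _
  (fun e => rev (iter (l e) (fun s => (k e + size s)%N :: s) [::]))).
  move=> e; elim: (l e) => // j IHj; rewrite iterS rev_cons IHj.
  by rewrite -[in RHS]addn1 iotaD cats1 -size_rev IHj size_iota.
computability; apply: computable_iter; computability.
apply: computable_addn.
  exact: (computable_comp Ck (computable_fst (computable_id (E := E * seq nat)))).
by apply: computable_size; computability.
Qed.

(** * Equality of trees and exhaustive search *)

Fixpoint tree_eq (t u : tree) : bool :=
  match t, u with
  | Leaf, Leaf => true
  | Node a b, Node a' b' => tree_eq a a' && tree_eq b b'
  | _, _ => false
  end.

Lemma tree_eqP : Equality.axiom tree_eq.
Proof.
elim=> [|a IHa b IHb] [|a' b'] /=; try by constructor.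
apply: (iffP andP) => [[/IHa-> /IHb->] //|[<- <-]].
by split; [apply/IHa|apply/IHb].
Qed.

HB.instance Definition _ := hasDecEq.Build tree tree_eqP.

Fixpoint tree_size (t : tree) : nat :=
  if t is Node a b then (tree_size a + tree_size b).+1 else 1%N.

Lemma computable_lson {E : Type} {cE : Codec E} (f : E -> tree) :
  computable f -> computable (fun e => lson (f e)).
Proof.
by case=> p Hp; exists (Comp Fst p) => o x; econstructor; [exact: Hp|constructor].
Qed.

Lemma computable_rson {E : Type} {cE : Codec E} (f : E -> tree) :
  computable f -> computable (fun e => rson (f e)).
Proof.
by case=> p Hp; exists (Comp Snd p) => o x; econstructor; [exact: Hp|constructor].
Qed.

Lemma computable_Node {E : Type} {cE : Codec E} (f g : E -> tree) :
  computable f -> computable g -> computable (fun e => Node (f e) (g e)).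
Proof. by move=> [p Hp] [q Hq]; exists (Cons p q) => o x; constructor. Qed.

Lemma computable_is_node {E : Type} {cE : Codec E} (f : E -> tree) :
  computable f -> computable (fun e => is_node (f e)).
Proof.
move=> [p Hp]; exists (If p (Cons Nil Nil) Nil) => o x.
apply: eval_if; first exact: Hp.
by rewrite /=; case: (f x) => /= *; repeat constructor.
Qed.

Ltac computable_eq_step := fail.
Ltac computable_nat ::=
  lazymatch goal with
  | |- computable (fun e => iter (@?k e) (@?F e) (@?x e)) =>
      apply: (computable_iter (k := k) (F := F) (x := x))
  | |- computable (fun e => nth ?d (@?s e) (@?k e)) =>
      apply: (computable_nth d (s := s) (k := k))
  | |- computable (fun e => iota (@?k e) (@?l e)) =>
      apply: (computable_iota (k := k) (l := l))
  | |- computable (fun e => nseq (@?k e) (@?x e)) =>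
      apply: (computable_nseq (k := k) (x := x))
  | |- computable (fun e => size (@?s e)) => apply: (computable_size (s := s))
  | |- computable (fun e => (@?f e).+1) => apply: (computable_succn (f := f))
  | |- computable (fun e => (@?f e).-1) => apply: (computable_predn (f := f))
  | |- computable (fun e => ((@?f e) + (@?g e))%N) =>
      apply: (computable_addn (f := f) (g := g))
  | |- computable (fun e => ((@?f e) - (@?g e))%N) =>
      apply: (computable_subn (f := f) (g := g))
  | |- computable (fun e => ((@?f e) * (@?g e))%N) =>
      apply: (computable_muln (f := f) (g := g))
  | |- computable (fun e => ((@?f e) <= (@?g e))%N) =>
      apply: (computable_leq (f := f) (g := g))
  | |- computable (fun e => lson (@?f e)) => apply: (computable_lson (f := f))
  | |- computable (fun e => rson (@?f e)) => apply: (computable_rson (f := f))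
  | |- computable (fun e => is_node (@?f e)) =>
      apply: (computable_is_node (f := f))
  | |- computable (fun e => Node (@?f e) (@?g e)) =>
      apply: (computable_Node (f := f) (g := g))
  | |- _ => computable_eq_step
  end.

(* Comparison with a stack of pairs of subtrees that remain to be compared. *)
Lemma computable_tree_eq : computable (fun u : tree * tree => tree_eq u.1 u.2).
Proof.
pose b (s : seq (tree * tree) * bool) := ~~ nilp s.1.
pose top (s : seq (tree * tree) * bool) := head (Leaf, Leaf) s.1.
pose f (s : seq (tree * tree) * bool) : seq (tree * tree) * bool :=
  if is_node (top s).1 then
    if is_node (top s).2 then
      ((lson (top s).1, lson (top s).2) ::
         ((rson (top s).1, rson (top s).2) :: behead s.1), s.2)
    else ([::], false)
  else if is_node (top s).2 then ([::], false) else (behead s.1, s.2).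
pose g (s : seq (tree * tree) * bool) : seq (tree * tree) * bool :=
  ([::], all (fun u => tree_eq u.1 u.2) s.1 && s.2).
(* Leaves have size 1, so popping a pair of leaves also lowers the measure. *)
pose r (s : seq (tree * tree) * bool) := sumn [seq tree_size u.1 | u <- s.1].
have Cg : computable g; last first.
  apply: (@eq_computable _ _ _ _ (fun u => (g ([:: (u.1, u.2)], true)).2)).
    by move=> u; rewrite /= !andbT.
  apply: computable_snd.
  apply: (computable_comp Cg (f := fun u : tree * tree => ([:: (u.1, u.2)], true))).
  by computability.
have Ct : computable top by rewrite /top; computability.
apply: (@computable_while _ _ b f g r).
- by rewrite /b; computability.
- by rewrite /f; computability.
- case=> [[|[[|u1 u2] [|v1 v2]] s] fl] //= _; rewrite /f /r /=.
  + by rewrite addnA addSn.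
- case=> [[|[[|u1 u2] [|v1 v2]] s] fl] //=.
  by rewrite /g /f /= !andbA.
Qed.

Lemma computable_eq {E : Type} {cE : Codec E}
    (X : eqType) {cX : Codec X} (f g : E -> X) :
  computable f -> computable g -> computable (fun e => f e == g e).
Proof.
case=> [p Hp] [q Hq]; have [r Hr] := computable_tree_eq.
exists (Comp r (Cons p q)) => o x.
have -> : (f x == g x) = tree_eq (code (f x)) (code (g x)).
  apply/eqP/idP => [->|eq_t]; first exact/tree_eqP.
  by apply: (@code_inj _ cX); exact/tree_eqP.
by apply: eval_comp (Hr o (_, _)); constructor.
Qed.

(* After [k] steps from the empty list, all trees of height at most [k] are listed. *)
Definition grow (L : seq tree) : seq tree :=
  Leaf :: [seq Node a b | a <- L, b <- L].

Fixpoint height (t : tree) : nat :=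
  if t is Node a b then (maxn (height a) (height b)).+1 else 1%N.

Lemma mem_grow k t : (height t <= k)%N -> t \in iter k grow [::].
Proof.
elim: k t => [|k IHk] [|a b] //.
rewrite [height _]/= ltnS geq_max iterS /grow in_cons => /andP[/IHk ha /IHk hb].
by apply/orP; right; apply/allpairsP; exists (a, b).
Qed.

(** The witness in the hypothesis only ensures termination: the tree returned is the first accepted
    one in the first list that contains any. The input [e] is returned along with it for the later
    stages. *)
Lemma search_program {E : Type} {cE : Codec E} (check : E -> tree -> bool) :
  computable (fun e : E * tree => check e.1 e.2) ->
  exists p, forall o e, (exists t, check e t) ->
    exists2 t, check e t & eval o p (code e) (code (e, t)).
Proof.
move=> Cc.
pose b (s : E * seq tree) := ~~ has (check s.1) s.2.
pose f (s : E * seq tree) := (s.1, grow s.2).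
pose best (s : E * seq tree) :=
  (s.1, foldr (fun t a => if check s.1 t then t else a) Leaf s.2).
have [pb Hb] : computable b.
  rewrite /b; computability.
  by apply: (computable_comp2 Cc); computability.
have [pf Hf] : computable f.
  by rewrite /f /grow; computability.
have [pbest Hbest] : computable best.
  rewrite /best; computability.
  by apply: (computable_comp2 Cc); computability.
exists (Comp pbest (Comp (While pb pf) (Cons Id Nil))) => o e [t0 ct0].
have fE k : iter k f (e, [::]) = (e, iter k grow [::]).
  by elim: k => //= k ->.
(* [t0] is listed after [height t0] rounds; the loop stops at the least round that lists an accepted
   tree. *)
have exk : exists k, ~~ b (iter k f (e, [::])).
  exists (height t0); rewrite fE negbK; apply/hasP; exists t0 => //.
  exact: mem_grow.
set s := iter (ex_minn exk) f (e, [::]).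
exists (best s).2; last first.
  have -> : (e, (best s).2) = best s by rewrite /s fE.
  apply: eval_comp (Hbest _ _); apply: eval_comp.
    by constructor; [constructor|exact: eval_nil].
  apply: (eval_while_iter (x := (e, [::])) (Hb o) (Hf o)).
    move=> j; case: ex_minnP => k _ kmin lt_jk.
    by apply: contraLR lt_jk => /kmin; rewrite -leqNgt.
  by case: ex_minnP.
have: ~~ b s by rewrite /s; case: ex_minnP.
rewrite /b negbK /best {}/s fE /=.
elim: (iter _ _ _) => //= t L IHL.
by case ct: (check e t) => //= /IHL.
Qed.

Ltac computable_field_step := fail.
Ltac computable_eq_step ::=
  lazymatch goal with
  | |- computable (fun e => (@?f e) == (@?g e)) =>
      apply: (computable_eq (f := f) (g := g))
  | |- _ => computable_field_step
  end.

(** * Arithmetic of the computable field *)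

Section FieldCodec.
Variables (K : fieldType) (enc : K -> tree).
Hypothesis enc_computable : computable_field enc.

(* Trees that code no element are decoded to [0]. *)
Definition field_decode (t : tree) : K :=
  match excluded_middle_informative (exists a, enc a = t) with
  | left h => proj1_sig (constructive_indefinite_description _ h)
  | right _ => 0
  end.

Lemma field_decodeP t a : enc a = t -> enc (field_decode t) = t.
Proof.
rewrite /field_decode => ea; case: excluded_middle_informative => [h|[]].
  by case: constructive_indefinite_description.
by exists a.
Qed.

Lemma field_codeK : cancel enc field_decode.
Proof. by move=> a; apply: (cf_inj enc_computable); apply: field_decodeP. Qed.

Definition codec_field : Codec K.
Proof.
exists enc field_decode; first exact: field_codeK.
have [p Hp] := cf_dom enc_computable.
exists (If (plain p) Id (const_prog (enc 0))) => o t.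
have [[[a ea] Ht]|[nea Ht]] := Hp t.
  rewrite (field_decodeP ea).
  by apply: eval_if (eval_plain o Ht) _; constructor.
rewrite /field_decode; case: excluded_middle_informative => // _.
apply: eval_if (eval_plain o Ht) _ => /=.
by elim: (enc 0) => /= *; constructor.
Defined.

End FieldCodec.

Existing Class computable_field.
#[export] Existing Instance codec_field.

Section FieldCombinators.
Context (K : fieldType) (enc : K -> tree) {enc_computable : computable_field enc}.

Lemma computable_addK {E : Type} {cE : Codec E} (f g : E -> K) :
  computable f -> computable g -> computable (fun e => f e + g e).
Proof.
have [p Hp] := cf_add enc_computable.
apply: (computable_comp2 (h := +%R)); exists (plain p) => o [a b].
exact/eval_plain/Hp.
Qed.

Lemma computable_mulK {E : Type} {cE : Codec E} (f g : E -> K) :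
  computable f -> computable g -> computable (fun e => f e * g e).
Proof.
have [p Hp] := cf_mul enc_computable.
apply: (computable_comp2 (h := *%R)); exists (plain p) => o [a b].
exact/eval_plain/Hp.
Qed.

Lemma computable_oppK {E : Type} {cE : Codec E} (f : E -> K) :
  computable f -> computable (fun e => - f e).
Proof.
have [p Hp] := cf_opp enc_computable.
apply: (computable_comp (g := -%R)); exists (plain p) => o a.
exact/eval_plain/Hp.
Qed.

Lemma computable_invK {E : Type} {cE : Codec E} (f : E -> K) :
  computable f -> computable (fun e => (f e)^-1).
Proof.
have [p Hp] := cf_inv enc_computable.
apply: (computable_comp (g := GRing.inv)); exists (plain p) => o a.
exact/eval_plain/Hp.
Qed.

End FieldCombinators.

(** * The certificate checker *)

Section Algorithm.
Variable K : fieldType.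

Notation mon := (seq nat).
Notation letter := (nat * seq nat)%type.
Notation gcert := (seq (K * (seq nat * ((nat * nat) * seq nat)))).
Notation ccert := (seq (K * (seq letter * ((letter * letter) * seq letter)))).
Notation pcert := (seq (K * (seq letter * (mon * seq letter)))).
Notation input :=
  (nat * (seq (seq K) * (seq (seq (seq (K * mon))) * seq (K * mon))))%type.
Notation table := (seq (seq mon * (seq (K * mon) * gcert))).
Notation polycert := (seq (seq mon * (ccert * pcert))).
Notation certificate := (seq nat * (table * (seq K * polycert)))%type.

(* Monomials are exponent lists and words are lists of letters; a letter [(k, a)]
   stands for the coefficient of the monomial [a] in the [k]-th factor from the
   right. A certificate lists the weights, normal forms of products of monomials,
   the annihilating polynomial and, for each product [z], two families of
   cofactors: of commutators of letters and of the equations [prel]. *)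

Definition fcoef (X : eqType) (s : seq (K * X)) (x : X) : K :=
  foldr (fun u a => if u.2 == x then u.1 + a else a) 0 s.

(** Keys may repeat in a formal sum, so a zero sum is recognized by the total coefficient of each
    key that occurs. *)
Definition fzero (X : eqType) (s : seq (K * X)) : bool :=
  all (fun u => fcoef s u.2 == 0) s.

Definition fscale (X : Type) (k : K) (s : seq (K * X)) : seq (K * X) :=
  map (fun u => (k * u.1, u.2)) s.

(** An entry [(k, (u, (y, v)))] stands for [k * u * rel y * v], so lists of entries describe
    elements of the two-sided ideal generated by [rel]. *)
Definition expand (X Y : Type) (rel : Y -> seq (K * seq X))
    (s : seq (K * (seq X * (Y * seq X)))) : seq (K * seq X) :=
  flatten (map (fun e =>
    map (fun r => (e.1 * r.1, e.2.1 ++ (r.2 ++ e.2.2.2))) (rel e.2.2.1)) s).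

Definition lookup (X : eqType) (Y : Type) (d : Y) (s : seq (X * Y)) (x : X) : Y :=
  foldr (fun u a => if u.1 == x then u.2 else a) d s.

Definition lists_of (X : Type) (s : seq X) (k : nat) : seq (seq X) :=
  iter k (fun L => [seq x :: l | x <- s, l <- L]) [:: [::]].

Definition lists_upto (X : Type) (s : seq X) (k : nat) : seq (seq X) :=
  iter k (fun L => [::] :: [seq x :: l | x <- s, l <- L]) [:: [::]].

Definition mon_word (l : mon) : seq nat :=
  flatten (map (fun i => nseq (nth 0%N l i) i) (iota 0 (size l))).

(* In the input, the entry of row [i] and column [j] is the [i]-th item of list [j]. *)
Definition in_coef (I : input) (i j : nat) : K := nth 0 (nth [::] I.2.1 j) i.
Definition in_poly (I : input) (i j : nat) : seq (K * mon) :=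
  nth [::] (nth [::] I.2.2.1 j) i.

(** Index pairs that are out of range give the empty sum, so even a meaningless certificate denotes
    an element of the ideal. *)
Definition grel (I : input) (ij : nat * nat) : seq (K * seq nat) :=
  if (ij.1 < ij.2)%N && (ij.2 < I.1)%N then
    (1, [:: ij.2; ij.1]) :: ((- in_coef I ij.1 ij.2, [:: ij.1; ij.2]) ::
    map (fun u => (- u.1, mon_word u.2)) (in_poly I ij.1 ij.2))
  else [::].

Definition wdeg (w l : seq nat) : nat :=
  foldr addn 0%N (map (fun i => nth 0 w i * nth 0 l i)%N (iota 0 (size l))).

(** The input polynomials are arbitrary term lists. A monomial whose terms cancel is exempt, since
    only the true monomials of [d i j] are known to lie below [x_i x_j]. *)
Definition weights_ok (I : input) (w : seq nat) : bool :=
  all (fun i => 0 < nth 0 w i)%N (iota 0 I.1) &&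
  all (fun j => all (fun i => (j <= i)%N ||
         all (fun u => (fcoef (in_poly I i j) u.2 == 0) ||
                       (wdeg w u.2 <= nth 0 w i + nth 0 w j)%N) (in_poly I i j))
       (iota 0 I.1)) (iota 0 I.1).

(** Any upper bound for the weights of the monomials of [g] would serve; the sum over the given
    terms is one. *)
Definition bound (I : input) (w : seq nat) : nat :=
  foldr addn 0%N (map (fun u => wdeg w u.2) I.2.2.2).

(** Weights are positive, so this box of exponents contains every monomial of weight at most
    [bound I w]. *)
Definition mons (I : input) (w : seq nat) : seq mon :=
  lists_of (iota 0 (bound I w).+1) I.1.

Definition nf (tab : table) (b : seq mon) : seq (K * mon) :=
  (lookup ([::], [::]) tab b).1.

Definition table_ok (I : input) (S : seq mon) (D : nat) (tab : table) : bool :=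
  all (fun b =>
      all (fun u => size u.2 == I.1) (nf tab b) &&
      fzero ((1, flatten (map mon_word b)) ::
             (map (fun u => (- u.1, mon_word u.2)) (nf tab b) ++
              expand (grel I) (lookup ([::], [::]) tab b).2)))
    (lists_upto S D).

Definition zword (b : seq mon) : seq letter :=
  foldr (fun l a => (size a, l) :: a) [::] b.

(** Words of letters are compared in a free noncommutative algebra; these relations make the
    coefficients commute, and [expand] serves for them as well. *)
Definition commutator (X : Type) (u : X * X) : seq (K * seq X) :=
  [:: (1, [:: u.1; u.2]); (- 1, [:: u.2; u.1])].

Definition prel (I : input) (S : seq mon) (D : nat) (tab : table) (m : mon) :
    seq (K * seq letter) :=
  (- fcoef I.2.2.2 m, [::]) ::
  map (fun b => (fcoef (nf tab b) m, zword b)) (lists_of S D).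

Definition powers (p : seq K) (z : seq letter) : seq (K * seq letter) :=
  map (fun k => (nth 0 p k, flatten (nseq k z))) (iota 0 (size p)).

(** The test on the last coefficient excludes the zero polynomial and makes [p] the normalized
    coefficient list that the root algorithm expects. *)
Definition poly_ok (I : input) (S : seq mon) (D : nat) (tab : table)
    (p : seq K) (pc : polycert) : bool :=
  (nth 0 p (size p).-1 != 0) &&
  all (fun b =>
      fzero (powers p (zword b) ++
             (expand (prel I S D tab) (lookup ([::], [::]) pc b).2 ++
              expand (@commutator letter) (lookup ([::], [::]) pc b).1)))
    (lists_of S D).

Definition check (I : input) (c : certificate) : bool :=
  weights_ok I c.1 &&
  (table_ok I (mons I c.1) (bound I c.1) c.2.1 &&
   poly_ok I (mons I c.1) (bound I c.1) c.2.1 c.2.2.1 c.2.2.2).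

Definition elements (W : seq K) (S : seq mon) : seq (seq (K * mon)) :=
  foldr (fun l L => [seq (k, l) :: c | k <- W, c <- L]) [:: [::]] S.

(** This test is meant for members of [elements], where each monomial is listed once and entries
    cannot cancel. *)
Definition nonsc (c : seq (K * mon)) : bool :=
  has (fun u => (u.1 != 0) && has (fun a => a != 0%N) u.2) c.

Definition prodexp (cs : seq (seq (K * mon))) : seq (K * seq mon) :=
  foldr (fun c a => [seq (u.1 * v.1, u.2 :: v.2) | u <- c, v <- a])
    [:: (1, [::])] cs.

Definition nfprod (tab : table) (cs : seq (seq (K * mon))) : seq (K * mon) :=
  flatten (map (fun u => fscale u.1 (nf tab u.2)) (prodexp cs)).

Definition is_fact (I : input) (tab : table) (cs : seq (seq (K * mon))) : bool :=
  all nonsc cs && fzero (nfprod tab cs ++ fscale (- 1) I.2.2.2).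

(* The first scaled factor has coefficients in [V], the others in [V / V]. *)
Definition facts (I : input) (c : certificate) (V : seq K) :
    seq (seq (seq (K * mon))) :=
  filter (is_fact I c.2.1)
    (lists_upto (elements (V ++ [seq u * v^-1 | u <- V, v <- V]) (mons I c.1))
       (bound I c.1)).

Section Computability.
Context (enc : K -> tree) {enc_computable : computable_field enc}.

Ltac computable_sum := fail.
Ltac computable_field_step ::=
  lazymatch goal with
  | |- computable (fun e => (@?f e) + (@?g e)) =>
      apply: (computable_addK (f := f) (g := g))
  | |- computable (fun e => (@?f e) * (@?g e)) =>
      apply: (computable_mulK (f := f) (g := g))
  | |- computable (fun e => - (@?f e)) => apply: (computable_oppK (f := f))
  | |- computable (fun e => (@?f e)^-1) => apply: (computable_invK (f := f))
  | |- _ => computable_sum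
  end.

Lemma computable_fcoef {E : Type} {cE : Codec E} (X : eqType) (cX : Codec X)
    (s : E -> seq (K * X)) (x : E -> X) :
  computable s -> computable x -> computable (fun e => fcoef (s e) (x e)).
Proof.
move=> Cs Cx; apply: (computable_comp2 (h := @fcoef X)) => //.
by rewrite /fcoef; computability.
Qed.

Lemma computable_fzero {E : Type} {cE : Codec E} (X : eqType) (cX : Codec X)
    (s : E -> seq (K * X)) :
  computable s -> computable (fun e => fzero (s e)).
Proof.
move=> Cs; apply: (computable_comp (g := @fzero X)) => //.
rewrite /fzero; computability; apply: computable_fcoef; computability.
Qed.

Ltac computable_words := fail.
Ltac computable_sum ::=
  lazymatch goal with
  | |- computable (fun e => fcoef (@?s e) (@?x e)) =>
      apply: (computable_fcoef (s := s) (x := x))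
  | |- computable (fun e => fzero (@?s e)) =>
      apply: (computable_fzero (s := s))
  | |- _ => computable_words
  end.

Lemma computable_fscale {E : Type} {cE : Codec E} (X : Type) (cX : Codec X)
    (k : E -> K) (s : E -> seq (K * X)) :
  computable k -> computable s -> computable (fun e => fscale (k e) (s e)).
Proof.
move=> Ck Cs; apply: (computable_comp2 (h := @fscale X)) => //.
by rewrite /fscale; computability.
Qed.

Lemma computable_lookup {E : Type} {cE : Codec E} (X : eqType) (Y : Type)
    (cX : Codec X) (cY : Codec Y) (d : Y) (s : E -> seq (X * Y)) (x : E -> X) :
  computable s -> computable x -> computable (fun e => lookup d (s e) (x e)).
Proof.
move=> Cs Cx; apply: (computable_comp2 (h := @lookup X Y d)) => //.
by rewrite /lookup; computability.
Qed.

Lemma computable_lists_of {E : Type} {cE : Codec E} (X : Type) (cX : Codec X)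
    (s : E -> seq X) (k : E -> nat) :
  computable s -> computable k -> computable (fun e => lists_of (s e) (k e)).
Proof.
move=> Cs Ck; apply: (computable_comp2 (h := @lists_of X)) => //.
by rewrite /lists_of; computability.
Qed.

Lemma computable_lists_upto {E : Type} {cE : Codec E} (X : Type) (cX : Codec X)
    (s : E -> seq X) (k : E -> nat) :
  computable s -> computable k -> computable (fun e => lists_upto (s e) (k e)).
Proof.
move=> Cs Ck; apply: (computable_comp2 (h := @lists_upto X)) => //.
by rewrite /lists_upto; computability.
Qed.

Lemma computable_expand {E : Type} {cE : Codec E} (X Y : Type)
    (cX : Codec X) (cY : Codec Y) (rel : E -> Y -> seq (K * seq X))
    (s : E -> seq (K * (seq X * (Y * seq X)))) :
  computable (fun u : E * Y => rel u.1 u.2) -> computable s ->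
  computable (fun e => expand (rel e) (s e)).
Proof.
move=> Cr Cs; rewrite /expand; computability.
by apply: (computable_comp2 Cr); computability.
Qed.

Lemma computable_mon_word {E : Type} {cE : Codec E} (l : E -> mon) :
  computable l -> computable (fun e => mon_word (l e)).
Proof.
move=> Cl; apply: (computable_comp (g := mon_word)) => //.
by rewrite /mon_word; computability.
Qed.

Lemma computable_wdeg {E : Type} {cE : Codec E} (w l : E -> seq nat) :
  computable w -> computable l -> computable (fun e => wdeg (w e) (l e)).
Proof.
move=> Cw Cl; apply: (computable_comp2 (h := wdeg)) => //.
by rewrite /wdeg; computability.
Qed.

Ltac computable_words ::=
  lazymatch goal with
  | |- computable (fun e => fscale (@?k e) (@?s e)) =>
      apply: (computable_fscale (k := k) (s := s))
  | |- computable (fun e => lookup ?d (@?s e) (@?x e)) =>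
      apply: (computable_lookup d (s := s) (x := x))
  | |- computable (fun e => lists_of (@?s e) (@?k e)) =>
      apply: (computable_lists_of (s := s) (k := k))
  | |- computable (fun e => lists_upto (@?s e) (@?k e)) =>
      apply: (computable_lists_upto (s := s) (k := k))
  | |- computable (fun e => expand (@?r e) (@?s e)) =>
      apply: (computable_expand (rel := r) (s := s))
  | |- computable (fun e => mon_word (@?l e)) =>
      apply: (computable_mon_word (l := l))
  | |- computable (fun e => wdeg (@?w e) (@?l e)) =>
      apply: (computable_wdeg (w := w) (l := l))
  end.

Lemma computable_grel : computable (fun u : input * (nat * nat) => grel u.1 u.2).
Proof. by rewrite /grel /in_coef /in_poly; computability. Qed.

Lemma computable_weights_ok :
  computable (fun u : input * seq nat => weights_ok u.1 u.2).
Proof. by rewrite /weights_ok /in_poly; computability. Qed.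

Lemma computable_bound : computable (fun u : input * seq nat => bound u.1 u.2).
Proof. by rewrite /bound; computability. Qed.

Lemma computable_mons : computable (fun u : input * seq nat => mons u.1 u.2).
Proof.
rewrite /mons; computability.
by apply: (computable_comp2 computable_bound); computability.
Qed.

Lemma computable_table_ok : computable
  (fun u : ((input * seq mon) * nat) * table => table_ok u.1.1.1 u.1.1.2 u.1.2 u.2).
Proof.
rewrite /table_ok /nf; computability.
by apply: (computable_comp2 computable_grel); computability.
Qed.

Lemma computable_zword : computable zword.
Proof. by rewrite /zword; computability. Qed.

Lemma computable_poly_ok : computable
  (fun u : ((((input * seq mon) * nat) * table) * seq K) * polycert =>
     poly_ok u.1.1.1.1.1 u.1.1.1.1.2 u.1.1.1.2 u.1.1.2 u.1.2 u.2).
Proof.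
rewrite /poly_ok /powers /prel /commutator /nf; computability;
  by apply: (computable_comp computable_zword); computability.
Qed.

Lemma computable_check : computable (fun u : input * certificate => check u.1 u.2).
Proof.
have Cb : computable (fun u : input * certificate => bound u.1 u.2.1).
  by apply: (computable_comp2 computable_bound); computability.
have Cm : computable (fun u : input * certificate => mons u.1 u.2.1).
  by apply: (computable_comp2 computable_mons); computability.
rewrite /check; computability.
- by apply: (computable_comp2 computable_weights_ok); computability.
- apply: (computable_comp computable_table_ok (f := fun u : input * certificate =>
    (u.1, mons u.1 u.2.1, bound u.1 u.2.1, u.2.2.1))).
  by computability.
- apply: (computable_comp computable_poly_ok (f := fun u : input * certificate =>
    (u.1, mons u.1 u.2.1, bound u.1 u.2.1, u.2.2.1, u.2.2.2.1, u.2.2.2.2))).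
  by computability.
Qed.

Lemma computable_is_fact : computable
  (fun u : (input * table) * seq (seq (K * mon)) => is_fact u.1.1 u.1.2 u.2).
Proof. by rewrite /is_fact /nonsc /nfprod /prodexp /nf; computability. Qed.

Lemma computable_facts : computable
  (fun u : (input * certificate) * seq K => facts u.1.1 u.1.2 u.2).
Proof.
rewrite /facts /elements; computability.
- apply: (computable_comp computable_is_fact (f :=
    fun u : ((input * certificate) * seq K) * seq (seq (K * mon)) =>
    (u.1.1.1, u.1.1.2.2.1, u.2))).
  by computability.
- by apply: (computable_comp2 computable_mons); computability.
- by apply: (computable_comp2 computable_bound); computability.
Qed.

(** Of the certificate [c] only [check I c] is retained, since the search may stop at any accepted
    one. The root algorithm is specified for the trivial oracle, hence [plain r]. *)
Lemma factorization_program : has_root_algorithm enc ->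
  exists P : prog, forall o (I : input), (exists c, check I c) ->
    exists (c : certificate) (V : seq K),
      [/\ check I c, forall a, (a \in V) = root (Poly c.2.2.1) a
        & eval o P (code I) (code (facts I c V))].
Proof.
case=> r Hr.
have Cdec : computable (fun t : tree => decode t : certificate).
  by have [p Hp] := @codec_decode certificate _; exists p => o t; apply: Hp.
have [ps Hps] := @search_program input _ (fun I t => check I (decode t))
  (computable_comp2 computable_check (computable_fst computable_id)
     (computable_comp Cdec (computable_snd computable_id))).
have [pf Hpf] := computable_facts.
have [pd Hpd] : computable (fun u : input * tree => (u.1, decode u.2 : certificate)).
  by computability; apply: (computable_comp Cdec); computability.
have [pp Hpp] : computable (fun u : input * certificate => u.2.2.2.1).
  by computability.
exists (Comp pf (Comp (Cons Id (Comp (plain r) pp)) (Comp pd ps))) => o I [c0 Hc0].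
have [|t Ht Hev] := Hps o I.
  by exists (code c0); rewrite codeK.
set c : certificate := decode t in Ht.
(* The checked last coefficient is nonzero, so [Poly] truncates nothing and the list in the
   certificate already codes the polynomial. *)
have pE : Poly c.2.2.1 = c.2.2.1 :> seq K.
  apply: (@PolyK _ 1); case/andP: Ht => _ /andP[_ /andP[]].
  by case: (c.2.2.1) => [|a s] /=; rewrite ?eqxx // nth_last.
have p_neq0 : Poly c.2.2.1 != 0.
  rewrite -size_poly_eq0 pE; case/andP: Ht => _ /andP[_ /andP[]].
  by case: (c.2.2.1) => [|a s] //=; rewrite eqxx.
have [V [HrV HV]] := Hr _ p_neq0.
exists c, V; split=> //.
apply: eval_comp (Hpf o ((I, c), V)).
apply: eval_comp; first by apply: eval_comp Hev (Hpd o (I, t)).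
constructor; first exact: eval_id.
apply: eval_comp; first exact: (Hpp o (I, c)).
by move: (eval_plain o HrV); rewrite pE.
Qed.

End Computability.
End Algorithm.

(** * Formal sums and the free algebra *)

Section FormalSums.
Variable K : fieldType.

Definition feval (X : Type) (V : lmodType K) (b : X -> V) (s : seq (K * X)) : V :=
  \sum_(u <- s) u.1 *: b u.2.

Definition weval (T : Type) (A : pzRingType) (f : T -> A) (w : seq T) : A :=
  \prod_(i <- w) f i.

Section Lmod.
Variable V : lmodType K.

Lemma feval_nil X (b : X -> V) : feval b [::] = 0.
Proof. exact: big_nil. Qed.

Lemma feval_cons X (b : X -> V) u s : feval b (u :: s) = u.1 *: b u.2 + feval b s.
Proof. exact: big_cons. Qed.

Lemma feval_cat X (b : X -> V) s t : feval b (s ++ t) = feval b s + feval b t.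
Proof. exact: big_cat. Qed.

Lemma feval_flatten X (b : X -> V) ss :
  feval b (flatten ss) = \sum_(s <- ss) feval b s.
Proof.
elim: ss => [|s ss IHs]; first by rewrite big_nil feval_nil.
by rewrite /= feval_cat big_cons IHs.
Qed.

Lemma feval_oppmap X Y (b : Y -> V) (f : X -> Y) (s : seq (K * X)) :
  feval b [seq (- u.1, f u.2) | u <- s] = - feval (b \o f) s.
Proof.
by rewrite /feval big_map -sumrN; apply: eq_bigr => u _; rewrite scaleNr.
Qed.

Lemma feval_scale X (b : X -> V) k s : feval b (fscale k s) = k *: feval b s.
Proof.
by rewrite /feval big_map scaler_sumr; apply: eq_bigr => u _; rewrite scalerA.
Qed.

Lemma eq_in_feval (X : eqType) (b c : X -> V) (s : seq (K * X)) :
  (forall u, u \in s -> b u.2 = c u.2) -> feval b s = feval c s.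
Proof. by move=> eq_bc; apply: eq_big_seq => u /eq_bc->. Qed.

Lemma fcoefE (X : eqType) (s : seq (K * X)) x :
  fcoef s x = \sum_(u <- s | u.2 == x) u.1.
Proof.
by rewrite unlock /fcoef /=; elim: s => //= u s ->.
Qed.

Lemma feval_fcoef (X : eqType) (b : X -> V) (s : seq (K * X)) :
  feval b s = \sum_(x <- undup (map snd s)) fcoef s x *: b x.
Proof.
under [RHS]eq_bigr do rewrite fcoefE scaler_suml.
rewrite (exchange_big_dep predT) //=; apply: eq_big_seq => u us.
rewrite -big_filter (_ : [seq _ <- _ | _] = [:: u.2]) ?big_seq1 //.
rewrite (eq_filter (a2 := pred1 u.2)) => [|x]; last exact: eq_sym.
by rewrite filter_pred1_uniq ?undup_uniq // mem_undup map_f.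
Qed.

(** This is how checked identities are exploited: a formal sum that cancels vanishes under every
    interpretation of its keys. *)
Lemma fzero_feval (X : eqType) (b : X -> V) (s : seq (K * X)) :
  fzero s -> feval b s = 0.
Proof.
move/allP=> s0; rewrite feval_fcoef big_seq big1 // => x.
by rewrite mem_undup => /mapP[u us ->]; rewrite (eqP (s0 u us)) scale0r.
Qed.

Lemma fzeroP (X : eqType) (s : seq (K * X)) :
  reflect (forall x, fcoef s x = 0) (fzero s).
Proof.
apply: (iffP allP) => [s0 x|s0 u _]; last by rewrite s0.
have [/mapP[u us ->]|xs] := boolP (x \in map snd s); first exact/eqP/s0.
rewrite fcoefE big_seq_cond big1 // => u /andP[us /eqP xu].
by rewrite -xu map_f in xs.
Qed.

End Lmod.

Section Algebra.
Variable A : algType K.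

Lemma weval_cat T (f : T -> A) u v : weval f (u ++ v) = weval f u * weval f v.
Proof. exact: big_cat. Qed.

Lemma weval_flatten T (f : T -> A) ws :
  weval f (flatten ws) = \prod_(w <- ws) weval f w.
Proof.
elim: ws => [|w ws IHw]; first by rewrite /weval !big_nil.
by rewrite /= weval_cat big_cons IHw.
Qed.

Lemma weval_nseq T (f : T -> A) k i : weval f (nseq k i) = f i ^+ k.
Proof. by rewrite /weval big_nseq -Monoid.iteropE. Qed.

Lemma feval_expand X Y (f : X -> A) (rel : Y -> seq (K * seq X)) s :
  feval (weval f) (expand rel s) =
  \sum_(e <- s) e.1 *: (weval f e.2.1 * feval (weval f) (rel e.2.2.1)
                        * weval f e.2.2.2).
Proof.
rewrite feval_flatten big_map; apply: eq_bigr => e _.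
rewrite /feval big_map mulr_sumr mulr_suml scaler_sumr; apply: eq_bigr => r _.
by rewrite !weval_cat -scalerA -scalerAr -scalerAl mulrA.
Qed.

End Algebra.
End FormalSums.

Section Lists.

Lemma mem_lists_of (X : eqType) (s : seq X) k (l : seq X) :
  (l \in lists_of s k) = (size l == k) && all (mem s) l.
Proof.
elim: k l => [|k IHk] [|x l] //=.
  by apply/negbTE/allpairsP => -[u []].
rewrite eqSS; apply/allpairsP/idP => [[[y m] /= [sy mk [-> ->]]]|].
  by move: mk; rewrite IHk sy andbCA.
by rewrite andbCA => /andP[sx ml]; exists (x, l); rewrite IHk.
Qed.

Lemma lists_of_uniq (X : eqType) (s : seq X) k : uniq s -> uniq (lists_of s k).
Proof.
move=> us; elim: k => //= k IHk.
by apply: allpairs_uniq => // -[x l] [y m] _ _ [-> ->].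
Qed.

Lemma mem_lists_upto (X : eqType) (s : seq X) k (l : seq X) :
  (l \in lists_upto s k) = (size l <= k)%N && all (mem s) l.
Proof.
elim: k l => [|k IHk] [|x l] //=.
rewrite in_cons /= ltnS; apply/allpairsP/idP => [[[y m] /= [sy mk [-> ->]]]|].
  by move: mk; rewrite IHk sy andbCA.
by rewrite andbCA => /andP[sx ml]; exists (x, l); rewrite IHk.
Qed.

End Lists.

Lemma mon_word_letters l : all (fun i => i < size l)%N (mon_word l).
Proof.
apply/allP => i /flattenP[s /mapP[j]]; rewrite mem_iota add0n => /andP[_ lt_j] ->.
by case/nseqP => ->.
Qed.

(** * Words, exponent lists and standard monomials *)

Section GAlgebra.
Variables (K : fieldType) (n : nat) (A : algType K) (x : 'I_n -> A).

(** Letters are natural numbers so that the type of words does not depend on [n]; a letter out of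
    range is sent to 0. *)
Definition xvar (i : nat) : A := if insub i is Some j then x j else 0.

Lemma xvarE (i : 'I_n) : xvar i = x i.
Proof. by rewrite /xvar valK. Qed.

Definition to_mon (l : seq nat) : 'X_{1..n} := [multinom nth 0%N l i | i < n].
Definition of_mon (a : 'X_{1..n}) : seq nat := [seq a i | i <- enum 'I_n].

Lemma size_of_mon a : size (of_mon a) = n.
Proof. by rewrite size_map size_enum_ord. Qed.

Lemma nth_of_mon a (i : 'I_n) : nth 0%N (of_mon a) i = a i.
Proof.
by rewrite (nth_map i) ?size_enum_ord // nth_ord_enum.
Qed.

Lemma of_monK : cancel of_mon to_mon.
Proof. by move=> a; apply/mnmP => i; rewrite mnmE nth_of_mon. Qed.

Lemma to_monK l : size l = n -> of_mon (to_mon l) = l.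
Proof.
move=> sl; apply: (@eq_from_nth _ 0%N); rewrite size_of_mon // => i lt_in.
by rewrite (nth_of_mon _ (Ordinal lt_in)) mnmE.
Qed.

Lemma weval_mon_word l : size l = n -> weval xvar (mon_word l) = stdmon x (to_mon l).
Proof.
move=> sl; rewrite /mon_word weval_flatten big_map sl /stdmon.
rewrite -[n in iota _ n]subn0 -/(index_iota 0 n) big_mkord.
by apply: eq_bigr => i _; rewrite weval_nseq xvarE mnmE.
Qed.

Lemma weval_of_mon a : weval xvar (mon_word (of_mon a)) = stdmon x a.
Proof. by rewrite weval_mon_word ?size_of_mon // of_monK. Qed.

Lemma stdpolyEw (s : seq 'X_{1..n}) (p : {mpoly K[n]}) :
  uniq s -> {subset msupp p <= s} ->
  stdpoly x p = \sum_(a <- s) p@_a *: stdmon x a.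
Proof.
move=> us sub; rewrite /stdpoly [RHS](bigID (mem (msupp p))) /=
  addrC [X in _ = X + _]big1 ?add0r.
  rewrite -[RHS]big_filter; apply: perm_big; apply: uniq_perm; rewrite ?filter_uniq //.
  by move=> a; rewrite mem_filter; case: (boolP (a \in msupp p)) => //= /sub->.
by move=> a /memN_msupp_eq0->; rewrite scale0r.
Qed.

Lemma stdpoly_is_linear : linear (stdpoly x : {mpoly K[n]} -> A).
Proof.
move=> k p q; set s := undup (msupp p ++ msupp q ++ msupp (k *: p + q)).
have us : uniq s by rewrite undup_uniq.
rewrite !(@stdpolyEw s) //; try by move=> a ha; rewrite mem_undup !mem_cat ha ?orbT.
rewrite scaler_sumr -big_split; apply: eq_bigr => a _ /=.
by rewrite mcoeffD mcoeffZ scalerDl scalerA.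
Qed.

HB.instance Definition _ :=
  GRing.isLinear.Build K {mpoly K[n]} A _ (stdpoly x : {mpoly K[n]} -> A) stdpoly_is_linear.

Lemma stdpolyD p q : stdpoly x (p + q) = stdpoly x p + stdpoly x q.
Proof. exact: linearD. Qed.

Lemma stdpolyB p q : stdpoly x (p - q) = stdpoly x p - stdpoly x q.
Proof. exact: linearB. Qed.

Lemma stdpolyZ k p : stdpoly x (k *: p) = k *: stdpoly x p.
Proof. exact: linearZ. Qed.

Lemma stdpolyX a : stdpoly x 'X_[a] = stdmon x a.
Proof. by rewrite /stdpoly msuppX big_seq1 mcoeffX eqxx scale1r. Qed.

Lemma stdpoly_terms (s : terms K n) :
  stdpoly x (poly_of_terms s) = feval (stdmon x) s.
Proof.
by rewrite /poly_of_terms linear_sum; apply: eq_bigr => u _; rewrite linearZ /= stdpolyX.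
Qed.

End GAlgebra.

Lemma malgU_scale (K : fieldType) (M : monomType) (k : K) (m : M) :
  mkmalgU m k = k *: (mkmalgU m 1 : @malg M K).
Proof. by apply/malgP => v; rewrite monalg.mcoeffZ !mcoeffU mulrnAr mulr1. Qed.

Section FreeAlgebra.
Variables (K : fieldType) (I : choiceType).

(** An alias to carry the full algebra structure: [freealg] is typed as an [lalgType] only, and
    evaluation of certificates also moves scalars past the left factor. *)
Definition freeA : Type := @malg (fmonom I) K.
HB.instance Definition _ := GRing.Lalgebra.on freeA.

Definition fword (w : seq I) : freeA := mkmalgU (FMonom w) 1.

Lemma fword_cat u v : fword (u ++ v) = fword u * fword v.
Proof.
rewrite /fword [RHS]fgmulUU mulr1; congr mkmalgU.
by rewrite /mmul /= fmmulE.
Qed.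

Lemma freeA_decomp (f : freeA) :
  exists s : seq (K * seq I), f = feval fword s.
Proof.
exists [seq (monalg.mcoeff w f, fmonom_val w) | w <- finmap.enum_fset (monalg.msupp f)].
rewrite [LHS]monalgE /feval big_map; apply: eq_bigr => w _ /=.
by rewrite /fword fmK; exact: malgU_scale.
Qed.

Fact freeA_scaleAr (k : K) (f g : freeA) : k *: (f * g) = f * (k *: g).
Proof.
have [s ->] := freeA_decomp f; have [t ->] := freeA_decomp g.
rewrite /feval !mulr_suml scaler_sumr; apply: eq_bigr => u _.
rewrite mulr_sumr !scaler_sumr mulr_sumr; apply: eq_bigr => v _.
have E (a b : K) (p q : seq I) :
    (a *: fword p) * (b *: fword q) = (a * b) *: fword (p ++ q).
  rewrite -(malgU_scale a (FMonom p)) -(malgU_scale b (FMonom q)).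
  rewrite -(malgU_scale (a * b) (FMonom (p ++ q))).
  apply: etrans (fgmulUU a b (FMonom p) (FMonom q)) _.
  exact (congr1 (fun m => mkmalgU m (a * b)) (fmmulE (FMonom p) (FMonom q))).
by rewrite (scalerA k) (E u.1 v.1) (E u.1 (k * v.1)) (scalerA k) mulrCA.
Qed.

HB.instance Definition _ := GRing.Lalgebra_isAlgebra.Build K freeA freeA_scaleAr.

Lemma fword_weval w : fword w = weval (fun i => fword [:: i]) w.
Proof.
elim: w => [|i w IHw]; last by rewrite -cat1s fword_cat weval_cat IHw /weval big_seq1.
by rewrite /weval big_nil /fword; congr mkmalgU; rewrite /mone /= fmoneE.
Qed.

Lemma fcoef_fword (s : seq (K * seq I)) w :
  fcoef s w = monalg.mcoeff (FMonom w) (feval fword s).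
Proof.
rewrite fcoefE raddf_sum /= big_mkcond; apply: eq_bigr => u _.
rewrite monalg.mcoeffZ /fword mcoeffU -val_eqE /=.
by case: eqP; rewrite ?mulr1 ?mulr0.
Qed.

Lemma fzero_fword (s : seq (K * seq I)) : feval fword s = 0 -> fzero s.
Proof. by move=> s0; apply/fzeroP => w; rewrite fcoef_fword s0 raddf0. Qed.

(* The concrete free algebra is only used through this lemma: its operations
   must not be unfolded by unification. *)
Lemma free_algebra : exists (F : algType K) (b : seq I -> F),
  [/\ b [::] = 1, forall u v, b (u ++ v) = b u * b v,
      forall f, exists s, f = feval b s
    & forall s, feval b s = 0 -> fzero s].
Proof.
exists (freeA : algType K), fword; split.
- by rewrite fword_weval /weval big_nil.
- exact: fword_cat.
- exact: freeA_decomp.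
- exact: fzero_fword.
Qed.

End FreeAlgebra.

Section FreeEvaluation.
Variables (K : fieldType) (n : nat) (A : algType K) (x : 'I_n -> A).

Definition fmonom_eval (w : fmonom 'I_n) : A := \prod_(i <- fmonom_val w) x i.

Lemma fmonom_eval_mmorphism : mmorphism fmonom_eval.
Proof.
split=> [u v|]; first by rewrite /fmonom_eval /mmul /= fmmulE big_cat.
by rewrite /fmonom_eval /mone /= fmoneE big_nil.
Qed.

HB.instance Definition _ :=
  monalg.isMultiplicative.Build (fmonom 'I_n) A fmonom_eval fmonom_eval_mmorphism.

Lemma freevalE f : freeval x f = monalg.mmap (in_alg A) fmonom_eval f.
Proof. by []. Qed.

Lemma freevalD f g : freeval x (f + g) = freeval x f + freeval x g.
Proof. by rewrite !freevalE raddfD. Qed.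

Lemma freeval_sum (J : Type) (r : seq J) (F : J -> freealg K n) :
  freeval x (\sum_(j <- r) F j) = \sum_(j <- r) freeval x (F j).
Proof. by rewrite !freevalE raddf_sum. Qed.

Lemma freevalB f g : freeval x (f - g) = freeval x f - freeval x g.
Proof. by rewrite !freevalE raddfB. Qed.

Lemma freevalM f g : freeval x (f * g) = freeval x f * freeval x g.
Proof.
have [|H _] := @monalg.commr_mmap_is_multiplicative _ _ _ (in_alg A) fmonom_eval.
  by move=> h w v; rewrite /GRing.comm /= mulr_algl mulr_algr.
by rewrite !freevalE H.
Qed.

Lemma freevalZ k f : freeval x (k *: f) = k *: freeval x f.
Proof. by rewrite !freevalE monalg.mmapZ /= mulr_algl. Qed.

(* Explicit arguments keep unification from unfolding the products. *)
Lemma freeval_relation k (f1 f2 f3 f4 f5 : freealg K n) :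
  freeval x (f1 * f2 - (k *: (f3 * f4) + f5)) =
  freeval x f1 * freeval x f2
  - (k *: (freeval x f3 * freeval x f4) + freeval x f5).
Proof.
rewrite (freevalB (f1 * f2)) (freevalD (k *: (f3 * f4))) (freevalZ k (f3 * f4)).
congr (_ - (k *: _ + _)); exact: freevalM.
Qed.

Lemma freeval_mul3 (f1 f2 f3 : freealg K n) :
  freeval x (f1 * f2 * f3) = freeval x f1 * freeval x f2 * freeval x f3.
Proof.
by apply: etrans (freevalM _ _) _; congr (_ * _); apply: freevalM.
Qed.

Lemma freeval_fword w : freeval x (fword K w) = weval x w.
Proof. by rewrite freevalE monalg.mmapU /= scale1r mul1r. Qed.

Lemma freeval_fvar i : freeval x (fvar K i) = x i.
Proof. by rewrite freevalE monalg.mmapU /= scale1r mul1r /fmonom_eval fmuE big_seq1. Qed.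

Lemma freeval_fvarX i k : freeval x (fvar K i ^+ k) = x i ^+ k.
Proof.
elim: k => [|k IHk]; last by rewrite !exprS freevalM freeval_fvar IHk.
by rewrite !expr0 freevalE monalg.mmap1.
Qed.

Lemma freeval_stdmon a : freeval x (stdmon (@fvar K n) a) = stdmon x a.
Proof.
rewrite /stdmon; elim/big_ind2: _ => [|f p g q <- <-|i _].
- by rewrite freevalE monalg.mmap1.
- exact: freevalM.
- exact: freeval_fvarX.
Qed.

Lemma freeval_stdpoly p : freeval x (stdpoly (@fvar K n) p) = stdpoly x p.
Proof.
rewrite /stdpoly freeval_sum; apply: eq_bigr => a _.
by rewrite freevalZ freeval_stdmon.
Qed.

End FreeEvaluation.

Section ExpandIdeal.
Variables (K : fieldType) (I Y : Type) (F : algType K) (b : seq I -> F).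
Hypotheses (b_nil : b [::] = 1) (b_cat : forall u v, b (u ++ v) = b u * b v).
Hypothesis b_span : forall f, exists s, f = feval b s.
Variable rel : Y -> seq (K * seq I).
Notation gens f := (exists s, feval b (expand rel s) = f).

Lemma word_weval w : b w = weval (fun i => b [:: i]) w.
Proof.
elim: w => [|i w IHw]; first by rewrite /weval big_nil.
by rewrite -cat1s b_cat weval_cat IHw /weval big_seq1.
Qed.

Lemma feval_expand_word s :
  feval b (expand rel s) =
  \sum_(e <- s) e.1 *: (b e.2.1 * feval b (rel e.2.2.1) * b e.2.2.2).
Proof.
have E : feval b =1 feval (weval (fun i => b [:: i])).
  by move=> t; apply: eq_bigr => u _; rewrite word_weval.
rewrite E feval_expand; apply: eq_bigr => e _.
by rewrite -!word_weval -E.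
Qed.

Lemma expand_gensD f g : gens f -> gens g -> gens (f + g).
Proof.
case=> [s <-] [t <-]; exists (s ++ t).
by rewrite !feval_expand_word big_cat.
Qed.

Lemma expand_gensZ k f : gens f -> gens (k *: f).
Proof.
case=> [s <-]; exists [seq (k * e.1, e.2) | e <- s].
rewrite !feval_expand_word big_map scaler_sumr.
by apply: eq_bigr => e _; rewrite scalerA.
Qed.

Lemma expand_gens_sum (J : eqType) (r : seq J) (G : J -> F) :
  (forall j, j \in r -> gens (G j)) -> gens (\sum_(j <- r) G j).
Proof.
elim: r => [|j r IHr] H.
  by exists [::]; rewrite feval_expand_word !big_nil.
rewrite big_cons; apply: expand_gensD; first by apply: H; rewrite mem_head.
by apply: IHr => k kr; apply: H; rewrite in_cons kr orbT.
Qed.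

(** Expanding both cofactors into words turns a membership with arbitrary cofactors into a
    certificate, whose cofactors are words. *)
Lemma expand_gensM y f g : gens (f * feval b (rel y) * g).
Proof.
have [s ->] := b_span f; have [t ->] := b_span g.
exists [seq (u.1 * v.1, (u.2, (y, v.2))) | u <- s, v <- t].
rewrite feval_expand_word big_allpairs_dep {2 4}/feval.
rewrite !mulr_suml; apply: eq_bigr => u _.
rewrite mulr_sumr; apply: eq_bigr => v _ /=.
by rewrite -!scalerAl -scalerAr scalerA.
Qed.

End ExpandIdeal.

(** * Input data and the presentation by generators and relations *)

Section Input.
Variables (K : fieldType) (n : nat).
Variables (c : 'I_n -> 'I_n -> K) (d : 'I_n -> 'I_n -> {mpoly K[n]}).
Variable ds : 'I_n -> 'I_n -> terms K n.
Hypothesis ds_d : forall i j : 'I_n, (i < j)%N -> poly_of_terms (ds i j) = d i j.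
Variable gs : terms K n.

Definition of_terms (s : terms K n) : seq (K * seq nat) :=
  [seq (u.1, of_mon u.2) | u <- s].

Definition upper T (F : 'I_n -> 'I_n -> T) : seq (seq T) :=
  [seq [seq F i j | i : 'I_n <- enum 'I_n & (i < j)%N] | j : 'I_n <- enum 'I_n].

Definition input_data :
    nat * (seq (seq K) * (seq (seq (seq (K * seq nat))) * seq (K * seq nat))) :=
  (n, (upper c, (upper (fun i j => of_terms (ds i j)), of_terms gs))).

Lemma nth_upper T (F : 'I_n -> 'I_n -> T) z (i j : 'I_n) : (i < j)%N ->
  nth z (nth [::] (upper F) j) i = F i j.
Proof.
move=> lt_ij; rewrite (nth_map j) ?size_enum_ord // nth_ord_enum.
have E : [seq k : 'I_n <- enum 'I_n | (k < j)%N] = take j (enum 'I_n).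
  apply: (inj_map val_inj); rewrite map_take val_enum_ord take_iota.
  rewrite (minn_idPl (ltnW (ltn_ord j))).
  rewrite (_ : map _ _ = [seq k <- map val (enum 'I_n) | (k < j)%N]).
    by rewrite val_enum_ord -[j : nat]add0n filter_iota_ltn ?add0n // ltnW.
  by rewrite filter_map.
rewrite E (nth_map i) ?size_take ?size_enum_ord ?(ltn_ord j) //.
by rewrite nth_take // nth_ord_enum.
Qed.

Lemma in_coef_data (i j : 'I_n) : (i < j)%N -> in_coef input_data i j = c i j.
Proof. exact: nth_upper. Qed.

Lemma in_poly_data (i j : 'I_n) : (i < j)%N -> in_poly input_data i j = of_terms (ds i j).
Proof. exact: nth_upper. Qed.

Lemma feval_of_terms (B : algType K) (y : 'I_n -> B) (s : terms K n) :
  feval (weval (xvar y) \o mon_word) (of_terms s) = stdpoly y (poly_of_terms s).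
Proof.
rewrite stdpoly_terms /feval big_map; apply: eq_bigr => u _ /=.
by rewrite weval_of_mon.
Qed.

Lemma feval_grel (B : algType K) (y : 'I_n -> B) (i j : 'I_n) : (i < j)%N ->
  feval (weval (xvar y)) (grel input_data (val i, val j)) =
  y j * y i - (c i j *: (y i * y j) + stdpoly y (d i j)).
Proof.
move=> lt_ij; rewrite /grel /= lt_ij ltn_ord /= !feval_cons /=.
rewrite feval_oppmap in_poly_data // feval_of_terms ds_d // in_coef_data //.
by rewrite /weval !big_cons !big_nil !mulr1 !xvarE scale1r scaleNr opprD.
Qed.

Lemma grel_cases (ij : nat * nat) :
  grel input_data ij = [::] \/
  exists i j : 'I_n, (i < j)%N /\ ij = (val i, val j).
Proof.
case: ij => i j; rewrite /grel /=; case: ifP => [/andP[lt_ij lt_jn]|_]; last by left.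
by right; exists (Ordinal (ltn_trans lt_ij lt_jn)), (Ordinal lt_jn).
Qed.

Section Presented.
Variables (A : algType K) (x : 'I_n -> A).
Hypothesis A_pres : presented c d x.

Lemma G_relation_freeval (i j : 'I_n) : (i < j)%N ->
  x j * x i = c i j *: (x i * x j) + stdpoly x (d i j).
Proof.
move=> lt_ij; apply/eqP; rewrite -subr_eq0; apply/eqP.
pose f := fvar K j * fvar K i
        - (c i j *: (fvar K i * fvar K j) + stdpoly (@fvar K n) (d i j)).
suff <- : freeval x f = 0.
  by rewrite freeval_relation !freeval_fvar freeval_stdpoly.
apply/(A_pres.2 f); exists [:: (1, f, 1)]; split.
  by move=> u; rewrite inE => /eqP->; exists i, j.
by rewrite big_seq1 mul1r mulr1.
Qed.

Lemma grel_eval0 ij : feval (weval (xvar x)) (grel input_data ij) = 0.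
Proof.
have [->|[i [j [lt_ij ->]]]] := grel_cases ij; first exact: feval_nil.
by rewrite feval_grel // G_relation_freeval // subrr.
Qed.

(** By the presentation, the difference of a word and its normal form lies in the ideal of the
    relations. Evaluating this membership in a free algebra on the letters [nat] gives the
    cofactors, and freeness there turns the identity into a cancellation that [fzero] sees. *)
Lemma ideal_cert_exists (w : seq nat) (q : {mpoly K[n]}) :
  all (fun i => i < n)%N w -> weval (xvar x) w = stdpoly x q ->
  exists crt, fzero ((1, w) ::
    [seq (- u.1, mon_word u.2) | u <- [seq (q@_a, of_mon a) | a <- msupp q]]
    ++ expand (grel input_data) crt).
Proof.
move=> wn wq.
have [w' w'E] : exists w' : seq 'I_n, map val w' = w.
  exists (pmap insub w); rewrite (pmap_filter (insubK _)).
  by apply/all_filterP; apply: sub_all wn => i lt_in /=; rewrite insubT.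
pose f := fword K w' - stdpoly (@fvar K n) q.
have [s [sG fE]] : in_ideal (G_relation c d) f.
  apply/(A_pres.2 f); rewrite freevalB freeval_fword freeval_stdpoly -wq.
  apply/eqP; rewrite subr_eq0 -w'E /weval big_map; apply/eqP.
  by apply: eq_bigr => i _; rewrite xvarE.
have [F [b [b_nil b_cat b_span b_free]]] := free_algebra K nat.
pose y (i : 'I_n) : F := b [:: val i].
have weE v : all (fun i => i < n)%N v -> weval (xvar y) v = b v.
  move=> /allP vn; rewrite (word_weval b_nil b_cat); apply: eq_big_seq => i /vn lt_in.
  by rewrite -[i]/(val (Ordinal lt_in)) xvarE.
have rE (i j : 'I_n) : (i < j)%N ->
    feval b (grel input_data (val i, val j)) =
    freeval y (fvar K j * fvar K i
        - (c i j *: (fvar K i * fvar K j) + stdpoly (@fvar K n) (d i j))).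
  move=> lt_ij; rewrite freeval_relation !freeval_fvar.
  rewrite freeval_stdpoly -feval_grel //.
  apply: eq_in_feval => u; rewrite /grel /= lt_ij ltn_ord /= !inE => hu.
  have nn (k : 'I_n) := ltn_ord k.
  rewrite weE //; move/orP: hu => [/eqP uE|/orP[/eqP uE|]]; rewrite ?uE /= ?nn //.
  case/mapP => v; rewrite in_poly_data // => /mapP[t _ ->] -> /=.
  by have := mon_word_letters (of_mon t.2); rewrite size_of_mon.
have [crt crtE] : exists crt, feval b (expand (grel input_data) crt)
    = - 1 *: freeval y f.
  apply: expand_gensZ => //; rewrite fE freeval_sum; apply: expand_gens_sum => // u us.
  rewrite freeval_mul3; have [i [j [lt_ij ->]]] := sG u us.
  by rewrite -rE //; apply: expand_gensM.
exists crt; apply: b_free.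
rewrite feval_cons feval_cat crtE scaleN1r scale1r feval_oppmap /=.
rewrite freevalB freeval_fword freeval_stdpoly.
have -> : weval y w' = b w.
  rewrite -weE // -w'E /weval big_map; apply: eq_bigr => i _.
  by rewrite xvarE.
suff -> : feval (b \o mon_word) [seq (q@_a, of_mon a) | a <- msupp q]
   = stdpoly y q by rewrite opprB addKr subrr.
rewrite /feval big_map; apply: eq_bigr => a _ /=; congr (_ *: _).
rewrite -weval_of_mon weE //.
by have := mon_word_letters (of_mon a); rewrite size_of_mon.
Qed.

End Presented.
End Input.

(** * Leading monomials *)

Section Orderings.
Variables (K : fieldType) (n : nat) (lt : rel 'X_{1..n}).
Hypothesis lt_mo : monomial_ordering lt.

Lemma mo_total_cases a b : [\/ a = b, lt a b | lt b a].
Proof.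
have [->|/(mo_total lt_mo)/orP[]] := eqVneq a b; first by apply: Or31.
  by apply: Or32.
by apply: Or33.
Qed.

Lemma mo_asym a b : lt a b -> lt b a = false.
Proof.
move=> ab; apply/negP => ba.
by have := mo_trans lt_mo ab ba; rewrite (mo_irr lt_mo).
Qed.

Lemma mo_mull a b m : lt a b -> lt (m + a)%MM (m + b)%MM.
Proof. by rewrite ![(m + _)%MM]addmC; apply: mo_mul. Qed.

Lemma mo_add a b a' b' : lt a a' -> lt b b' -> lt (a + b)%MM (a' + b')%MM.
Proof.
by move=> la lb; apply: (mo_trans lt_mo (mo_mul lt_mo b la)); apply: mo_mull.
Qed.

(* An infinite descending chain [0 > a > 2a > ...] would contradict
   well-foundedness. *)
Lemma mo_ge0 a : a != 0%MM -> lt 0%MM a.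
Proof.
move=> a0; have [a0'|//|la] := mo_total_cases 0%MM a.
  by rewrite -a0' eqxx in a0.
suff H m : forall k, m = (a *+ k)%MM -> False by case: (H _ 0%N erefl).
elim/(well_founded_ind (mo_wf lt_mo)): m => m IHm k mE.
apply: (IHm (a *+ k.+1)%MM _ k.+1) => //; rewrite mE mulmS.
by have := mo_mul lt_mo (a *+ k)%MM la; rewrite add0m.
Qed.

Lemma lead_exists (p : {mpoly K[n]}) : p != 0 -> exists a, lead_monomial lt p a.
Proof.
rewrite -msupp_eq0 => p0.
have [a ha Ha] : exists2 a, a \in msupp p &
    forall b, b \in msupp p -> b != a -> lt b a.
  elim: (msupp p) p0 => // b [|b' s] IHs _.
    by exists b; rewrite ?mem_head // => m; rewrite inE => /eqP->; rewrite eqxx.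
  have [//|a ha Ha] := IHs.
  have [ab|ab|ba] := mo_total_cases a b.
  - exists a; first by rewrite in_cons ha orbT.
    by move=> m; rewrite in_cons -ab => /orP[->//|]; apply: Ha.
  - exists b; first by rewrite mem_head.
    move=> m; rewrite in_cons => /orP[->//|/Ha {}Ha] _.
    have [->//|/Ha] := eqVneq m a.
    by move=> ma; apply: mo_trans ab.
  - exists a; first by rewrite in_cons ha orbT.
    move=> m; rewrite in_cons => /orP[/eqP->//|]; exact: Ha.
by exists a; split.
Qed.

End Orderings.

(** * Rewriting words to standard monomials *)

Section WordExponents.
Variable n : nat.

Definition expo (w : seq nat) : 'X_{1..n} := [multinom count_mem (i : nat) w | i < n].

Lemma expo_cat u v : expo (u ++ v) = (expo u + expo v)%MM.
Proof. by apply/mnmP => i; rewrite !mnmE count_cat. Qed.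

Lemma count_flatten_nseq (T : eqType) (f : T -> nat) (s : seq T) k : uniq s ->
  count_mem k (flatten [seq nseq (f i) i | i <- s]) = (f k * (k \in s))%N.
Proof.
elim: s => [|i s IHs] /=; first by rewrite muln0.
case/andP => is_ us; rewrite count_cat IHs // count_nseq in_cons /= [k == i]eq_sym.
have [ik|_] := eqVneq i k; last by rewrite mul0n add0n.
by rewrite -ik (negbTE is_) muln0 addn0 mul1n muln1.
Qed.

Lemma count_mon_word l k : count_mem k (mon_word l) = nth 0%N l k.
Proof.
rewrite /mon_word (@count_flatten_nseq _ (nth 0%N l)) ?iota_uniq //.
rewrite mem_iota add0n leq0n; case: ltnP => [_|le_k]; first by rewrite muln1.
by rewrite nth_default.
Qed.

Lemma expo_of_mon a : expo (mon_word (of_mon a)) = a.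
Proof. by apply/mnmP => i; rewrite mnmE count_mon_word nth_of_mon. Qed.

Lemma sorted_mon_word l : sorted leq (mon_word l).
Proof.
rewrite sorted_pairwise; last exact: leq_trans.
rewrite /mon_word; elim: (size l) {2}0%N => //= k IHk m.
rewrite pairwise_cat IHk andbT; apply/andP; split.
  apply/allrelP => i j /nseqP[-> _] /flattenP[s /mapP[h]].
  by rewrite mem_iota => /andP[lt_mh _] -> /nseqP[-> _]; apply: ltnW.
apply/(pairwiseP 0%N) => i j; rewrite !inE size_nseq => lt_i lt_j _.
by rewrite !nth_nseq lt_i lt_j.
Qed.

(** The words without descents, where rewriting [x_j x_i] to [x_i x_j] stops, are the standard
    monomials. *)
Lemma sorted_word_unique w : all (fun i => i < n)%N w -> sorted leq w ->
  w = mon_word (of_mon (expo w)).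
Proof.
move=> /allP wn sw; apply: (sorted_eq leq_trans anti_leq) => //.
  exact: sorted_mon_word.
apply/allP => k _ /=; rewrite count_mon_word; apply/eqP.
have [lt_kn|le_nk] := ltnP k n.
  by rewrite (nth_of_mon _ (Ordinal lt_kn)) mnmE.
rewrite nth_default ?size_of_mon //; apply/count_memPn.
by apply/negP => /wn; rewrite ltnNge le_nk.
Qed.

Fixpoint inversions (w : seq nat) : nat :=
  if w is i :: v then (count (fun j => j < i) v + inversions v)%N else 0%N.

Lemma inversions_swap u i j v : (i < j)%N ->
  inversions (u ++ j :: i :: v) = (inversions (u ++ i :: j :: v)).+1.
Proof.
move=> lt_ij; elim: u => [|k u IHu] /=.
  by rewrite lt_ij [(j < i)%N]ltnNge (ltnW lt_ij) /= add0n add1n addSn addnCA.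
rewrite IHu addnS !count_cat /=; congr (_ + _).+1; congr (_ + _)%N.
exact: addnCA.
Qed.

Lemma unsorted_word w : ~~ sorted leq w ->
  exists u i j v, (i < j)%N /\ w = u ++ j :: i :: v.
Proof.
elim: w => // j [|i v] //= IHw; rewrite negb_and => /orP[|/IHw].
  by rewrite -ltnNge => lt_ij; exists [::], i, j, v.
by case=> u [i' [j' [v' [lt_ij ->]]]]; exists (j :: u), i', j', v'.
Qed.

End WordExponents.

Section LeadingTerms.
Variables (K : fieldType) (n : nat).
Variables (c : 'I_n -> 'I_n -> K) (d : 'I_n -> 'I_n -> {mpoly K[n]}).
Variables (A : algType K) (x : 'I_n -> A).
Hypothesis c_neq0 : forall i j : 'I_n, (i < j)%N -> c i j != 0.
Hypothesis A_pres : presented c d x.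
Variable lt : rel 'X_{1..n}.
Hypothesis lt_adm : admissible d lt.
Let lt_mo := lt_adm.1.

Definition below (m : 'X_{1..n}) (f : A) : Prop :=
  exists2 r, f = stdpoly x r & forall b, b \in msupp r -> lt b m.

Lemma below0 m : below m 0.
Proof. by exists 0; rewrite ?linear0 // msupp0. Qed.

Lemma belowD m f g : below m f -> below m g -> below m (f + g).
Proof.
move=> [r -> Hr] [s -> Hs]; exists (r + s); rewrite ?stdpolyD // => b.
by move/msuppD_le; rewrite mem_cat => /orP[/Hr|/Hs].
Qed.

Lemma belowZ m k f : below m f -> below m (k *: f).
Proof.
move=> [r -> Hr]; exists (k *: r); rewrite ?stdpolyZ // => b.
by move/msuppZ_le/Hr.
Qed.

Lemma below_sum m (J : eqType) (r : seq J) (F : J -> A) :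
  (forall j, j \in r -> below m (F j)) -> below m (\sum_(j <- r) F j).
Proof.
by move=> H; rewrite big_seq; elim/big_ind: _ => //;
  [exact: below0 | exact: belowD].
Qed.

Lemma below_trans m m' f : lt m m' -> below m f -> below m' f.
Proof.
move=> mm [r -> Hr]; exists r => // b /Hr bm; exact: (mo_trans lt_mo bm mm).
Qed.

Lemma below_stdmon m a : lt a m -> below m (stdmon x a).
Proof. by exists 'X_[a]; rewrite ?stdpolyX // => b; rewrite msuppX inE => /eqP->. Qed.

Definition leads (m : 'X_{1..n}) (f : A) : Prop :=
  exists2 k : K, k != 0 & below m (f - k *: stdmon x m).

Lemma leads_below m m' f : lt m m' -> leads m f -> below m' f.
Proof.
move=> mm [k _ Hk]; rewrite -[f](subrK (k *: stdmon x m)).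
apply: belowD; first exact: below_trans Hk.
exact/belowZ/below_stdmon.
Qed.

(** Well-founded induction on the exponent, then induction on inversions. Sorting one descent [j i]
    multiplies by the nonzero [c i j] and removes an inversion; the terms from [d i j] have smaller
    exponents by admissibility. *)
Lemma word_leads w : all (fun i => i < n)%N w -> leads (expo n w) (weval (xvar x) w).
Proof.
move: {2}(expo n w) (erefl (expo n w)) => m.
elim/(well_founded_ind (mo_wf lt_mo)): m w => m IHm w.
have [k] := ubnP (inversions w); elim: k w => // k IHk w le_k wm wn.
have [sw|] := boolP (sorted leq w).
  exists 1; rewrite ?oner_neq0 // [X in weval _ X](sorted_word_unique wn sw).
  rewrite weval_of_mon.
  by rewrite scale1r subrr; exact: below0.
case/unsorted_word => u [i [j [v [lt_ij wE]]]].
have [ui [jn [iN vn]]] : [/\ all (fun i => i < n)%N u, j < n, i < n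
    & all (fun i => i < n)%N v]%N.
  by move: wn; rewrite wE all_cat /= => /and4P[].
pose w' := u ++ i :: j :: v.
have w'm : expo n w' = m.
  rewrite -wm wE; apply/mnmP => h; rewrite !mnmE !count_cat /=.
  by congr (_ + _)%N; apply: addnCA.
have [k1 k1_neq0 Hk1] : leads (expo n w') (weval (xvar x) w').
  apply: IHk; rewrite ?w'm //.
    by move: le_k; rewrite wE inversions_swap // ltnS.
  by rewrite all_cat /= ui jn iN vn.
have relE := G_relation_freeval A_pres (i := Ordinal iN) (j := Ordinal jn) lt_ij.
set q := d _ _ in relE; set cij := c _ _ in relE.
have -> : weval (xvar x) w = cij *: weval (xvar x) w' +
    \sum_(a <- msupp q) q@_a *: weval (xvar x) (u ++ (mon_word (of_mon a) ++ v)).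
  rewrite wE -[j :: i :: v]/([:: j; i] ++ v) -[w']/(u ++ ([:: i; j] ++ v)).
  have W2 p q' : weval (xvar x) [:: p; q'] = xvar x p * xvar x q'.
    by rewrite /weval !big_cons big_nil mulr1.
  rewrite !weval_cat !W2.
  have E (h : nat) (hn : (h < n)%N) : xvar x h = x (Ordinal hn) by rewrite -xvarE.
  rewrite !(E i iN) !(E j jn) relE mulrDl mulrDr -scalerAl -scalerAr.
  congr (_ + _); rewrite /stdpoly mulr_suml mulr_sumr; apply: eq_bigr => a _.
  by rewrite weval_cat weval_cat weval_of_mon -scalerAl -scalerAr.
exists (cij * k1); first by rewrite mulf_neq0 // c_neq0.
rewrite wm addrAC -scalerA -scalerBr; apply: belowD.
  by apply: belowZ; rewrite -w'm.
apply: below_sum => a qa; apply: belowZ.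
set w2 := u ++ _.
have w2n : all (fun i => i < n)%N w2.
  rewrite !all_cat ui vn andbT /=.
  by have := mon_word_letters (of_mon a); rewrite size_of_mon.
have lt_w2 : lt (expo n w2) m.
  rewrite -wm wE -[j :: i :: v]/([:: j; i] ++ v) !expo_cat expo_of_mon.
  apply/mo_mull/(mo_mul lt_mo) => //.
  have [q0|[b [_ lead_b] lt_b]] := lt_adm.2 (Ordinal iN) (Ordinal jn) lt_ij.
    by rewrite /q q0 msupp0 in qa.
  have -> : expo n [:: j; i] = (U_(Ordinal iN) + U_(Ordinal jn))%MM.
    by apply/mnmP => h; rewrite !mnmE /= addn0 addnC.
  have [->//|/(lead_b _ qa) lt_ab] := eqVneq a b.
  exact: mo_trans lt_ab lt_b.
exact: leads_below lt_w2 (IHm _ lt_w2 w2 erefl w2n).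
Qed.

Lemma stdmon_mul_leads a b : leads (a + b)%MM (stdmon x a * stdmon x b).
Proof.
rewrite -!weval_of_mon -weval_cat.
have -> : (a + b)%MM = expo n (mon_word (of_mon a) ++ mon_word (of_mon b)).
  by rewrite expo_cat !expo_of_mon.
apply: word_leads; rewrite all_cat.
have := mon_word_letters (of_mon a); have := mon_word_letters (of_mon b).
by rewrite !size_of_mon => -> ->.
Qed.

(** Leading monomials add as for commutative polynomials because the [c i j] are nonzero. This
    additivity is what bounds the factors of [g]. *)
Lemma lead_mul p q a b : lead_monomial lt p a -> lead_monomial lt q b ->
  leads (a + b)%MM (stdpoly x p * stdpoly x q).
Proof.
move=> [pa Ha] [qb Hb].
have dec (r : {mpoly K[n]}) m : lead_monomial lt r m ->
    below m (stdpoly x r - r@_m *: stdmon x m).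
  move=> [rm Hm]; exists (r - r@_m *: 'X_[m]); first by rewrite stdpolyB stdpolyZ stdpolyX.
  move=> h; rewrite mcoeff_msupp mcoeffB mcoeffZ mcoeffX.
  have [<-|mh] := eqVneq m h; first by rewrite mulr1 subrr eqxx.
  by rewrite mulr0 subr0 -mcoeff_msupp => /Hm; apply; rewrite eq_sym.
have mulb m1 m2 f g : below m1 f -> below m2 g -> below (m1 + m2)%MM (f * g).
  move=> [r -> Hr] [s -> Hs]; rewrite /stdpoly mulr_suml.
  apply: below_sum => i ir; rewrite mulr_sumr; apply: below_sum => j js.
  rewrite -scalerAl -scalerAr; do 2!apply: belowZ.
  by apply: leads_below (stdmon_mul_leads i j); apply: (mo_add lt_mo); [apply: Hr|apply: Hs].
have mulbl m1 m2 f : below m1 f -> below (m1 + m2)%MM (f * stdmon x m2).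
  move=> [r -> Hr]; rewrite /stdpoly mulr_suml.
  apply: below_sum => i ir; rewrite -scalerAl; apply: belowZ.
  by apply: leads_below (stdmon_mul_leads i m2); apply: mo_mul => //; apply: Hr.
have mulbr m1 m2 f : below m2 f -> below (m1 + m2)%MM (stdmon x m1 * f).
  move=> [r -> Hr]; rewrite /stdpoly mulr_sumr.
  apply: below_sum => i ir; rewrite -scalerAr; apply: belowZ.
  by apply: leads_below (stdmon_mul_leads m1 i); apply: mo_mull => //; apply: Hr.
have [k k0 Hk] := stdmon_mul_leads a b.
have {dec} [Da Db] := (dec p a (conj pa Ha), dec q b (conj qb Hb)).
exists (p@_a * q@_b * k).
  by rewrite !mulf_neq0 // -mcoeff_msupp.
set f := stdpoly x p in Da *; set g := stdpoly x q in Db *.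
(* Split each factor into leading term and remainder. Three products involve a remainder and are
   smaller; the product of the leading terms is controlled by [stdmon_mul_leads]. *)
have -> : f * g - (p@_a * q@_b * k) *: stdmon x (a + b)%MM =
  (f - p@_a *: stdmon x a) * (g - q@_b *: stdmon x b)
  + q@_b *: ((f - p@_a *: stdmon x a) * stdmon x b)
  + p@_a *: (stdmon x a * (g - q@_b *: stdmon x b))
  + (p@_a * q@_b) *: (stdmon x a * stdmon x b - k *: stdmon x (a + b)%MM).
  have E (R1 R2 P Q M : A) (k1 k2 : K) :
    (R1 + k1 *: P) * (R2 + k2 *: Q) - (k1 * k2 * k) *: M =
    R1 * R2 + k2 *: (R1 * Q) + k1 *: (P * R2) + (k1 * k2) *: (P * Q - k *: M).
    rewrite mulrDl !mulrDr -!scalerAl -!scalerAr scalerBr !scalerA.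
    by rewrite !addrA.
  by rewrite -E !subrK.
apply: belowD; last by apply: belowZ.
apply: belowD; last by apply: belowZ; apply: mulbr.
apply: belowD; last by apply: belowZ; apply: mulbl.
exact: mulb.
Qed.

End LeadingTerms.

(** * Integrality of the products of coefficients *)

Section LexicographicDigits.
Variable B : nat.

(** The value in base [B], most significant digit first: it turns the lexicographic order of bounded
    sequences into the order of numbers. *)
Fixpoint digits_value (N : nat) (d : nat -> nat) : nat :=
  if N is N'.+1 then (d 0 * B ^ N' + digits_value N' (fun k => d k.+1))%N else 0%N.

Lemma digits_value_lt N d : (forall k, (k < N)%N -> (d k < B)%N) ->
  (digits_value N d < B ^ N)%N.
Proof.
elim: N d => //= N IHN d dB.
have {}IHN := IHN (fun k => d k.+1) (fun k lt_k => dB k.+1 lt_k).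
apply: leq_trans (_ : (d 0).+1 * B ^ N <= _)%N; last first.
  by rewrite expnS leq_mul2r dB // orbT.
by rewrite mulSn addnC ltn_add2r.
Qed.

(** The digits of [d] after position [p] together amount to less than one unit of the digit at
    [p]. *)
Lemma digits_value_mono N d d' p : (p < N)%N ->
  (forall k, (k < N)%N -> (d k < B)%N) ->
  (forall k, (k < p)%N -> (d k <= d' k)%N) -> (d p < d' p)%N ->
  (digits_value N d < digits_value N d')%N.
Proof.
elim: N d d' p => //= N IHN d d' [_|p lt_pN] dB le_dd' lt_dd'.
  apply: leq_trans (leq_addr _ _).
  apply: leq_trans (_ : (d 0).+1 * B ^ N <= _)%N; last by rewrite leq_mul2r lt_dd' orbT.
  by rewrite mulSn addnC ltn_add2r digits_value_lt // => k lt_k; apply: dB.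
rewrite -addnS; apply: leq_add; first by rewrite leq_mul2r le_dd' ?orbT.
apply: (IHN (fun k => d k.+1) (fun k => d' k.+1) p) => //.
  by move=> k lt_k; apply: dB.
by move=> k lt_k; apply: le_dd'.
Qed.

(** Ranks in decreasing order are dual to counts. Counts change by at most one when an entry is
    replaced, so sorted lists can be compared without describing insertion. *)
Lemma nth_sort_geq v (s : seq nat) k : (k < size s)%N ->
  (v <= nth 0 (sort geq s) k)%N = (k < count (leq v) s)%N.
Proof.
have tr : transitive geq by move=> a b c /= ba ac; exact: leq_trans ac ba.
rewrite -(size_sort geq) -(permP (permEl (perm_sort geq s)) (leq v)).
have: sorted geq (sort geq s) by apply: sort_sorted => a b; exact: leq_total.
elim: (sort geq s) k => //= y l IHl k; rewrite (path_sortedE tr) => /andP[/allP ly sl].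
have c0 : (v <= y)%N = false -> count (leq v) l = 0%N.
  move=> vy; apply/eqP; rewrite -leqn0 leqNgt -has_count; apply/hasP => -[z /ly zy vz].
  by rewrite (leq_trans vz zy) in vy.
case: k => [_|k]; last first.
  rewrite ltnS => lt_k; rewrite /= IHl //; case vy: (v <= y)%N; first by rewrite add1n ltnS.
  by rewrite c0.
by case vy: (v <= y)%N => //=; rewrite c0.
Qed.

End LexicographicDigits.

Section Span.
Variables (K : fieldType) (L : lmodType K).

Definition kspan (P : L -> Prop) (y : L) : Prop :=
  exists2 s : seq (K * L), (forall u, u \in s -> P u.2) &
    y = \sum_(u <- s) u.1 *: u.2.

Lemma kspan0 P : kspan P 0.
Proof. by exists [::]; rewrite ?big_nil. Qed.

Lemma kspanD P y z : kspan P y -> kspan P z -> kspan P (y + z).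
Proof.
move=> [s Hs ->] [t Ht ->]; exists (s ++ t); last by rewrite big_cat.
by move=> u; rewrite mem_cat => /orP[/Hs|/Ht].
Qed.

Lemma kspanZ P k y : kspan P y -> kspan P (k *: y).
Proof.
move=> [s Hs ->]; exists [seq (k * u.1, u.2) | u <- s].
  by move=> _ /mapP[u us ->]; apply: Hs us.
by rewrite big_map scaler_sumr; apply: eq_bigr => u _; rewrite scalerA.
Qed.

Lemma kspan_gen (P : L -> Prop) y : P y -> kspan P y.
Proof.
by move=> Py; exists [:: (1, y)]; rewrite ?big_seq1 ?scale1r // => u; rewrite inE => /eqP->.
Qed.

Lemma kspan_sum P (J : eqType) (r : seq J) (F : J -> L) :
  (forall j, j \in r -> kspan P (F j)) -> kspan P (\sum_(j <- r) F j).
Proof.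
by move=> H; rewrite big_seq; elim/big_ind: _ => //; [exact: kspan0|exact: kspanD].
Qed.

Lemma kspan_sub (P Q : L -> Prop) y :
  (forall z, P z -> kspan Q z) -> kspan P y -> kspan Q y.
Proof.
by move=> PQ [s Hs ->]; apply: kspan_sum => u /Hs /PQ; apply: kspanZ.
Qed.

End Span.

Lemma kspan_linear (K : fieldType) (L M : lmodType K) (f : L -> M) P Q y :
  linear f -> (forall z, P z -> kspan Q (f z)) -> kspan P y -> kspan Q (f y).
Proof.
move=> lf PQ [s Hs ->].
have f0 : f 0 = 0.
  by have := lf 1 0 0; rewrite scale1r addr0 -[f 0]addr0 scale1r addr0 => /eqP;
     rewrite -[X in X == _]addr0 (inj_eq (addrI _)) eq_sym => /eqP.
elim: s Hs => [|u s IHs] Hs; first by rewrite big_nil f0; apply: kspan0.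
rewrite big_cons lf; apply: kspanD.
  by apply/kspanZ/PQ/Hs; rewrite mem_head.
by apply: IHs => v vs; apply: Hs; rewrite in_cons vs orbT.
Qed.

(* A form of the Dedekind-Mertens lemma for twisted products: only the
   position [lead i j] of the leading term of each product is used. *)
Section DedekindMertens.
Variables (K : fieldType) (L : comAlgType K) (M : Type).
Variables (a b : nat) (f t : nat -> L) (m : nat -> nat -> M -> K).
Variable lead : nat -> nat -> M.
Hypothesis lead_neq0 : forall i j, (i < a)%N -> (j < b)%N -> m i j (lead i j) != 0.
Hypothesis lead_max : forall i j i' j', (i < a)%N -> (j < b)%N -> (i' < a)%N ->
  (j' < b)%N -> m i' j' (lead i j) != 0 ->
  [\/ (i', j') = (i, j), (i < i')%N | (j < j')%N].

Definition product_coef (u : M) : L :=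
  \sum_(p <- [seq (i, j) | i <- iota 0 a, j <- iota 0 b]) m p.1 p.2 u *: (f p.1 * t p.2).

Definition dm_target (N : nat) (y : L) : Prop :=
  exists s u, [/\ size s = N, all (fun i => i < a)%N s
                & y = (\prod_(i <- s) f i) * product_coef u].

(* The product is rewritten with the leading relation of [f i * t j], where [i]
   is the entry of rank [b - 1 - j] of [s] in decreasing order; the other terms
   of the relation strictly increase the sequence of pairs
   ([k]-th largest entry of [s], [b - 1 - j <= k]) for the lexicographic order. *)
Lemma dedekind_mertens N s j : (b <= N.+1)%N -> size s = N.+1 ->
  all (fun i => i < a)%N s -> (j < b)%N ->
  kspan (dm_target N) ((\prod_(i <- s) f i) * t j).
Proof.
(* Entries are at most [a], so a digit, twice an entry plus a bit, is below [2a + 2]. Doubling lets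
   the bit decide only between equal entries. *)
move=> bN; pose B := (a.*2).+2.
pose dig (s : seq nat) (j k : nat) :=
  ((nth 0%N (sort geq s) k).*2 + (b.-1 - j <= k)%N)%N.
pose rk s j := digits_value B N.+1 (dig s j).
(* This bound keeps ranks below [B ^ N.+1]. Rewriting increases the rank, so the induction runs on
   the gap that remains. *)
have digB s' j' : all (fun i => i < a)%N s' -> forall k, (dig s' j' k < B)%N.
  move=> sa k; rewrite /dig /B -addn2 -ltnS.
  have: (nth 0%N (sort geq s') k <= a)%N.
    have [lt_k|le_k] := ltnP k (size (sort geq s')); last by rewrite nth_default.
    apply/ltnW/(allP sa); rewrite -(mem_sort geq); exact: mem_nth.
  rewrite -leq_double => le_a.
  by apply: leq_ltn_trans (leq_add le_a (leq_b1 _)) _; rewrite addn1 addn2.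
have [k] := ubnP (B ^ N.+1 - rk s j); elim: k s j => // k IHk s j.
rewrite ltnS => le_k sN sa jb.
pose r := (b.-1 - j)%N.
have lt_rb : (r < b)%N.
  by rewrite /r (leq_ltn_trans (leq_subr _ _)) // prednK // (leq_ltn_trans _ jb).
have lt_rs : (r < size s)%N by rewrite sN (leq_trans lt_rb).
pose ss := sort geq s; pose g := nth 0%N ss r.
have gs : g \in s by rewrite -(mem_sort geq) mem_nth ?size_sort.
have ga : (g < a)%N := allP sa _ gs.
pose s0 := rem g s.
have ps : perm_eq s (g :: s0) by exact: perm_to_rem.
have s0a : all (fun i => i < a)%N s0 by apply/allP => i /mem_rem /(allP sa).
have s0N : size s0 = N by rewrite size_rem // sN.
have -> : (\prod_(i <- s) f i) * t j = (\prod_(i <- s0) f i) * (f g * t j).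
  by rewrite (perm_big _ ps) big_cons /= mulrAC mulrC.
set P0 := \prod_(i <- s0) f i.
pose idx := [seq (i, j) | i <- iota 0 a, j <- iota 0 b].
have idxu : uniq idx by apply: allpairs_uniq; rewrite ?iota_uniq // => -[? ?] [? ?] _ _.
have mem_idx p : (p \in idx) = (p.1 < a)%N && (p.2 < b)%N.
  case: p => i' j'; apply/allpairsP/andP => /= [[[i1 j1] /=]|[ia jb']].
    by rewrite !mem_iota !add0n => -[/= ia jb' [-> ->]].
  by exists (i', j'); rewrite !mem_iota.
(* Solve the relation at position [lead g j] for its leading product, whose coefficient is
   invertible. *)
have cE : f g * t j = (m g j (lead g j))^-1 *: (product_coef (lead g j)
    - \sum_(p <- idx | p != (g, j)) m p.1 p.2 (lead g j) *: (f p.1 * t p.2)).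
  rewrite /product_coef -/idx (bigD1_seq (g, j)) ?mem_idx ?ga //= addrK.
  by rewrite scalerA mulVf ?scale1r // lead_neq0.
rewrite cE -scalerAr; apply: kspanZ; rewrite mulrBr -scaleN1r.
apply: kspanD.
  by apply: kspan_gen; exists s0, (lead g j).
apply: kspanZ; rewrite mulr_sumr -big_filter; apply: kspan_sum => -[i' j'].
rewrite mem_filter mem_idx /= => /and3P[ne_p ia' jb'].
rewrite -scalerAr; have [->|m0] := eqVneq (m i' j' (lead g j)) 0.
  by rewrite scale0r; apply: kspan0.
apply: kspanZ; rewrite mulrA [P0 * _]mulrC.
have -> : f i' * P0 = \prod_(i <- i' :: s0) f i by rewrite big_cons.
have s1N : size (i' :: s0) = N.+1 by rewrite /= s0N.
have s1a : all (fun i => i < a)%N (i' :: s0) by rewrite /= ia'.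
apply: IHk => //.
have rk_le : (rk s j < B ^ N.+1)%N by apply: digits_value_lt => h _; apply: digB.
apply: leq_trans le_k; rewrite ltn_sub2l //.
have cnt v : count (leq v) s = ((v <= g) + count (leq v) s0)%N.
  by rewrite (permP ps).
have ss_ge v h : (h < N.+1)%N -> (v <= nth 0%N ss h)%N = (h < count (leq v) s)%N.
  by move=> lt_h; rewrite nth_sort_geq ?sN.
have ss1_ge v h : (h < N.+1)%N ->
    (v <= nth 0%N (sort geq (i' :: s0)) h)%N = (h < (v <= i') + count (leq v) s0)%N.
  by move=> lt_h; rewrite nth_sort_geq ?s1N.
have lt_rN : (r < N.+1)%N by rewrite -sN.
(* Replacing one [g] by [i'] lowers no entry greater than [g] and no entry at a rank before [r],
   where [g] was taken. *)
have step h : (h < N.+1)%N -> (g < nth 0%N ss h)%N || (h < r)%N ->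
    (nth 0%N ss h <= nth 0%N (sort geq (i' :: s0)) h)%N.
  move=> lt_h hyp; rewrite ss1_ge //; set v := nth 0%N ss h in hyp *.
  have := ss_ge v h lt_h; rewrite leqnn cnt => /esym.
  have [lt_gv|le_vg] := ltnP g v.
    by rewrite /= add0n => /leq_trans; apply; rewrite leq_addl.
  move: hyp; rewrite ltnNge le_vg /= => lt_hr _.
  have := ss_ge v r lt_rN; rewrite -/g le_vg cnt le_vg add1n ltnS => /esym le_r.
  by apply: leq_trans lt_hr (leq_trans le_r (leq_addl _ _)).
(* If [i' <= g] the second index grows: at rank [b.-1 - j'] the bit changes from 0 to 1, while the
   entries up to there do not decrease. *)
have [lt_gi|le_ig] := ltnP g i'; last first.
  have lt_jj : (j < j')%N.
    case: (lead_max ga jb ia' jb' m0) => // [[ii jj]|]; last by rewrite ltnNge le_ig.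
    by rewrite ii jj eqxx in ne_p.
  have lt_rr : (b.-1 - j' < r)%N.
    by rewrite /r ltn_sub2l // (leq_trans lt_jj) // -ltnS prednK // (leq_ltn_trans _ jb).
  apply: (@digits_value_mono _ _ _ _ (b.-1 - j')) => //.
  - exact: ltn_trans lt_rr lt_rN.
  - by move=> h _; apply: digB.
  - move=> h lt_h; rewrite /dig -/r [(r <= h)%N]leqNgt (ltn_trans lt_h lt_rr) /= addn0.
    apply: leq_trans (leq_addr _ _); rewrite leq_double step ?(ltn_trans lt_h lt_rr) ?orbT //.
    by rewrite (ltn_trans lt_h) // (ltn_trans lt_rr).
  - rewrite /dig -/r leqnn [(r <= _)%N]leqNgt lt_rr /= addn0 addn1 ltnS leq_double.
    rewrite step ?lt_rr ?orbT //.
    exact: ltn_trans lt_rr lt_rN.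
(* If [g < i'], then [p] entries of [s] are at least [i'], so the old entry at rank [p] is smaller
   than [i'] and the new one is not. *)
pose p := count (leq i') s.
have le_pr : (p <= r)%N.
  by rewrite leqNgt -ss_ge // -/g -ltnNge.
have lt_pN : (p < N.+1)%N by exact: leq_ltn_trans le_pr lt_rN.
apply: (@digits_value_mono _ _ _ _ p) => //.
- by move=> h _; apply: digB.
- move=> h lt_h; have lt_hr := leq_trans lt_h le_pr.
  rewrite /dig -/r [(r <= h)%N]leqNgt lt_hr /= addn0; apply: leq_trans (leq_addr _ _).
  by rewrite leq_double step ?lt_hr ?orbT // (ltn_trans lt_h).
- have lt1 : (nth 0%N ss p < i')%N by rewrite ltnNge ss_ge // ltnn.
  have le2 : (i' <= nth 0%N (sort geq (i' :: s0)) p)%N.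
    by rewrite ss1_ge // leqnn add1n ltnS /p cnt [(i' <= g)%N]leqNgt lt_gi.
  rewrite /dig; apply: leq_trans (leq_addr _ _).
  apply: leq_trans (_ : (nth 0%N ss p).+1.*2 <= _)%N; last by rewrite leq_double (leq_trans lt1).
  by rewrite doubleS !ltnS -addn1 leq_add2l leq_b1.
Qed.

End DedekindMertens.

(** * Coordinates in the basis of standard monomials *)

Section Coordinates.
Variables (K : fieldType) (n : nat) (A : algType K) (x : 'I_n -> A).
Hypothesis x_basis : forall a : A, exists! p : {mpoly K[n]}, stdpoly x p = a.

Definition coord (a : A) : {mpoly K[n]} :=
  proj1_sig (constructive_indefinite_description _ (x_basis a)).

Lemma coordK a : stdpoly x (coord a) = a.
Proof.
by rewrite /coord; case: (constructive_indefinite_description _ _) => p [].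
Qed.

Lemma stdpoly_inj p q : stdpoly x p = stdpoly x q -> p = q.
Proof.
by move=> pq; have [r [_ ru]] := x_basis (stdpoly x q); rewrite -(ru p) // -(ru q).
Qed.

Lemma stdpolyK p : coord (stdpoly x p) = p.
Proof. by apply: stdpoly_inj; rewrite coordK. Qed.

Lemma coordD a b : coord (a + b) = coord a + coord b.
Proof. by apply: stdpoly_inj; rewrite stdpolyD !coordK. Qed.

Lemma coordZ k a : coord (k *: a) = k *: coord a.
Proof. by apply: stdpoly_inj; rewrite stdpolyZ !coordK. Qed.

Lemma coord0 : coord 0 = 0.
Proof. by rewrite -(scale0r 0) coordZ scale0r. Qed.

Definition std_coef (a : A) (m : 'X_{1..n}) : K := (coord a)@_m.
Notation coef := std_coef.

Lemma coef0 m : coef 0 m = 0.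
Proof. by rewrite /std_coef coord0 mcoeff0. Qed.

Lemma coefD a b m : coef (a + b) m = coef a m + coef b m.
Proof. by rewrite /std_coef coordD mcoeffD. Qed.

Lemma coefZ k a m : coef (k *: a) m = k * coef a m.
Proof. by rewrite /std_coef coordZ mcoeffZ. Qed.

Lemma coef_sum (J : Type) (r : seq J) (F : J -> A) m :
  coef (\sum_(j <- r) F j) m = \sum_(j <- r) coef (F j) m.
Proof. by elim: r => [|j r IHr]; rewrite ?(big_nil, coef0) // !big_cons coefD IHr. Qed.

Lemma coef_stdpoly p m : coef (stdpoly x p) m = p@_m.
Proof. by rewrite /std_coef stdpolyK. Qed.

Lemma coef_stdmon a m : coef (stdmon x a) m = (a == m)%:R.
Proof. by rewrite -stdpolyX coef_stdpoly mcoeffX. Qed.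

Lemma coef_expand (s : seq 'X_{1..n}) a : uniq s ->
  {subset msupp (coord a) <= s} -> a = \sum_(m <- s) coef a m *: stdmon x m.
Proof. by move=> us sub; rewrite -{1}[a]coordK (stdpolyEw _ us sub). Qed.

Lemma coef_inj a b : (forall m, coef a m = coef b m) -> a = b.
Proof. by move=> ab; rewrite -[a]coordK -[b]coordK; congr stdpoly; apply/mpolyP. Qed.

Lemma leads_coef lt m f : monomial_ordering lt -> leads x lt m f ->
  coef f m != 0 /\ forall u, coef f u != 0 -> u = m \/ lt u m.
Proof.
move=> lt_mo [k k0 [r rE Hr]].
have fE u : coef f u = k * (m == u)%:R + r@_u.
  by rewrite -[f](subrK (k *: stdmon x m)) rE coefD coef_stdpoly coefZ coef_stdmon addrC.
split.
  rewrite fE eqxx mulr1 memN_msupp_eq0 ?addr0 //.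
  by apply/negP => /Hr; rewrite (mo_irr lt_mo).
move=> u; rewrite fE; have [->|_] := eqVneq m u; first by left.
by rewrite mulr0 add0r -mcoeff_msupp => /Hr; right.
Qed.

Definition stdprod (b : seq 'X_{1..n}) : A := \prod_(m <- b) stdmon x m.

End Coordinates.

Section SortedMonomials.
Variables (K : fieldType) (n : nat) (lt : rel 'X_{1..n}).
Hypothesis lt_mo : monomial_ordering lt.

(** Numbering monomials increasingly turns [lt] into the order of positions, the form in which
    [dedekind_mertens] states its hypotheses. *)
Lemma sort_monomials (S : seq 'X_{1..n}) : uniq S ->
  exists2 s, perm_eq S s &
    forall i j, (i < j < size s)%N -> lt (nth 0%MM s i) (nth 0%MM s j).
Proof.
move=> us; pose le a b := (a == b) || lt a b.
have tot : total le.
  by move=> a b; rewrite /le; case: (mo_total_cases lt_mo a b) => [->|->|->]; rewrite ?eqxx ?orbT.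
have trl : transitive lt by exact: mo_trans lt_mo.
exists (sort le S); first by rewrite perm_sym; apply/permPl/perm_sort.
have: sorted lt (sort le S).
  have us' : uniq (sort le S) by rewrite sort_uniq.
  have := sort_sorted tot S; case: (sort le S) us' => //= a s.
  elim: s a => //= b s IHs a /andP[]; rewrite inE negb_or => /andP[/negbTE ab _] us'.
  by rewrite {1}/le ab /= => /andP[-> ps]; apply: IHs.
move=> so i j /andP[lt_ij lt_j]; apply: (sorted_ltn_nth trl 0%MM so) => //;
  by rewrite inE // (ltn_trans lt_ij).
Qed.

End SortedMonomials.

Section Chain.
Variables (K : fieldType) (n : nat).
Variables (c : 'I_n -> 'I_n -> K) (d : 'I_n -> 'I_n -> {mpoly K[n]}).
Variables (A : algType K) (x : 'I_n -> A).
Hypothesis c_neq0 : forall i j : 'I_n, (i < j)%N -> c i j != 0.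
Hypothesis A_pres : presented c d x.
Hypothesis x_basis : forall a : A, exists! p : {mpoly K[n]}, stdpoly x p = a.
Variable lt : rel 'X_{1..n}.
Hypothesis lt_adm : admissible d lt.
Let lt_mo := lt_adm.1.
Notation coef := (std_coef x_basis).
Notation coord := (coord x_basis).

Variables (S : seq 'X_{1..n}) (L : comAlgType K).
Hypothesis S_uniq : uniq S.
(* [X k a] is the coefficient of the monomial [a] in a generic factor; the
   factors are numbered from the right. *)
Variable X : nat -> 'X_{1..n} -> L.

Fixpoint zval (b : seq 'X_{1..n}) : L :=
  if b is m :: b' then X (size b') m * zval b' else 1.

(* The coefficients of the product of the [k] rightmost generic factors. *)
Definition tail_coef (k : nat) (u : 'X_{1..n}) : L :=
  \sum_(b <- lists_of S k) coef (stdprod x b) u *: zval b.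

(** A finite set outside which the tail coefficients vanish; its size is the parameter [b] of
    [dedekind_mertens]. *)
Definition tail_supp (k : nat) : seq 'X_{1..n} :=
  undup (flatten [seq msupp (coord (stdprod x b)) | b <- lists_of S k]).

Lemma tail_coef0 : tail_coef 0 0%MM = 1.
Proof.
rewrite /tail_coef big_seq1 /stdprod big_nil /=.
have -> : 1 = stdmon x 0%MM by rewrite /stdmon big1 // => i _; rewrite mnm0E.
by rewrite coef_stdmon eqxx scale1r.
Qed.

Lemma tail_coefS k u : tail_coef k.+1 u =
  \sum_(p <- [seq (m, v) | m <- S, v <- tail_supp k])
     coef (stdmon x p.1 * stdmon x p.2) u *: (X k p.1 * tail_coef k p.2).
Proof.
rewrite /tail_coef /= !big_allpairs_dep; apply: eq_bigr => m _ /=.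
under [RHS]eq_bigr do rewrite mulr_sumr scaler_sumr.
rewrite exchange_big [LHS]big_seq [RHS]big_seq; apply: eq_bigr => b Sb /=.
have sb : size b = k by move: Sb; rewrite mem_lists_of => /andP[/eqP].
rewrite sb /stdprod big_cons -/(stdprod x b).
rewrite {1}(@coef_expand _ _ _ _ x_basis (tail_supp k) (stdprod x b)) ?undup_uniq //; last first.
  move=> v hv; rewrite mem_undup; apply/flattenP; exists (msupp (coord (stdprod x b))) => //.
  by apply/mapP; exists b.
rewrite mulr_sumr coef_sum scaler_suml; apply: eq_bigr => v _.
by rewrite -scalerAr coefZ -scalerAr scalerA mulrC.
Qed.

Lemma tail_coef_out k u : u \notin tail_supp k -> tail_coef k u = 0.
Proof.
move=> hu; rewrite /tail_coef big_seq big1 // => b Sb.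
suff -> : coef (stdprod x b) u = 0 by rewrite scale0r.
apply/memN_msupp_eq0; apply: contra hu => hu; rewrite mem_undup.
by apply/flattenP; exists (msupp (coord (stdprod x b))) => //; apply/mapP; exists b.
Qed.

(** One use of Dedekind-Mertens, for factor [k] times the tail to its right: [N.+1] coefficients of
    the factor and one of the tail are traded for [N] coefficients of the factor and one of the
    longer tail. *)
Lemma dm_slot k N s u : (size (tail_supp k) <= N.+1)%N -> size s = N.+1 ->
  all (mem S) s ->
  kspan (fun y => exists s' v, [/\ size s' = N, all (mem S) s'
      & y = (\prod_(m <- s') X k m) * tail_coef k.+1 v])
    ((\prod_(m <- s) X k m) * tail_coef k u).
Proof.
move=> leN sN sS.
have [uU|/tail_coef_out->] := boolP (u \in tail_supp k); last first.
  by rewrite mulr0; apply: kspan0.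
have [Ss pS Slt] := sort_monomials lt_mo S_uniq.
have [Us pU Ult] := sort_monomials lt_mo (undup_uniq _ : uniq (tail_supp k)).
pose sx m := index m Ss.
have memS m : (m \in Ss) = (m \in S) by rewrite (perm_mem pS).
have memU m : (m \in Us) = (m \in tail_supp k) by rewrite (perm_mem pU).
pose mm i j v := coef (stdmon x (nth 0%MM Ss i) * stdmon x (nth 0%MM Us j)) v.
pose ld i j := (nth 0%MM Ss i + nth 0%MM Us j)%MM.
have lds i j := leads_coef x_basis lt_mo
  (stdmon_mul_leads c_neq0 A_pres lt_adm (nth 0%MM Ss i) (nth 0%MM Us j)).
have H0 i j : (i < size Ss)%N -> (j < size Us)%N -> mm i j (ld i j) != 0.
  by move=> _ _; apply: (lds i j).1.
(* If [i' <= i] and [j' <= j], not both equal, then the leading monomial of the product [(i', j')]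
   is below [ld i j], which therefore cannot occur in it. *)
have H1 i j i' j' : (i < size Ss)%N -> (j < size Us)%N -> (i' < size Ss)%N ->
    (j' < size Us)%N -> mm i' j' (ld i j) != 0 ->
    [\/ (i', j') = (i, j), (i < i')%N | (j < j')%N].
  move=> ia jb ia' jb' /(lds i' j').2; rewrite -/(ld i' j') => le_ld.
  have [lt_i|le_i] := ltnP i i'; first by apply: Or32.
  have [lt_j|le_j] := ltnP j j'; first by apply: Or33.
  suff: ~~ ((i' < i)%N || (j' < j)%N).
    rewrite negb_or -!leqNgt => /andP[ii jj]; apply: Or31.
    by congr pair; apply/eqP; rewrite eqn_leq ?le_i ?le_j.
  apply/negP => hlt; have: lt (ld i' j') (ld i j).
    move: hlt; rewrite [(i' < i)%N]ltn_neqAle [(j' < j)%N]ltn_neqAle le_i le_j !andbT /ld.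
    have [->|ni] := eqVneq i' i; have [->|nj] := eqVneq j' j => //= _.
    - by apply: (mo_mull lt_mo); apply: Ult; rewrite jb ltn_neqAle nj le_j.
    - by apply: (mo_mul lt_mo); apply: Slt; rewrite ia ltn_neqAle ni le_i.
    - apply: (mo_add lt_mo); first by apply: Slt; rewrite ia ltn_neqAle ni le_i.
      by apply: Ult; rewrite jb ltn_neqAle nj le_j.
  case: le_ld => [->|lt2]; first by rewrite (mo_irr lt_mo).
  by move=> lt1; have := mo_trans lt_mo lt1 lt2; rewrite (mo_irr lt_mo).
have DM := @dedekind_mertens K L 'X_{1..n} (size Ss) (size Us)
  (fun i => X k (nth 0%MM Ss i)) (fun j => tail_coef k (nth 0%MM Us j))
  mm ld H0 H1 N (map sx s) (index u Us).
have uUs : u \in Us by rewrite memU.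
move: DM; rewrite size_map index_mem uUs big_map nth_index //.
have -> : \prod_(j <- s) X k (nth 0%MM Ss (sx j)) = \prod_(j <- s) X k j.
  by apply: eq_big_seq => m /(allP sS) mS; rewrite nth_index // memS.
have -> : all (fun i => i < size Ss)%N (map sx s).
  by rewrite all_map; apply: sub_all sS => m mS /=; rewrite index_mem memS.
rewrite (perm_size pU) in leN; move=> /(_ leN sN isT isT).
apply: kspan_sub => _ [s' [v [s'N s'S ->]]].
apply: kspan_gen; exists (map (nth 0%MM Ss) s'), v; split.
- by rewrite size_map.
- by rewrite all_map; apply: sub_all s'S => i iS /=; rewrite -memS mem_nth.
- rewrite big_map; congr (_ * _); rewrite tail_coefS /product_coef.
  rewrite !big_allpairs_dep (perm_big _ pS) /=.
  rewrite (big_nth 0%MM) /index_iota subn0; apply: eq_bigr => i _.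
  by rewrite (perm_big _ pU) /= (big_nth 0%MM) /index_iota subn0.
Qed.

(** Start from the empty tail, whose coefficient is 1, and let [dm_slot] take one coefficient out of
    each factor in turn. What is collected is a single coefficient of the full product. *)
Lemma chain N k : (forall h, (h < k)%N -> (size (tail_supp h) <= N.+1)%N) ->
  forall ss : nat -> seq 'X_{1..n},
  (forall h, (h < k)%N -> size (ss h) = N.+1 /\ all (mem S) (ss h)) ->
  kspan (fun y => exists ss' v,
      (forall h, (h < k)%N -> size (ss' h) = N /\ all (mem S) (ss' h)) /\
      y = (\prod_(h < k) \prod_(m <- ss' h) X h m) * tail_coef k v)
    (\prod_(h < k) \prod_(m <- ss h) X h m).
Proof.
elim: k => [|k IHk] leN ss Hss.
  apply: kspan_gen; exists (fun=> [::]), 0%MM; split=> //.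
  by rewrite !big_ord0 tail_coef0 mulr1.
have {}IHk := IHk (fun h lt_h => leN h (ltnW lt_h)) ss (fun h lt_h => Hss h (ltnW lt_h)).
rewrite big_ord_recr /=; set Y := \prod_(m <- ss k) X k m.
apply: (@kspan_linear _ _ _ (fun y => y * Y)) IHk.
  by move=> r y z; rewrite mulrDl scalerAl.
move=> _ [ss' [v [Hss' ->]]]; rewrite -mulrA [_ * Y]mulrC.
have [sk Sk] := Hss k (ltnSn k).
apply: (@kspan_linear _ _ _ (fun y => _ * y)) (dm_slot v (leN k (ltnSn k)) sk Sk).
  by move=> r y z; rewrite mulrDr scalerAr.
move=> _ [s' [w [s'N s'S ->]]]; apply: kspan_gen.
exists (fun h => if h == k then s' else ss' h), w; split.
  move=> h; rewrite ltnS leq_eqVlt; case: eqP => [-> //|_] /= lt_h; exact: Hss'.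
rewrite big_ord_recr /= eqxx -mulrA; congr (_ * _); apply: eq_bigr => h _.
by rewrite ltn_eqF.
Qed.

End Chain.

(** * The annihilating polynomial *)

Section Annihilator.
Variables (K : fieldType) (n : nat).
Variables (c : 'I_n -> 'I_n -> K) (d : 'I_n -> 'I_n -> {mpoly K[n]}).
Variables (A : algType K) (x : 'I_n -> A).
Hypothesis c_neq0 : forall i j : 'I_n, (i < j)%N -> c i j != 0.
Hypothesis A_pres : presented c d x.
Hypothesis x_basis : forall a : A, exists! p : {mpoly K[n]}, stdpoly x p = a.
Variable lt : rel 'X_{1..n}.
Hypothesis lt_adm : admissible d lt.

Variables (S : seq 'X_{1..n}) (L : comAlgType K).
Hypothesis S_uniq : uniq S.
Variable X : nat -> 'X_{1..n} -> L.
Variables (M : nat) (gc : 'X_{1..n} -> K).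
Notation zval := (zval X).
Notation tail_coef := (tail_coef x_basis S X).
Notation tail_supp := (tail_supp x_basis S).

Definition prod_ideal (y : L) : Prop :=
  exists q : seq (L * 'X_{1..n}),
    y = \sum_(u <- q) u.1 * (tail_coef M u.2 - (gc u.2)%:A).

Lemma prod_ideal0 : prod_ideal 0.
Proof. by exists [::]; rewrite big_nil. Qed.

Lemma prod_idealD y z : prod_ideal y -> prod_ideal z -> prod_ideal (y + z).
Proof. by move=> [q ->] [r ->]; exists (q ++ r); rewrite big_cat. Qed.

Lemma prod_idealM y z : prod_ideal z -> prod_ideal (y * z).
Proof.
move=> [q ->]; exists [seq (y * u.1, u.2) | u <- q].
by rewrite big_map mulr_sumr; apply: eq_bigr => u _; rewrite mulrA.
Qed.

Lemma prod_idealZ k y : prod_ideal y -> prod_ideal (k *: y).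
Proof. by rewrite -mulr_algl; apply: prod_idealM. Qed.

Lemma prod_ideal_sum (J : eqType) (r : seq J) (F : J -> L) :
  (forall j, j \in r -> prod_ideal (F j)) -> prod_ideal (\sum_(j <- r) F j).
Proof.
by move=> H; rewrite big_seq; elim/big_ind: _ => //; [exact: prod_ideal0|exact: prod_idealD].
Qed.

Lemma zvalE b : zval b = \prod_(h < size b) X h (nth 0%MM (rev b) h).
Proof.
elim: b => [|m b IHb]; first by rewrite big_ord0.
rewrite /= big_ord_recr /= rev_cons nth_rcons size_rev ltnn eqxx mulrC; congr (_ * _).
by rewrite IHb; apply: eq_bigr => h _; rewrite nth_rcons size_rev ltn_ord.
Qed.

(** A product of words is a matrix with one row per word and one column per factor; [chain] acts on
    the columns, so the product is transposed. *)
Lemma zval_columns bs : all (fun b => b \in lists_of S M) bs ->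
  \prod_(b <- bs) zval b =
  \prod_(h < M) \prod_(m <- [seq nth 0%MM (rev b) h | b <- bs]) X h m.
Proof.
move=> /allP bsS; under [RHS]eq_bigr do rewrite big_map.
rewrite exchange_big; apply: eq_big_seq => b /bsS.
by rewrite mem_lists_of zvalE => /andP[/eqP->].
Qed.

Lemma column_mem bs h : all (fun b => b \in lists_of S M) bs -> (h < M)%N ->
  all (mem S) [seq nth 0%MM (rev b) h | b <- bs].
Proof.
move=> /allP bsS lt_h; rewrite all_map; apply/allP => b /bsS /=.
rewrite mem_lists_of => /andP[/eqP sb /allP bS]; apply: bS.
by rewrite -mem_rev mem_nth // size_rev sb.
Qed.

Let N := (\max_(h < M) size (tail_supp h))%N.

Definition short_word (y : L) : Prop := exists bs : seq (seq 'X_{1..n}),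
  [/\ (size bs <= N)%N, all (fun b => b \in lists_of S M) bs
    & y = \prod_(b <- bs) zval b].

Definition reduced (y : L) : Prop :=
  exists2 y', kspan short_word y' & prod_ideal (y - y').

Lemma reduced_short y : kspan short_word y -> reduced y.
Proof. by move=> sy; exists y; rewrite ?subrr //; apply: prod_ideal0. Qed.

Lemma reducedD y z : reduced y -> reduced z -> reduced (y + z).
Proof.
move=> [y' sy Iy] [z' sz Iz]; exists (y' + z'); first exact: kspanD.
by rewrite opprD addrACA; apply: prod_idealD.
Qed.

Lemma reducedZ k y : reduced y -> reduced (k *: y).
Proof.
move=> [y' sy Iy]; exists (k *: y'); first exact: kspanZ.
by rewrite -scalerBr; apply: prod_idealZ.
Qed.

Lemma reduced_span (P : L -> Prop) y : (forall z, P z -> reduced z) ->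
  kspan P y -> reduced y.
Proof.
move=> PQ [s Hs ->]; elim: s Hs => [|u s IHs] Hs.
  by rewrite big_nil; apply/reduced_short/kspan0.
rewrite big_cons; apply: reducedD; first by apply/reducedZ/PQ/Hs; rewrite mem_head.
by apply: IHs => v vs; apply: Hs; rewrite in_cons vs orbT.
Qed.

Lemma reduced_ideal y : prod_ideal y -> reduced y.
Proof. by exists 0; [exact: kspan0 | rewrite subr0]. Qed.

(** [chain] shortens every column by one at the price of a coefficient of the full product, and that
    coefficient is a scalar modulo the ideal. So [N.+1] words reduce to combinations of [N]
    words. *)
Lemma reduced_long bs : size bs = N.+1 -> all (fun b => b \in lists_of S M) bs ->
  reduced (\prod_(b <- bs) zval b).
Proof.
move=> sN bsS; rewrite zval_columns //.
have leN h : (h < M)%N -> (size (tail_supp h) <= N.+1)%N.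
  by move=> lt_h; rewrite -[h]/(val (Ordinal lt_h)) leqW // /N leq_bigmax.
have cols h : (h < M)%N -> size [seq nth 0%MM (rev b) h | b <- bs] = N.+1 /\
    all (mem S) [seq nth 0%MM (rev b) h | b <- bs].
  by move=> lt_h; rewrite size_map sN column_mem.
apply: reduced_span (chain c_neq0 A_pres lt_adm S_uniq X leN cols).
move=> _ [ss' [v [Hss ->]]].
(* Columns of equal length [N] regroup into [N] words. Words are written from the left and factors
   numbered from the right, hence [rev]. *)
pose rows := [seq rev [seq nth 0%MM (ss' h) l | h <- iota 0 M] | l <- iota 0 N].
have rowsS : all (fun b => b \in lists_of S M) rows.
  apply/allP => b0 /mapP[l]; rewrite mem_iota add0n => /andP[_ lt_l] ->.
  rewrite mem_lists_of size_rev size_map size_iota eqxx all_rev /= all_map.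
  apply/allP => h; rewrite mem_iota add0n => /andP[_ lt_h] /=.
  by have [sh /allP] := Hss h lt_h; apply; rewrite mem_nth // sh.
have -> : \prod_(h < M) \prod_(m <- ss' h) X h m = \prod_(b <- rows) zval b.
  rewrite zval_columns //; apply: eq_bigr => h _; congr (\prod_(m <- _) _).
  have [sh _] := Hss h (ltn_ord h).
  rewrite -map_comp -[LHS](mkseq_nth 0%MM) sh; apply: eq_map => l /=.
  by rewrite revK (nth_map 0%N) ?size_iota // nth_iota.
set P := \prod_(b <- rows) _.
have -> : P * tail_coef M v = gc v *: P + P * (tail_coef M v - (gc v)%:A).
  by rewrite mulrBr -scalerAr mulr1 addrC subrK.
apply: reducedD.
  apply/reducedZ/reduced_short/kspan_gen; exists rows; split=> //.
  by rewrite size_map size_iota.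
by apply: reduced_ideal; exists [:: (P, v)]; rewrite big_seq1.
Qed.

Lemma reducedM b y : b \in lists_of S M -> reduced y -> reduced (zval b * y).
Proof.
move=> bS [y' sy Iy]; rewrite -[y](subrK y') mulrDr addrC; apply: reducedD; last first.
  exact/reduced_ideal/prod_idealM.
case: sy => s Hs ->; rewrite mulr_sumr.
elim: s Hs => [|u s IHs] Hs; first by rewrite big_nil; apply/reduced_short/kspan0.
rewrite big_cons -scalerAr; apply: reducedD; last first.
  by apply: IHs => v vs; apply: Hs; rewrite in_cons vs orbT.
apply: reducedZ; have [bs [sN bsS ->]] := Hs u (mem_head _ _).
have -> : zval b * \prod_(b <- bs) zval b = \prod_(b <- b :: bs) zval b by rewrite big_cons.
have b_bsS : all (fun b => b \in lists_of S M) (b :: bs) by rewrite /= bS.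
move: sN; rewrite leq_eqVlt => /orP[/eqP sN|lt_N].
  by apply: reduced_long; rewrite /= ?sN.
by apply/reduced_short/kspan_gen; exists (b :: bs).
Qed.

Lemma reducedX b k : b \in lists_of S M -> reduced (zval b ^+ k).
Proof.
move=> bS; elim: k => [|k IHk]; last by rewrite exprS; apply: reducedM.
by apply/reduced_short/kspan_gen; exists [::]; rewrite big_nil expr0.
Qed.

Definition short_words : seq L :=
  [seq \prod_(b <- bs) zval b | bs <- lists_upto (lists_of S M) N].

Lemma kspan_short y : kspan short_word y ->
  exists r : 'rV[K]_(size short_words), y = \sum_j r 0 j *: short_words`_j.
Proof.
case=> s Hs ->; elim: s Hs => [|u s IHs] Hs.
  by exists 0; rewrite big_nil big1 // => j _; rewrite mxE scale0r.
have [|r rE] := IHs; first by move=> v vs; apply: Hs; rewrite in_cons vs orbT.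
have [bs [sN bsS uE]] := Hs u (mem_head _ _).
have hu : u.2 \in short_words.
  by apply/mapP; exists bs; rewrite // mem_lists_upto sN.
pose j0 : 'I_(size short_words) := Ordinal (etrans (index_mem _ _) hu).
exists (r + u.1 *: delta_mx 0 j0); rewrite big_cons rE addrC.
rewrite [RHS](eq_bigr (fun j => r 0 j *: short_words`_j
   + (u.1 * (j == j0)%:R) *: short_words`_j)); last first.
  by move=> j _; rewrite !mxE eqxx /= scalerDl.
rewrite big_split /=; congr (_ + _); rewrite (bigD1 j0) //= big1 ?addr0.
  by rewrite eqxx mulr1 nth_index.
by move=> j /negbTE->; rewrite mulr0 scale0r.
Qed.

(** Modulo the ideal all powers of the word lie in the span of [q] short words, so the first [q.+1]
    powers are linearly dependent; a kernel vector of their coordinate matrix gives the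
    polynomial. *)
Lemma annihilator1 b : b \in lists_of S M ->
  exists2 p : {poly K}, p != 0 & prod_ideal (horner_alg (zval b) p).
Proof.
move=> bS; set q := size short_words.
have H k : exists r : 'rV[K]_q, prod_ideal (zval b ^+ k - \sum_j r 0 j *: short_words`_j).
  by have [y /kspan_short[r ->] Iy] := reducedX k bS; exists r.
pose r k := proj1_sig (constructive_indefinite_description _ (H k)).
have Hr k : prod_ideal (zval b ^+ k - \sum_j r k 0 j *: short_words`_j).
  by rewrite /r; case: constructive_indefinite_description.
pose C := \matrix_(k < q.+1) r k.
have kerC : kermx C != 0.
  by rewrite -mxrank_eq0 mxrank_ker -lt0n subn_gt0 ltnS; apply: rank_leq_col.
have [v vK v0] : exists2 v : 'rV_q.+1, v *m C = 0 & v != 0.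
  have /rowV0Pn[v] := kerC; first by move=> /sub_kermxP vC v0; exists v.
pose p := \poly_(k < q.+1) v 0 (inord k).
exists p.
  apply: contra_neq v0 => p0; apply/rowP => k; rewrite mxE.
  have := coef_poly q.+1 (fun k => v 0 (inord k)) k.
  by rewrite -/p p0 poly.coef0 ltn_ord inord_val => <-.
have -> : horner_alg (zval b) p = \sum_(k < q.+1) v 0 k *: zval b ^+ k.
  rewrite /p poly_def linear_sum; apply: eq_bigr => k _.
  by rewrite -mul_polyC rmorphM rmorphXn /= horner_algC horner_algX inord_val mulr_algl.
have -> : \sum_(k < q.+1) v 0 k *: zval b ^+ k =
  \sum_(k < q.+1) v 0 k *: (zval b ^+ k - \sum_j r k 0 j *: short_words`_j).
  apply/eqP; rewrite -subr_eq0 -sumrB; apply/eqP.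
  rewrite (eq_bigr (fun k : 'I_q.+1 => \sum_j (v 0 k * C k j) *: short_words`_j)).
    rewrite exchange_big big1 //= => j _; rewrite -scaler_suml.
    by move/rowP: vK => /(_ j); rewrite !mxE => ->; rewrite scale0r.
  move=> k _; rewrite scalerBr opprB addrC subrK scaler_sumr.
  by apply: eq_bigr => j _; rewrite scalerA mxE.
by apply: prod_ideal_sum => k _; apply/prod_idealZ/Hr.
Qed.

Lemma annihilator : exists2 p : {poly K}, p != 0 &
  forall b, b \in lists_of S M -> prod_ideal (horner_alg (zval b) p).
Proof.
elim: (lists_of S M) (fun b => @annihilator1 b) => [|b s IHs] H.
  by exists 1; rewrite ?oner_neq0.
have [p p0 Hp] := IHs (fun b' bs => H b' (mem_behead (s := b :: s) bs)).
have [q q0 Hq] := H b (mem_head _ _).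
(* Multiples of an annihilator annihilate too, so a product serves all words. *)
exists (p * q); first by rewrite mulf_neq0.
move=> b'; rewrite in_cons rmorphM => /orP[/eqP->|/Hp I]; first exact: prod_idealM.
by rewrite mulrC; apply: prod_idealM.
Qed.

End Annihilator.

(** * Weights *)

Section Gordan.
Import Order.TTheory Num.Theory.

Fixpoint dot (w v : seq int) : int :=
  match w, v with
  | a :: w', b :: v' => a * b + dot w' v'
  | _, _ => 0
  end.

Definition lincomb (a : int) (u : seq int) (b : int) (v : seq int) : seq int :=
  [seq a * p.1 + b * p.2 | p <- zip u v].

Lemma dot_lincomb w a u b v : size u = size v ->
  dot w (lincomb a u b v) = a * dot w u + b * dot w v.
Proof.
elim: w u v => [|c w IHw] [|p u] [|q v] //=; rewrite ?mulr0 ?addr0 // => -[suv].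
by rewrite -/(lincomb a u b v) IHw // !mulrDr addrACA !(mulrCA c).
Qed.

Lemma dotZ k w v : dot [seq k * a | a <- w] v = k * dot w v.
Proof.
elim: w v => [|c w IHw] [|p v] //=; rewrite ?mulr0 //.
by rewrite IHw mulrDr mulrA.
Qed.

(** The back substitution of the elimination: the eliminated coordinate is chosen between its lower
    and its upper bounds, either of which may be absent. *)
Lemma separating_rat (lo hi : seq rat) :
  (forall l h, l \in lo -> h \in hi -> l < h) ->
  exists w, (forall l, l \in lo -> l < w) /\ (forall h, h \in hi -> w < h).
Proof.
have below (L : rat) (s : seq rat) : (forall h, h \in s -> L < h) ->
    exists2 w, L < w & forall h, h \in s -> w < h.
  elim: s => [|h s IHs] H; first by exists (L + 1); rewrite ?ltrDl.
  have [w Lw ws] : exists2 w, L < w & forall h, h \in s -> w < h.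
    by apply: IHs => h' h's; apply: H; rewrite in_cons h's orbT.
  have Lh := H h (mem_head _ _); have [m1 m2] := midf_lt Lh.
  exists (Num.min w ((L + h) / 2%:R)); first by rewrite lt_min Lw m1.
  move=> h'; rewrite in_cons gt_min => /orP[/eqP->|/ws->//].
  by rewrite m2 orbT.
elim: lo => [|l lo IHlo] H.
  have [L HL] : exists L : rat, forall h, h \in hi -> L < h.
    elim: hi {H} => [|h s [L HL]]; first by exists 0.
    exists (Num.min L (h - 1)) => h'; rewrite in_cons gt_min => /orP[/eqP->|/HL->//].
    by rewrite ltrBlDr ltrDl ltr01 orbT.
  by exists L; split.
have [w [low whi]] : exists w, (forall l, l \in lo -> l < w) /\ (forall h, h \in hi -> w < h).
  by apply: IHlo => l' h l's; apply: H; rewrite in_cons l's orbT.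
have [|w' Lw' w'hi] := below (Num.max l w) hi.
  by move=> h hhi; rewrite gt_max whi // andbT H ?mem_head.
exists w'; split=> // l'; rewrite in_cons => /orP[/eqP->|/low lw].
  by move: Lw'; rewrite gt_max => /andP[].
by apply: lt_trans lw _; move: Lw'; rewrite gt_max => /andP[].
Qed.

(* Gordan's theorem by Fourier-Motzkin elimination of the first coordinate. *)
Lemma gordan n (pos : seq int -> Prop) (vs : seq (seq int)) :
  (forall a u b v, 0 < a -> 0 < b -> size u = n -> size v = n -> pos u -> pos v ->
     pos (lincomb a u b v)) ->
  ~ pos (nseq n 0) ->
  (forall v, v \in vs -> size v = n /\ pos v) ->
  exists2 w, size w = n & forall v, v \in vs -> 0 < dot w v.
Proof.
elim: n pos vs => [|n IHn] pos vs posD pos0 Hvs.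
  exists [::] => // v /Hvs[/size0nil -> p0]; by case: pos0.
pose hd (v : seq int) := head 0 v.
have vsE v : v \in vs -> v = hd v :: behead v.
  by move/Hvs => -[]; case: v.
have sz v : v \in vs -> size (behead v) = n.
  by move/Hvs => -[]; case: v => //= a v [].
pose Z := [seq behead v | v <- vs & hd v == 0].
pose P := [seq v <- vs | 0 < hd v].
pose Q := [seq v <- vs | hd v < 0].
(* A vector with positive head and one with negative head are combined, with positive factors, so
   that the heads cancel; [pos] plays the role of a convex cone without 0. *)
pose PQ := [seq lincomb (- hd q) (behead p) (hd p) (behead q) | p <- P, q <- Q].
have lcE u v : size u = n.+1 -> size v = n.+1 -> lincomb (- hd v) u (hd u) v =
    0 :: lincomb (- hd v) (behead u) (hd u) (behead v).
  case: u => // a u; case: v => // b v _ _.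
  by rewrite /lincomb /= mulNr mulrC addNr.
have [|||w sw Hw] := IHn (fun t => pos (0 :: t)) (Z ++ PQ).
- move=> a u b v a0 b0 su sv pu pv.
  by have := posD a (0 :: u) b (0 :: v) a0 b0; rewrite /= /lincomb /= !mulr0 addr0 su sv; apply.
- exact: pos0.
- move=> v; rewrite mem_cat => /orP[/mapP[u]|/allpairsP[[p q] /= []]].
    rewrite mem_filter => /andP[/eqP u0 uvs] ->; split; first exact: sz.
    by rewrite -u0 -vsE //; case: (Hvs _ uvs).
  rewrite !mem_filter => /andP[p0 pvs] /andP[q0 qvs] ->.
  split; first by rewrite size_map size_zip !sz // minnn.
  have := posD (- hd q) p (hd p) q; rewrite oppr_gt0 => /(_ q0 p0).
  have [sp pp] := Hvs _ pvs; have [sq pq] := Hvs _ qvs => /(_ sp sq pp pq).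
  by rewrite lcE.
(* For a nonzero head, [0 < r * hd v + dot w (behead v)] bounds [r] from below or from above,
   according to the sign of the head. *)
pose lo := [seq - (dot w (behead p))%:~R / (hd p)%:~R | p <- P] : seq rat.
pose hi := [seq (dot w (behead q))%:~R / - (hd q)%:~R | q <- Q] : seq rat.
have [|r [Hlo Hhi]] := @separating_rat lo hi.
  move=> _ _ /mapP[p pP ->] /mapP[q qQ ->].
  have Hpq := Hw (lincomb (- hd q) (behead p) (hd p) (behead q)).
  move: (pP) (qQ); rewrite !mem_filter => /andP[p0 pvs] /andP[q0 qvs].
  rewrite ltr_pdivrMr ?ltr0z // mulrAC ltr_pdivlMr ?oppr_gt0 ?ltrz0 //.
  have: 0 < dot w (lincomb (- hd q) (behead p) (hd p) (behead q)).
    by apply: Hpq; rewrite mem_cat; apply/orP; right; apply/allpairsP; exists (p, q).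
  rewrite dot_lincomb ?sz // -(ltr0z rat) rmorphD !rmorphM rmorphN /= => H.
  rewrite -subr_gt0; congr (0 < _): H; ring.
(* The weights must be integers, so everything is multiplied by the denominator of [r]. *)
exists (numq r :: [seq denq r * a | a <- w]); first by rewrite /= size_map sw.
move=> v vvs; rewrite (vsE v vvs) /= dotZ -(ltr0z rat) rmorphD !rmorphM /=.
have -> : (numq r)%:~R = r * (denq r)%:~R :> rat by rewrite -numqE.
rewrite mulrAC [_ * (dot _ _)%:~R]mulrC -mulrDl pmulr_lgt0 ?ltr0z ?denq_gt0 //.
have [v0|v0|v0] := ltrgtP (hd v) 0.
- have /Hhi : (dot w (behead v))%:~R / - (hd v)%:~R \in hi.
    by apply/mapP; exists v; rewrite // mem_filter v0.
  rewrite ltr_pdivlMr ?oppr_gt0 ?ltrz0 // mulrN -subr_gt0 opprK addrC.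
  by [].
- have /Hlo : - (dot w (behead v))%:~R / (hd v)%:~R \in lo.
    by apply/mapP; exists v; rewrite // mem_filter v0.
  by rewrite ltr_pdivrMr ?ltr0z // -subr_gt0 opprK.
- rewrite v0 mulr0z mulr0 add0r ltr0z; apply: Hw; rewrite mem_cat; apply/orP; left.
  by apply/mapP; exists v; rewrite // mem_filter v0 eqxx.
Qed.

End Gordan.

Section Weights.
Import Order.TTheory Num.Theory.
Variables (n : nat) (lt : rel 'X_{1..n}).
Hypothesis lt_mo : monomial_ordering lt.

Lemma mo_muln a b k : lt a b -> (0 < k)%N -> lt (a *+ k)%MM (b *+ k)%MM.
Proof.
move=> ab; case: k => // k _; elim: k => [|k IHk]; first by rewrite !mulm1n.
by rewrite !(mulmS _ k.+1); apply: (mo_add lt_mo).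
Qed.

Definition wsum (w : seq nat) (a : 'X_{1..n}) : nat :=
  (\sum_(i < n) nth 0%N w i * a i)%N.

Lemma wsumD w a b : wsum w (a + b)%MM = (wsum w a + wsum w b)%N.
Proof.
by rewrite /wsum -big_split; apply: eq_bigr => i _; rewrite mnmDE mulnDr.
Qed.

Definition mon_diff (a b : 'X_{1..n}) : seq int :=
  [seq (b i)%:Z - (a i)%:Z | i <- enum 'I_n].

Lemma dot_mon_diff w a b : size w = n ->
  dot w (mon_diff a b) = \sum_(i < n) nth 0 w i * ((b i)%:Z - (a i)%:Z).
Proof.
move=> sw; rewrite /mon_diff.
have E (s : seq 'I_n) (f : 'I_n -> int) (v : seq int) : size v = size s ->
    dot v [seq f i | i <- s] = \sum_(p <- zip v s) p.1 * f p.2.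
  elim: s v => [|i s IHs] [|q v] //=; first by rewrite big_nil.
  by move=> [sv]; rewrite big_cons IHs.
rewrite E ?size_enum_ord //.
rewrite -[w in zip w _](mkseq_nth 0) sw /mkseq -val_enum_ord -map_comp.
have -> : zip (map (nth 0 w \o val) (enum 'I_n)) (enum 'I_n) =
   [seq (nth 0 w (val i), i) | i <- enum 'I_n].
  by elim: (enum 'I_n) => //= i s ->.
by rewrite big_map big_enum.
Qed.

(** The cone consists of differences of pairs [a], [b] with [lt a b]. Compatibility with products
    closes it under positive combinations, and irreflexivity keeps 0 out. *)
Lemma weights_exist (V : seq ('X_{1..n} * 'X_{1..n})) :
  (forall v, v \in V -> lt v.1 v.2) ->
  exists w : seq nat, [/\ size w = n, forall i, (i < n)%N -> (0 < nth 0 w i)%N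
    & forall v, v \in V -> (wsum w v.1 <= wsum w v.2)%N].
Proof.
move=> HV.
pose pos v := exists a b, lt a b /\ v = mon_diff a b.
(* The added pairs [(1, x_i)] of monomials force the weights to be positive. *)
pose V' := [seq (0%MM, U_(i)%MM) | i <- enum 'I_n] ++ V.
have [|||w sw Hw] := @gordan n pos [seq mon_diff v.1 v.2 | v <- V'].
- move=> k u l v k0 l0 _ _ [a [b [ab ->]]] [a' [b' [ab' ->]]].
  exists (a *+ `|k|%N + a' *+ `|l|%N)%MM, (b *+ `|k|%N + b' *+ `|l|%N)%MM; split.
    by apply: (mo_add lt_mo); apply: mo_muln; rewrite // absz_gt0 gt_eqF.
  rewrite /lincomb /mon_diff.
  have -> (f g : 'I_n -> int) (s : seq 'I_n) : zip (map f s) (map g s) = [seq (f i, g i) | i <- s].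
    by elim: s => //= i s ->.
  rewrite -map_comp; apply: eq_map => i /=.
  rewrite !mnmDE !mulmnE !PoszD !PoszM !gtz0_abs //.
  by ring.
- case=> a [b [ab E]]; suff eab : a = b by rewrite eab (mo_irr lt_mo) in ab.
  apply/mnmP => i; apply/eqP; rewrite -eqz_nat eq_sym -subr_eq0; apply/eqP.
  have := congr1 (fun s => nth 0 s i) E; rewrite nth_nseq if_same.
  by rewrite (nth_map i) ?size_enum_ord // nth_ord_enum.
- move=> _ /mapP[v vV ->]; split; first by rewrite size_map size_enum_ord.
  exists v.1, v.2; split=> //; move: vV; rewrite mem_cat => /orP[/mapP[i _ ->]|/HV//].
  apply: (mo_ge0 lt_mo); apply/eqP => /mnmP/(_ i); rewrite mnm1E mnm0E eqxx.
  by [].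
have w_gt0 i : (i < n)%N -> 0 < nth 0 w i.
  move=> lt_in; have := Hw (mon_diff 0%MM U_(Ordinal lt_in)).
  rewrite dot_mon_diff // (bigD1 (Ordinal lt_in)) //= mnm1E mnm0E eqxx.
  rewrite subr0 mulr1 big1 ?addr0 => [|j /negbTE nj]; last first.
    by rewrite mnm1E mnm0E eq_sym nj subrr mulr0.
  apply; apply/mapP; exists (0%MM, U_(Ordinal lt_in)%MM) => //.
  by rewrite mem_cat map_f // mem_enum.
have wE i : (i < n)%N -> (`|nth (0 : int) w i|%N : int) = nth 0 w i.
  by move=> /w_gt0/ltW/gez0_abs.
exists [seq `|a|%N | a <- w]; split; first by rewrite size_map.
  by move=> i lt_in; rewrite (nth_map 0) ?sw // absz_gt0 gt_eqF // w_gt0.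
move=> v vV.
have := Hw (mon_diff v.1 v.2); rewrite dot_mon_diff // => H.
have {}H : 0 < \sum_(i < n) nth 0 w i * ((v.2 i)%:Z - (v.1 i)%:Z).
  by apply: H; apply/mapP; exists v; rewrite // mem_cat vV orbT.
apply: ltnW; rewrite -ltz_nat -subr_gt0.
have E a : (wsum [seq `|b|%N | b <- w] a : int) = \sum_(i < n) nth 0 w i * (a i)%:Z.
  rewrite /wsum (big_morph Posz PoszD (erefl _)); apply: eq_bigr => i _.
  by rewrite PoszM (nth_map 0) ?sw // wE.
by rewrite !E -sumrB; under eq_bigr do rewrite -mulrBr.
Qed.

End Weights.

(** * Soundness of the checker *)

Section WeightedOrder.
Variables (n : nat) (lt : rel 'X_{1..n}) (w : seq nat).
Hypothesis lt_mo : monomial_ordering lt.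

Definition weighted_lt : rel 'X_{1..n} := fun a b =>
  (wsum w a < wsum w b)%N || (wsum w a == wsum w b) && lt a b.

Lemma wlt_mo : monomial_ordering weighted_lt.
Proof.
split.
- by move=> a; rewrite /weighted_lt ltnn eqxx (mo_irr lt_mo).
- move=> b a e; rewrite /weighted_lt => /orP[ab|/andP[/eqP-> ab]] /orP[be|/andP[/eqP be lbe]].
  + by rewrite (ltn_trans ab be).
  + by rewrite -be ab.
  + by rewrite be.
  + by rewrite be eqxx (mo_trans lt_mo ab lbe) orbT.
- move=> a b /(mo_total lt_mo) ab; rewrite /weighted_lt.
  by case: ltngtP ab.
- move=> a b m; rewrite /weighted_lt !wsumD ltn_add2r eqn_add2r.
  by case/orP => [->//|/andP[-> /(mo_mul lt_mo)->]]; rewrite orbT.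
(* Accessibility by induction on the weight, and among monomials of equal weight by induction along
   [lt]. *)
- move=> a; have [k] := ubnP (wsum w a).
  elim: k a => [a|k IHk a]; first by rewrite ltn0.
  rewrite ltnS => le_k.
  have {}IHk b : (wsum w b < wsum w a)%N -> Acc weighted_lt b.
    by move=> lt_b; apply: IHk; exact: leq_trans lt_b le_k.
  move: IHk; elim/(well_founded_ind (mo_wf lt_mo)): a {le_k} => a IHa IHk.
  constructor => b /orP[/IHk H|/andP[/eqP ba lba]]; first exact: H.
  apply: (IHa b lba) => e lt_e; apply: IHk; rewrite -ba; exact: lt_e.
Qed.

Lemma wlt_wsum a b : weighted_lt a b -> (wsum w a <= wsum w b)%N.
Proof. by case/orP => [/ltnW|/andP[/eqP->]]. Qed.

End WeightedOrder.

Lemma expo_le_wsum n (w : seq nat) (a : 'X_{1..n}) (i : 'I_n) :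
  (0 < nth 0 w i)%N -> (a i <= wsum w a)%N.
Proof.
move=> w0; rewrite /wsum (bigD1 i) //=; apply: leq_trans (leq_addr _ _).
by rewrite leq_pmull.
Qed.

Lemma wdeg_of_mon n w (a : 'X_{1..n}) : wdeg w (of_mon a) = wsum w a.
Proof.
rewrite /wdeg foldrE big_map size_of_mon -[n in iota _ n]subn0 -/(index_iota 0 n).
by rewrite big_mkord; apply: eq_bigr => i _; rewrite nth_of_mon.
Qed.

Section CheckSound.
Variables (K : fieldType) (n : nat).
Variables (c : 'I_n -> 'I_n -> K) (d : 'I_n -> 'I_n -> {mpoly K[n]}).
Variables (A : algType K) (x : 'I_n -> A).
Hypothesis c_neq0 : forall i j : 'I_n, (i < j)%N -> c i j != 0.
Hypothesis A_pres : presented c d x.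
Hypothesis x_basis : forall a : A, exists! p : {mpoly K[n]}, stdpoly x p = a.
Variable lt : rel 'X_{1..n}.
Hypothesis lt_adm : admissible d lt.
Variable ds : 'I_n -> 'I_n -> terms K n.
Hypothesis ds_d : forall i j : 'I_n, (i < j)%N -> poly_of_terms (ds i j) = d i j.
Variables (gs : terms K n) (g : A).
Hypothesis gs_g : stdpoly x (poly_of_terms gs) = g.
Notation I := (input_data c ds gs).
Notation coef := (std_coef x_basis).
Notation coord := (coord x_basis).

Definition stdm (l : seq nat) : A := stdmon x (to_mon n l).

Lemma coef_feval_stdm (s : seq (K * seq nat)) m :
  (forall u, u \in s -> size u.2 = n) -> coef (feval stdm s) m = fcoef s (of_mon m).
Proof.
move=> sn; rewrite coef_sum fcoefE [RHS]big_mkcond; apply: eq_big_seq => u /sn su.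
rewrite coefZ coef_stdmon (_ : (to_mon n u.2 == m) = (u.2 == of_mon m)).
  by case: eqP; rewrite ?mulr1 ?mulr0.
by apply/eqP/eqP => [<-|->]; rewrite ?to_monK ?of_monK.
Qed.

Lemma fcoef_size (s : seq (K * seq nat)) l :
  (forall u, u \in s -> size u.2 = n) -> size l != n -> fcoef s l = 0.
Proof.
move=> sn ln; rewrite fcoefE big_seq_cond big1 // => u /andP[/sn su /eqP ul].
by rewrite -ul su eqxx in ln.
Qed.

Lemma size_of_terms (s : terms K n) u : u \in of_terms s -> size u.2 = n.
Proof. by case/mapP => v _ ->; rewrite size_of_mon. Qed.

Lemma feval_stdm_of_terms (s : terms K n) :
  feval stdm (of_terms s) = stdpoly x (poly_of_terms s).
Proof.
rewrite stdpoly_terms /feval big_map; apply: eq_bigr => u _ /=.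
by rewrite /stdm of_monK.
Qed.

Variable w : seq nat.
Hypothesis w_ok : weights_ok I w.
Notation D := (bound I w).
Notation S := (mons I w).
Notation wlt := (weighted_lt lt w).

Lemma w_gt0 (i : 'I_n) : (0 < nth 0 w i)%N.
Proof.
case/andP: w_ok => /allP H _; apply: H; by rewrite mem_iota add0n /= ltn_ord.
Qed.

Lemma fcoef_of_terms (s : terms K n) (a : 'X_{1..n}) :
  fcoef (of_terms s) (of_mon a) = (poly_of_terms s)@_a.
Proof.
by rewrite -coef_feval_stdm ?feval_stdm_of_terms ?coef_stdpoly //; apply: size_of_terms.
Qed.

(** The checked weights bound the monomials of [d i j] only weakly by [x_i x_j]; [lt] breaks the
    ties. The leading monomial for this order may differ from the one for [lt]. *)
Lemma wlt_adm : admissible d wlt.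
Proof.
split; first exact: wlt_mo lt_adm.1.
move=> i j lt_ij; have [->|[a lead_a lt_a]] := lt_adm.2 i j lt_ij; first by left.
have [->|d0] := eqVneq (d i j) 0; first by left.
have [b lead_b] := lead_exists (wlt_mo w lt_adm.1) d0.
right; exists b => //.
have le_b : (wsum w b <= wsum w (U_(i) + U_(j))%MM)%N.
  case/andP: w_ok => _ /allP/(_ j); rewrite mem_iota add0n /= ltn_ord => /(_ isT).
  move=> /allP/(_ i); rewrite mem_iota add0n /= ltn_ord leqNgt lt_ij => /(_ isT) /allP H.
  have hb : b \in msupp (d i j) by case: lead_b.
  have : (poly_of_terms (ds i j))@_b != 0 by rewrite ds_d // -mcoeff_msupp.
  rewrite -fcoef_of_terms => nz.
  have /mapP[u us bu] : of_mon b \in map snd (of_terms (ds i j)).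
    apply: contraR nz => nb; rewrite fcoefE big_seq_cond big1 // => u /andP[us /eqP ub].
    by rewrite -ub map_f in nb.
  have := H u; rewrite in_poly_data // us -bu (negbTE nz) wdeg_of_mon => /(_ isT) /= le_w.
  suff U (k : 'I_n) : wsum w U_(k)%MM = nth 0%N w k by rewrite wsumD !U.
  rewrite /wsum (bigD1 k) //= big1 ?addn0 ?mnm1E ?eqxx ?muln1 // => h /negbTE hk.
  by rewrite mnm1E eq_sym hk muln0.
have lt_b : lt b (U_(i) + U_(j))%MM.
  have hb : b \in msupp (d i j) by case: lead_b.
  have [->//|/(lead_a.2 _ hb) ba] := eqVneq b a.
  exact: (mo_trans lt_adm.1 ba lt_a).
rewrite /weighted_lt; move: le_b; rewrite leq_eqVlt => /orP[->|->//].
by rewrite lt_b orbT.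
Qed.

Definition has_lead (f : A) (m : 'X_{1..n}) : Prop := lead_monomial wlt (coord f) m.

Lemma has_lead_mul f h a b : has_lead f a -> has_lead h b -> has_lead (f * h) (a + b)%MM.
Proof.
move=> Hf Hh; have := lead_mul c_neq0 A_pres wlt_adm Hf Hh; rewrite !coordK.
case/(leads_coef x_basis (wlt_mo w lt_adm.1)) => ne0 low; split.
  by rewrite mcoeff_msupp.
by move=> u; rewrite mcoeff_msupp => /low[->|//]; rewrite eqxx.
Qed.

Lemma coord1 : coord 1 = 'X_[0].
Proof.
apply: (stdpoly_inj x_basis); rewrite coordK stdpolyX /stdmon big1 // => i _.
by rewrite mnm0E.
Qed.

Lemma has_lead1 : has_lead 1 0%MM.
Proof.
by rewrite /has_lead coord1; split; rewrite msuppX ?mem_head // => b; rewrite inE => ->.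
Qed.

Lemma has_lead_exists f : f != 0 -> exists m, has_lead f m.
Proof.
move=> f0; apply: lead_exists; first exact: wlt_mo lt_adm.1.
by apply: contra_neq f0 => cf; rewrite -[f](coordK x_basis) cf linear0.
Qed.

Lemma has_lead_prod (hs : seq A) (ms : seq 'X_{1..n}) : size ms = size hs ->
  (forall i, (i < size hs)%N -> has_lead (nth 0 hs i) (nth 0%MM ms i)) ->
  has_lead (\prod_(h <- hs) h) (\sum_(m <- ms) m)%MM.
Proof.
elim: hs ms => [|h hs IHhs] [|m ms] //= => [_ _|[sz] H].
  by rewrite !big_nil; apply: has_lead1.
rewrite !big_cons; apply: has_lead_mul; first exact: (H 0%N).
by apply: IHhs => // i lt_i; apply: (H i.+1).
Qed.

Lemma coef_g m : coef g m = fcoef (of_terms gs) (of_mon m).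
Proof. by rewrite fcoef_of_terms -gs_g coef_stdpoly. Qed.

Lemma supp_bound m : coef g m != 0 -> (wsum w m <= D)%N.
Proof.
rewrite coef_g => nz.
have /mapP[u us mu] : of_mon m \in map snd (of_terms gs).
  apply: contraR nz => nb; rewrite fcoefE big_seq_cond big1 // => u /andP[us /eqP ub].
  by rewrite -ub map_f in nb.
rewrite /bound foldrE big_map (big_rem u us) /= -mu wdeg_of_mon.
exact: leq_addr.
Qed.

Lemma mem_mons l : (l \in S) = (size l == n) && all (fun i => i <= D)%N l.
Proof.
rewrite mem_lists_of; congr (_ && _); apply: eq_all => i.
by apply: etrans (mem_iota _ _ _) _; rewrite add0n ltnS.
Qed.

Lemma mons_uniq : uniq S.
Proof. by apply: lists_of_uniq; apply: iota_uniq. Qed.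

Lemma of_mon_mons (a : 'X_{1..n}) : (wsum w a <= D)%N -> of_mon a \in S.
Proof.
move=> aD; rewrite mem_mons size_of_mon eqxx /=; apply/allP => _ /mapP[i _ ->].
by apply: leq_trans aD; apply: expo_le_wsum; apply: w_gt0.
Qed.

Definition inS (f : A) : Prop := forall m, coef f m != 0 -> of_mon m \in S.

Lemma inS_expand f : inS f -> f = \sum_(l <- S) coef f (to_mon n l) *: stdm l.
Proof.
move=> fS; apply: (coef_inj (x_basis := x_basis)) => m; rewrite coef_sum.
have [mS|mS] := boolP (of_mon m \in S).
  rewrite (bigD1_seq (of_mon m)) ?mons_uniq //= coefZ coef_stdmon of_monK eqxx mulr1.
  rewrite big_seq_cond big1 ?addr0 // => l /andP[lS lm].
  rewrite coefZ coef_stdmon (_ : _ == m = false) ?mulr0 //; apply/negbTE.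
  apply: contra lm => /eqP <-; rewrite to_monK //.
  by move: lS; rewrite mem_mons => /andP[/eqP].
rewrite big_seq big1 => [|l lS].
  by apply/eqP; apply: contraR mS => /fS.
rewrite coefZ coef_stdmon (_ : _ == m = false) ?mulr0 //; apply/negbTE.
apply: contra mS => /eqP <-; rewrite to_monK //.
by move: lS; rewrite mem_mons => /andP[/eqP].
Qed.

(** The leading monomials of the factors add up to that of [g], hence so do their weights, and for
    [wlt] the leading monomial of a factor has the largest weight in it. *)
Lemma factor_bounds (hs : seq A) : (forall h, h \in hs -> nonscalar h) ->
  \prod_(h <- hs) h = g ->
  [/\ (size hs <= D)%N, forall h, h \in hs -> inS h & forall h, h \in hs -> h != 0].
Proof.
move=> hns hg.
have hn0 h : h \in hs -> h != 0.
  by move=> /hns/(_ 0); rewrite scale0r => /eqP.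
have H h : exists m, h \in hs -> has_lead h m.
  have [/hn0/has_lead_exists[m Hm]|_] := boolP (h \in hs); first by exists m.
  by exists 0%MM.
pose lm h := proj1_sig (constructive_indefinite_description _ (H h)).
have Hlm h : h \in hs -> has_lead h (lm h).
  by rewrite /lm; case: constructive_indefinite_description.
have Hg : has_lead g (\sum_(m <- map lm hs) m)%MM.
  rewrite -hg; apply: has_lead_prod; first by rewrite size_map.
  by move=> i lt_i; rewrite (nth_map 0) //; apply/Hlm/mem_nth.
have gD : (wsum w (\sum_(m <- map lm hs) m)%MM <= D)%N.
  by apply: supp_bound; rewrite -mcoeff_msupp; case: Hg.
have wE : wsum w (\sum_(m <- map lm hs) m)%MM = (\sum_(h <- hs) wsum w (lm h))%N.
  rewrite big_map; elim/big_rec2: _ => [|h m k _ <-]; last by rewrite wsumD.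
  by rewrite /wsum big1 // => i _; rewrite mnm0E muln0.
have lmD h : h \in hs -> (wsum w (lm h) <= D)%N.
  move=> hh; apply: leq_trans gD; rewrite wE (big_rem h hh) /=; exact: leq_addr.
split=> //.
  apply: leq_trans gD; rewrite wE -sum1_size big_seq [X in (_ <= X)%N]big_seq.
  (* A factor of weight 0 would have the least monomial 1 as leading monomial and be a scalar, so
     each factor contributes at least 1. *)
  apply: leq_sum => h hh; rewrite lt0n; apply/negP => /eqP w0.
  have lm0 : lm h = 0%MM.
    apply/mnmP => i; rewrite mnm0E; apply/eqP; rewrite -leqn0 -w0.
    by apply: expo_le_wsum; apply: w_gt0.
  have [_ low] := Hlm _ hh.
  apply: (hns _ hh (coef h 0%MM)); apply: (coef_inj (x_basis := x_basis)) => m.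
  rewrite coefZ /std_coef coord1 mcoeffX.
  have [->|m0] := eqVneq 0%MM m; first by rewrite mulr1.
  rewrite mulr0; apply: memN_msupp_eq0; apply/negP => mh.
  have := low m mh; rewrite lm0 eq_sym m0 => /(_ isT) lt0.
  have := mo_ge0 (wlt_mo w lt_adm.1) (a := m); rewrite eq_sym m0 => /(_ isT).
  by rewrite (mo_asym (wlt_mo w lt_adm.1) lt0).
move=> h hh m hm; apply: of_mon_mons.
have [_ low] := Hlm _ hh.
have [->|ne] := eqVneq m (lm h); first exact: lmD.
apply: leq_trans (lmD h hh); apply: (@wlt_wsum _ lt); apply: low => //.
by rewrite mcoeff_msupp.
Qed.

Fixpoint zpt (fs : seq (seq nat -> K)) (b : seq (seq nat)) : K :=
  match fs, b with
  | f :: fs', l :: b' => f l * zpt fs' b'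
  | _, _ => 1
  end.

Definition stdw (b : seq (seq nat)) : A := weval (xvar x) (flatten (map mon_word b)).

Lemma stdw_cons l b : l \in S -> stdw (l :: b) = stdm l * stdw b.
Proof.
rewrite mem_mons => /andP[/eqP ln _].
by rewrite /stdw /= weval_cat weval_mon_word.
Qed.

Lemma prod_expand (fs : seq (seq nat -> K)) :
  \prod_(f <- fs) (\sum_(l <- S) f l *: stdm l) =
  \sum_(b <- lists_of S (size fs)) zpt fs b *: stdw b.
Proof.
elim: fs => [|f fs IHfs].
  by rewrite big_nil big_seq1 scale1r /stdw /weval big_nil.
rewrite big_cons IHfs /= big_allpairs_dep mulr_suml; apply: eq_big_seq => l lS.
rewrite mulr_sumr; apply: eq_bigr => b _ /=.
by rewrite stdw_cons // -scalerAl -scalerAr scalerA.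
Qed.

(** [K^o] is [K] as an algebra over itself, so that words of letters can be evaluated in it; [rev]
    because letters number the factors from the right. *)
Definition point (fs : seq (seq nat -> K)) (u : nat * seq nat) : K^o :=
  nth (fun=> 0) (rev fs) u.1 u.2.

Lemma weval_zword fs b : size fs = size b -> weval (point fs) (zword b) = zpt fs b.
Proof.
have sz b' : size (zword b') = size b' by elim: b' => //= l b' ->.
elim: fs b => [|f fs IHfs] [|l b] //= => [_|[sfs]]; first exact: big_nil.
rewrite /weval big_cons /point /= sz rev_cons nth_rcons size_rev sfs ltnn eqxx.
congr (_ * _); rewrite -IHfs // /weval; apply: eq_big_seq => u ub.
rewrite /point nth_rcons size_rev sfs.
suff -> : (u.1 < size b)%N by [].
elim: b {IHfs sfs l} ub => //= l b IHb; rewrite inE sz => /orP[/eqP-> //|/IHb].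
by move=> /leq_trans; apply.
Qed.

Section Table.
Variable tab : seq (seq (seq nat) *
  (seq (K * seq nat) * seq (K * (seq nat * ((nat * nat) * seq nat))))).
Hypothesis tab_ok : table_ok I S D tab.

Lemma nf_size b u : b \in lists_upto S D -> u \in nf tab b -> size u.2 = n.
Proof. by move=> /(allP tab_ok)/andP[/allP H _] /H/eqP. Qed.

Lemma nf_eval b : b \in lists_upto S D -> stdw b = feval stdm (nf tab b).
Proof.
move=> bS; have /andP[_] := allP tab_ok b bS.
move=> /(fzero_feval (weval (xvar x))); rewrite feval_cons feval_cat feval_expand /=.
rewrite [X in _ + (_ + X)]big1 => [|e _]; last first.
  by rewrite (grel_eval0 ds_d gs A_pres) mulr0 mul0r scaler0.
rewrite addr0 scale1r feval_oppmap => /eqP; rewrite subr_eq0 => /eqP E; rewrite /stdw E.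
by apply: eq_in_feval => u /(nf_size bS) un /=; rewrite weval_mon_word.
Qed.

Lemma lists_of_upto b k : (k <= D)%N -> b \in lists_of S k -> b \in lists_upto S D.
Proof. by rewrite mem_lists_of mem_lists_upto => kD /andP[/eqP-> ->]; rewrite kD. Qed.

(** The coefficients of an actual factorization are a zero of the product equations, by comparison
    of coefficients in the basis. For lists [m] of the wrong length the equation is trivial. *)
Lemma prel_eval0 (fs : seq (seq nat -> K)) m : size fs = D ->
  \prod_(f <- fs) (\sum_(l <- S) f l *: stdm l) = g ->
  feval (weval (point fs)) (prel I S D tab m) = 0 :> K^o.
Proof.
move=> sfs fsg; rewrite feval_cons /weval big_nil -/(weval (point fs)) /=.
have [/eqP mn|mn] := boolP (size m == n); last first.
  rewrite (fcoef_size (@size_of_terms gs)) // oppr0 scale0r add0r /feval big_map.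
  rewrite big_seq big1 // => b bS; rewrite (fcoef_size _ mn) ?scale0r // => u.
  by apply: nf_size; apply: lists_of_upto bS.
have := congr1 (fun f => coef f (to_mon n m)) fsg.
rewrite prod_expand sfs coef_sum coef_g to_monK // => E.
suff -> : feval (weval (point fs)) [seq (fcoef (nf tab b) m, zword b) | b <- lists_of S D]
    = fcoef (of_terms gs) m :> K^o by rewrite /GRing.scale /= mulr1 addNr.
rewrite -E /feval big_map; apply: eq_big_seq => b bS.
have bS' := lists_of_upto (leqnn D) bS.
rewrite coefZ nf_eval // coef_feval_stdm ?to_monK //; last by move=> u; apply: nf_size.
rewrite weval_zword; last by move: bS; rewrite mem_lists_of sfs => /andP[/eqP].
exact: mulrC.
Qed.

Variables (p : seq K) (pc : seq (seq (seq nat) *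
  (seq (K * (seq (nat * seq nat) *
     (((nat * seq nat) * (nat * seq nat)) * seq (nat * seq nat)))) *
   seq (K * (seq (nat * seq nat) * (seq nat * seq (nat * seq nat))))))).
Hypothesis p_ok : poly_ok I S D tab p pc.

(** Evaluate the checked identity at the factorization: the product equations vanish there,
    commutators vanish in [K], and [p(z)] is what remains. *)
Lemma zpt_root (fs : seq (seq nat -> K)) b : size fs = D ->
  \prod_(f <- fs) (\sum_(l <- S) f l *: stdm l) = g ->
  b \in lists_of S D -> root (Poly p) (zpt fs b).
Proof.
move=> sfs fsg bS; case/andP: p_ok => _ /allP/(_ b bS).
move=> /(fzero_feval (weval (point fs) : _ -> K^o)).
rewrite !feval_cat !feval_expand [X in _ + (X + _)]big1 => [|e _]; last first.
  by rewrite prel_eval0 // mulr0 mul0r scaler0.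
rewrite [X in _ + (_ + X)]big1 => [|e _]; last first.
  rewrite /commutator !feval_cons feval_nil /weval !big_cons !big_nil /= !mulr1 scaleN1r.
  by rewrite scale1r addr0 [point fs _ * _]mulrC subrr mulr0 mul0r scaler0.
rewrite !addr0 /feval big_map => E; rewrite /root (horner_coef_wide _ (size_Poly p)).
have sb : size fs = size b by move: bS; rewrite mem_lists_of sfs => /andP[/eqP->].
apply/eqP; rewrite -[RHS]E -[k in iota _ k]subn0 -/(index_iota 0 (size p)).
rewrite big_mkord; apply: eq_bigr => k _ /=.
by rewrite coef_Poly weval_flatten big_nseq -Monoid.iteropE weval_zword.
Qed.

Lemma mem_elements (W : seq K) (T : seq (seq nat)) e :
  (e \in elements W T) = (map snd e == T) && all (fun u => u.1 \in W) e.
Proof.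
elim: T e => [|l T IHT] [|[k l'] e] //=.
  by apply/allpairsP => -[u []].
apply/allpairsP/idP => [[[k1 e1] /= [kW eT [-> -> ->]]]|].
  by move: eT; rewrite IHT eqseq_cons eqxx /= => /andP[-> ->]; rewrite kW.
rewrite eqseq_cons => /andP[/andP[/eqP-> eT] /andP[kW eW]].
by exists (k, e); rewrite IHT eT eW.
Qed.

Lemma prodexp_eval (cs : seq (seq (K * seq nat))) :
  (forall e, e \in cs -> map snd e = S) ->
  feval stdw (prodexp cs) = \prod_(e <- cs) feval stdm e /\
  forall u, u \in prodexp cs -> u.2 \in lists_of S (size cs).
Proof.
elim: cs => [|e cs IHcs] eS.
  rewrite big_nil /feval big_seq1 scale1r /stdw /weval big_nil; split=> // u.
  by rewrite inE => /eqP->.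
have [|IH1 IH2] := IHcs; first by move=> e' h; apply: eS; rewrite in_cons h orbT.
have eSS u : u \in e -> u.2 \in S by rewrite -(eS e (mem_head _ _)) => /(map_f snd).
split.
  rewrite big_cons -IH1 /feval big_allpairs_dep mulr_suml; apply: eq_big_seq => u ue.
  rewrite mulr_sumr; apply: eq_bigr => v _ /=.
  by rewrite stdw_cons ?eSS // -scalerAl -scalerAr scalerA.
move=> u /allpairsP[[a b] /= [ae bc ->]].
by apply/allpairsP; exists (a.2, b.2); rewrite /= eSS ?IH2.
Qed.

Lemma nfprod_eval (cs : seq (seq (K * seq nat))) : (size cs <= D)%N ->
  (forall e, e \in cs -> map snd e = S) ->
  feval stdm (nfprod tab cs) = \prod_(e <- cs) feval stdm e /\
  forall u, u \in nfprod tab cs -> size u.2 = n.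
Proof.
move=> csD eS; have [<- keys] := prodexp_eval eS; split.
  rewrite feval_flatten big_map; apply: eq_big_seq => u /keys uS.
  by rewrite feval_scale nf_eval //; apply: lists_of_upto uS.
move=> u /flattenP[s /mapP[v vc ->]] /mapP[r rv ->] /=.
by apply: nf_size rv; apply: lists_of_upto (keys v vc).
Qed.

Lemma is_factP (cs : seq (seq (K * seq nat))) : (size cs <= D)%N ->
  (forall e, e \in cs -> map snd e = S) ->
  is_fact I tab cs = all (@nonsc K) cs && (\prod_(e <- cs) feval stdm e == g).
Proof.
move=> csD eS; have [<- keys] := nfprod_eval csD eS; congr (_ && _).
have gE : feval stdm (of_terms gs) = g by rewrite feval_stdm_of_terms.
have keys' u : u \in nfprod tab cs ++ fscale (- 1) (of_terms gs) -> size u.2 = n.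
  rewrite mem_cat => /orP[/keys//|/mapP[v vg ->]].
  exact: (size_of_terms vg).
apply/fzeroP/eqP => [H|H m].
  apply: (coef_inj (x_basis := x_basis)) => m; apply/eqP; rewrite -subr_eq0; apply/eqP.
  have := H (of_mon m); rewrite -coef_feval_stdm // feval_cat feval_scale gE coefD coefZ.
  by rewrite mulN1r.
have [/eqP mn|mn] := boolP (size m == n); last exact: fcoef_size.
rewrite -[m](to_monK mn) -coef_feval_stdm // feval_cat feval_scale gE H.
by rewrite scaleN1r subrr coef0.
Qed.

Lemma nonscP (e : seq (K * seq nat)) : map snd e = S ->
  reflect (nonscalar (feval stdm e)) (nonsc e).
Proof.
move=> eS.
have sz u : u \in e -> size u.2 = n.
  by move/(map_f snd); rewrite eS mem_mons => /andP[/eqP].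
have eu : uniq (map snd e) by rewrite eS mons_uniq.
have eE u : u \in e -> coef (feval stdm e) (to_mon n u.2) = u.1.
  move=> ue; rewrite coef_feval_stdm // to_monK ?sz //.
  rewrite fcoefE -big_filter (_ : [seq v <- e | v.2 == u.2] = [:: u]) ?big_seq1 //.
  elim: e eu ue {eS sz} => //= v e IHe /andP[ve eu]; rewrite inE => /orP[/eqP->|ue].
    rewrite eqxx; congr (_ :: _); apply/eqP; rewrite -(negbK (_ == _)) -has_filter.
    by apply: contra ve => /hasP[y ye /eqP<-]; rewrite map_f.
  have [vu|_] := eqVneq v.2 u.2; last exact: IHe.
  by rewrite vu map_f in ve.
apply: (iffP hasP) => [[u ue /andP[u1 /hasP[a al a0]]] k ek|ns].
  have := eE u ue; rewrite ek coefZ /std_coef coord1 mcoeffX.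
  suff /negbTE-> : 0%MM != to_mon n u.2 by rewrite mulr0 => u0; rewrite -u0 eqxx in u1.
  apply: contra a0 => /eqP l0; have := to_monK (sz u ue); rewrite -l0 => E.
  by move: al; rewrite -E => /mapP[i _ ->]; rewrite mnm0E.
have [//|H] := boolP (has (fun u => (u.1 != 0) && has (fun a => a != 0%N) u.2) e).
  by move/hasP.
case: (ns (coef (feval stdm e) 0%MM)); apply: (coef_inj (x_basis := x_basis)) => m.
rewrite coefZ [coef 1 _]/std_coef coord1 mcoeffX.
have [<-|m0] := eqVneq 0%MM m; first by rewrite mulr1.
rewrite mulr0 coef_feval_stdm // fcoefE big_seq_cond big1 // => u /andP[ue /eqP um].
apply/eqP; move/hasPn: H => /(_ u ue); rewrite negb_and negbK => /orP[//|/hasPn u0].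
case/eqP: m0; apply/mnmP => i; rewrite mnm0E; apply/esym/eqP; rewrite -nth_of_mon -um.
by have := u0 (nth 0%N u.2 i); rewrite negbK; apply; rewrite mem_nth ?sz.
Qed.

(** Exchanging the monomial chosen in factor [i] exchanges one coefficient in the product; stated
    without division, as the coefficient may be 0. *)
Lemma zpt_set (fs : seq (seq nat -> K)) b i l : size fs = size b -> (i < size b)%N ->
  zpt fs (set_nth [::] b i l) * nth (fun=> 0) fs i (nth [::] b i) =
  zpt fs b * nth (fun=> 0) fs i l.
Proof.
elim: fs b i => [|f fs IHfs] [|l' b] [|i] //= [sfs] lt_i.
  by rewrite mulrC [f l * _]mulrC mulrA.
by rewrite -!mulrA IHfs // mulrA.
Qed.

Variable V : seq K.
Hypothesis V_roots : forall a, (a \in V) = root (Poly p) a.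
Notation W := (V ++ [seq u * v^-1 | u <- V, v <- V]).

(** Choose in each factor a nonzero pivot coefficient. The products with all pivots, or with one
    pivot exchanged, are roots of [p], and their ratios are the coefficients of the factors relative
    to the pivots. *)
Lemma candidates_complete (hs : seq A) : (forall h, h \in hs -> nonscalar h) ->
  \prod_(h <- hs) h = g ->
  exists cs, [/\ size cs = size hs, all (fun e => e \in elements W S) cs,
    \prod_(e <- cs) feval stdm e = g
    & forall i, (i < size hs)%N -> exists2 k : K, k != 0 &
        feval stdm (nth [::] cs i) = k *: nth 0 hs i].
Proof.
move=> hns hg; have [hsD hsS hs0] := factor_bounds hns hg.
(* The equations concern exactly [D] factors, and [factor_bounds] gives [size hs <= D]. *)
pose hs' := hs ++ nseq (D - size hs) 1.
pose f (h : A) (l : seq nat) := coef h (to_mon n l).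
have one_supp m : coef 1 m = (0%MM == m)%:R by rewrite /std_coef coord1 mcoeffX.
have S1 : inS 1.
  move=> m; rewrite one_supp; have [<- _|_] := eqVneq 0%MM m; last by rewrite eqxx.
  by apply: of_mon_mons; rewrite /wsum big1 // => i _; rewrite mnm0E muln0.
have hs'S h : h \in hs' -> inS h.
  by rewrite mem_cat => /orP[/hsS//|/nseqP[->]].
have hs'0 h : h \in hs' -> h != 0.
  by rewrite mem_cat => /orP[/hs0//|/nseqP[-> _]]; apply: oner_neq0.
have Hpl h : exists l, h \in hs' -> l \in S /\ f h l != 0.
  have [hh|_] := boolP (h \in hs'); last by exists [::].
  have /lead_exists-/(_ lt lt_adm.1)[m [mh _]] : coord h != 0.
    by apply: contra_neq (hs'0 h hh) => ch; rewrite -[h](coordK x_basis) ch linear0.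
  rewrite mcoeff_msupp in mh.
  by exists (of_mon m) => _; split; rewrite ?/f ?of_monK //; apply: hs'S mh.
pose pl h := proj1_sig (constructive_indefinite_description _ (Hpl h)).
have plP h : h \in hs' -> pl h \in S /\ f h (pl h) != 0.
  by rewrite /pl; case: constructive_indefinite_description.
pose fs := map f hs'; pose b := map pl hs'.
have sz' : size hs' = D by rewrite size_cat size_nseq subnKC.
have fsg : \prod_(f0 <- fs) (\sum_(l <- S) f0 l *: stdm l) = g.
  rewrite big_map -hg (eq_big_seq id) => [|h /hs'S hS]; last by rewrite -inS_expand.
  by rewrite big_cat /= [X in _ * X]big1_seq ?mulr1 // => h /= /nseqP[->].
have bS l i : l \in S -> (i < D)%N -> set_nth [::] b i l \in lists_of S D.
  move=> lS lt_i; rewrite mem_lists_of size_set_nth size_map sz' (maxn_idPr lt_i) eqxx /=.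
  apply/(all_nthP [::]) => j; rewrite size_set_nth size_map sz' (maxn_idPr lt_i) => lt_j.
  rewrite nth_set_nth /=; case: eqP => // _.
  by rewrite (nth_map 0) ?sz' //; case: (plP (nth 0 hs' j)); rewrite ?mem_nth ?sz'.
have rootV l i : l \in S -> (i < D)%N -> zpt fs (set_nth [::] b i l) \in V.
  by move=> lS lt_i; rewrite V_roots zpt_root ?size_map // bS.
pose zb := zpt fs b.
have zbE : zb = \prod_(h <- hs') f h (pl h).
  by rewrite /zb /fs /b; elim: (hs') => [|h t IHt]; rewrite ?big_nil //= big_cons IHt.
have zb0 : zb != 0.
  by rewrite zbE prodf_seq_neq0; apply/allP => h /plP[_ ->].
(* The only nonzero coefficient of 1 is 1, so the padding does not change the product of the
   pivots. *)
have zbE' : zb = \prod_(h <- hs) f h (pl h).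
  rewrite zbE big_cat /= [X in _ * X]big1_seq ?mulr1 // => h /andP[_ h1].
  have hh : h \in hs' by rewrite mem_cat h1 orbT.
  have [_] := plP h hh; case/nseqP: h1 => -> _.
  by rewrite /f one_supp; have [//|_] := eqVneq 0%MM _; rewrite eqxx.
(* Every pivot is scaled to 1 except that of the first factor, which absorbs [zb]; so the scalars
   multiply to 1 and the product stays [g]. *)
pose us i := (if i == 0%N then zb else 1) / f (nth 0 hs i) (pl (nth 0 hs i)).
have us0 i : (i < size hs)%N -> us i != 0.
  move=> lt_i; rewrite /us mulf_neq0 //; first by case: ifP; rewrite ?oner_neq0.
  by rewrite invr_neq0 //; case: (plP (nth 0 hs i)) => //; rewrite mem_cat mem_nth.
pose e i := [seq (us i * f (nth 0 hs i) l, l) | l <- S].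
have eE i : (i < size hs)%N -> feval stdm (e i) = us i *: nth 0 hs i.
  move=> lt_i; rewrite [in RHS](inS_expand (hsS _ (mem_nth 0 lt_i))) /feval big_map scaler_sumr.
  by apply: eq_bigr => l _; rewrite scalerA.
exists (mkseq e (size hs)); split.
- by rewrite size_mkseq.
- apply/allP => e' /mapP[i]; rewrite mem_iota add0n => /andP[_ lt_i] ->.
  have lt_iD : (i < D)%N by apply: leq_trans lt_i hsD.
  rewrite mem_elements -map_comp map_id eqxx /=; apply/allP => _ /mapP[l lS ->] /=.
  have sfb : size fs = size b by rewrite !size_map.
  have lt_ib : (i < size b)%N by rewrite size_map sz'.
  have hi' : nth 0 hs i \in hs' by rewrite mem_cat mem_nth.
  have := zpt_set l sfb lt_ib.
  rewrite (nth_map 0) ?sz' // (nth_map 0) ?sz' // nth_cat lt_i -/zb.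
  have [_] := plP _ hi'.
  set h := nth 0 hs i => fh0 E; rewrite /us mem_cat.
  (* This root is the scaled coefficient itself for the first factor, and [zb] times it for the
     others. *)
  have {}E : zpt fs (set_nth [::] b i l) = zb * f h l / f h (pl h).
    by apply: (mulIf fh0); rewrite E divfK.
  have zV := rootV l i lS lt_iD; rewrite E in zV.
  case: eqP => _; first by rewrite mulrAC zV.
  have zbV : zb \in V.
    rewrite V_roots zpt_root ?size_map // mem_lists_of size_map sz' eqxx /=.
    by apply/allP => _ /mapP[h' /plP[hS _] ->].
  apply/orP; right; apply/allpairsP.
  exists (zb * f h l / f h (pl h), zb); split=> //=.
  by rewrite div1r mulrAC [zb * _]mulrC mulfK // mulrC.
- rewrite big_map.
  have -> : \prod_(i <- iota 0 (size hs)) feval stdm (e i) =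
      \prod_(i < size hs) (us i *: nth 0 hs i).
    rewrite -[k in iota _ k]subn0 -/(index_iota 0 (size hs)) big_mkord.
    by apply: eq_bigr => i _; rewrite eE.
  rewrite scaler_prod -hg [RHS](big_nth 0) big_mkord.
  suff -> : \prod_(i < size hs) us i = 1 by rewrite scale1r.
  rewrite /us big_split /= prodfV.
  have -> : \prod_(i < size hs) f (nth 0 hs i) (pl (nth 0 hs i)) = zb.
    by rewrite zbE' (big_nth 0) big_mkord.
  (* Without factors nothing absorbs [zb], but then [zb] is an empty product. *)
  case hs_nil: (size hs) => [|k].
    by rewrite big_ord0 mul1r zbE' (size0nil hs_nil) big_nil invr1.
  by rewrite big_ord_recl /= big1 ?mulr1 ?divff.
- by move=> i lt_i; exists (us i); rewrite ?us0 // nth_mkseq ?eE.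
Qed.

(** Candidates are filtered by an exact test, so every listed tuple is a factorization; the choice
    of [W] matters for completeness only. *)
Lemma facts_sound : all_factorizations g
  [seq [seq feval stdm e | e <- cs]
     | cs <- [seq cs <- lists_upto (elements W S) D | is_fact I tab cs]].
Proof.
have keys cs : all (fun e => e \in elements W S) cs -> forall e, e \in cs -> map snd e = S.
  by move=> /allP csW e /csW; rewrite mem_elements => /andP[/eqP].
split.
  move=> _ /mapP[cs + ->]; rewrite mem_filter mem_lists_upto => /andP[+ /andP[csD csW]].
  rewrite is_factP //; last exact: keys csW.
  case/andP => /allP ns /eqP csg; split; last by rewrite big_map.
  by move=> _ /mapP[e ecs ->]; apply/nonscP; [exact: keys csW _ ecs|exact: ns].
move=> hs hns hg; have [cs [szcs csW csg Hcs]] := candidates_complete hns hg.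
have [hsD _ _] := factor_bounds hns hg.
exists [seq feval stdm e | e <- cs]; split; last 1 first.
- move=> i lt_i; have [k k0 E] := Hcs i lt_i.
  exists (k^-1)%:A; last first.
    by rewrite (nth_map [::]) ?szcs // E mulr_algl scalerA mulVf ?scale1r.
  split; last by move=> a; rewrite mulr_algl mulr_algr.
  by exists k%:A; rewrite !mulr_algl !scalerA mulVf ?mulfV ?scale1r.
- apply/mapP; exists cs => //; rewrite mem_filter mem_lists_upto szcs hsD csW !andbT.
  rewrite is_factP ?szcs //; last exact: keys csW.
  rewrite csg eqxx andbT; apply/allP => e ecs.
  apply/nonscP; first exact: keys csW _ ecs.
  have lt_i : (index e cs < size hs)%N by rewrite -szcs index_mem.
  have [k k0] := Hcs _ lt_i; rewrite nth_index // => -> j E.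
  apply: (hns _ (mem_nth 0 lt_i) (k^-1 * j)).
  by rewrite -scalerA -E scalerA mulVf ?scale1r.
- by rewrite size_map.
Qed.

End Table.
End CheckSound.

(** * Existence of certificates *)

Section FreeCommutative.
Import -(notations) finmap.
Variables (K : fieldType) (T : choiceType).

Definition word_monomial (w : seq T) : cmonom T :=
  foldr (fun i m => mmul (ucm i) m) mone w.

Lemma word_monomialE w i : word_monomial w i = count_mem i w.
Proof.
elim: w => [|j w IHw] /=; first by rewrite cm1.
by rewrite cmM cmU IHw.
Qed.

Lemma word_monomial_perm u v : (word_monomial u == word_monomial v) = perm_eq u v.
Proof.
apply/cmP/permP => [uv|uv i]; last by rewrite !word_monomialE uv.
by apply/permP/allP => i _; rewrite /= -!word_monomialE uv.
Qed.

(** Commutative monomials are words up to permutation, so freeness makes coefficients cancel on each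
    permutation class, the hypothesis of [commutator_cert]. *)
Lemma free_commutative_algebra : exists (L : comAlgType K) (var : T -> L),
  (forall f, exists s, f = feval (weval var) s) /\
  (forall s, feval (weval var) s = 0 ->
     forall w, \sum_(u <- s | perm_eq u.2 w) u.1 = 0).
Proof.
pose L : comAlgType K := @malg (cmonom T) K.
pose var (i : T) : L := mkmalgU (ucm i) 1.
have varE w : weval var w = mkmalgU (word_monomial w) 1.
  elim: w => [|i w IHw]; first exact: big_nil.
  have -> : weval var (i :: w) = var i * weval var w by exact: big_cons.
  rewrite IHw; apply: etrans (fgmulUU 1 1 (ucm i) (word_monomial w)) _.
  exact (congr1 (mkmalgU (word_monomial (i :: w))) (mulr1 (1 : K))).
have scaleU (k : K) m : mkmalgU m k = k *: (mkmalgU m 1 : L).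
  exact: malgU_scale.
exists L, var; split=> [f|s s0 w].
  pose word (m : cmonom T) :=
    flatten [seq nseq (m i) i | i <- enum_fset (finsupp m)].
  have wordK m : word_monomial (word m) = m.
    apply/eqP/cmP => i; rewrite word_monomialE /word.
    rewrite (@count_flatten_nseq _ m) ?fset_uniq // -cmE_neq0.
    by case: (m i) => // k; rewrite muln1.
  exists [seq (monalg.mcoeff m f, word m) | m <- enum_fset (monalg.msupp f)].
  rewrite [LHS]monalgE /feval big_map; apply: eq_bigr => m _ /=.
  by rewrite scaleU varE wordK.
have E : monalg.mcoeff (word_monomial w) (feval (weval var) s) =
    \sum_(u <- s | perm_eq u.2 w) u.1.
  elim: (s) => [|u t IHt]; first by rewrite feval_nil big_nil; exact: monalg.mcoeff0.
  rewrite feval_cons big_cons -IHt.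
  apply: etrans (monalg.mcoeffD _ _ _) _.
  have -> : monalg.mcoeff (word_monomial w) (u.1 *: weval var u.2) =
      u.1 * (perm_eq u.2 w)%:R.
    apply: etrans (monalg.mcoeffZ _ _ _) _; congr (_ * _).
    by rewrite varE; apply: etrans (mcoeffU _ _ _) _; rewrite word_monomial_perm.
  by case: perm_eq; rewrite ?mulr1 // mulr0 add0r.
by rewrite -E s0; exact: monalg.mcoeff0.
Qed.

End FreeCommutative.

Section CommutatorCertificates.
Variables (K : fieldType) (T : choiceType).

(** Replace each word by a representative of its permutation class. This changes the sum by an
    element of the commutator ideal, and the resulting sum cancels formally. *)
Lemma commutator_cert (s : seq (K * seq T)) :
  (forall w, \sum_(u <- s | perm_eq u.2 w) u.1 = 0) ->
  exists crt, fzero (s ++ expand (@commutator K T) crt).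
Proof.
move=> s0; have [F [b [b_nil b_cat b_span b_free]]] := free_algebra K T.
pose J f := exists crt, feval b (expand (@commutator K T) crt) = f.
have JD f g : J f -> J g -> J (f + g) by exact: expand_gensD.
have JZ k f : J f -> J (k *: f) by exact: expand_gensZ.
have J0 : J 0 by exists [::]; rewrite feval_nil.
have JM f g h : J g -> J (f * g * h).
  case=> crt <-; rewrite feval_expand_word // mulr_sumr mulr_suml.
  apply: expand_gens_sum => // e _; rewrite -scalerAr -scalerAl; apply: JZ.
  by rewrite !mulrA -[_ * b e.2.2.2 * h]mulrA; apply: expand_gensM.
have comE i j : b [:: i] * b [:: j] - b [:: j] * b [:: i] = feval b (commutator K (i, j)).
  by rewrite !feval_cons feval_nil /= scale1r scaleN1r addr0 -!b_cat.
(* Moving a letter past a word: the commutator with a letter is a derivation. *)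
have Jcom i v : J (b [:: i] * b v - b v * b [:: i]).
  elim: v => [|j v IHv]; first by rewrite b_nil mulr1 mul1r subrr.
  rewrite -[j :: v]cat1s b_cat.
  have -> : b [:: i] * (b [:: j] * b v) - b [:: j] * b v * b [:: i] =
      1 * (b [:: i] * b [:: j] - b [:: j] * b [:: i]) * b v
      + b [:: j] * (b [:: i] * b v - b v * b [:: i]) * 1.
    by rewrite mul1r mulr1 mulrBl mulrBr !mulrA addrA subrK.
  apply: JD; last exact: JM.
  by apply: JM; rewrite comE -[feval b _]mulr1 -[_ * 1]mul1r mulrA; apply: expand_gensM.
have Jperm u v : perm_eq u v -> J (b u - b v).
  elim: u v => [|i u IHu] v uv.
    by have /nilP-> : nilp v; rewrite ?subrr // /nilp -(perm_size uv).
  have iv : i \in v by rewrite -(perm_mem uv) mem_head.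
  case/splitPr: iv uv => v1 v2; rewrite perm_sym perm_catC cat_cons perm_cons perm_catC perm_sym.
  move=> /IHu H.
  have -> : b (i :: u) - b (v1 ++ i :: v2) = b [:: i] * (b u - b (v1 ++ v2)) * 1
      + 1 * (b [:: i] * b v1 - b v1 * b [:: i]) * b v2.
    rewrite mulr1 mul1r mulrBl mulrBr -[i :: u]cat1s -[i :: v2]cat1s !b_cat !mulrA addrA subrK.
    by [].
  by apply: JD; apply: JM.
pose ws := map snd s; pose rep w := nth [::] ws (find (perm_eq w) ws).
have rep_perm w : w \in ws -> perm_eq w (rep w).
  by move=> hw; apply: nth_find; apply/hasP; exists w.
have rep_eq u v : perm_eq u v -> rep u = rep v.
  by move=> /permPl uv; rewrite /rep (eq_find uv).
pose s' := [seq (u.1, rep u.2) | u <- s].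
have s'0 : feval b s' = 0.
  apply: fzero_feval; apply/allP => _ /mapP[u us ->] /=.
  rewrite fcoefE big_map /= -[X in _ == X](s0 (rep u.2)); apply/eqP.
  rewrite [LHS]big_seq_cond [RHS]big_seq_cond; apply: eq_bigl => v /=.
  case vs: (v \in s) => //=.
  have hv : v.2 \in ws by apply: map_f.
  have hu : u.2 \in ws by apply: map_f.
  apply/eqP/idP => [<-|vu]; first exact: rep_perm.
  apply: rep_eq; rewrite perm_sym; apply: perm_trans (rep_perm _ hu) _.
  by rewrite perm_sym.
have [crt crtE] : J (- 1 *: feval b s).
  apply: (JZ _ _ _); rewrite -[feval b s]subr0 -s'0 /feval big_map -sumrB.
  apply: (@expand_gens_sum _ _ _ _ _ b_nil b_cat) => u us.
  by rewrite -scalerBr; apply: JZ; apply/Jperm/rep_perm/map_f.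
exists crt; apply: b_free; rewrite feval_cat crtE scaleN1r subrr.
by [].
Qed.

End CommutatorCertificates.

Lemma lists_of_map (X Y : Type) (f : X -> Y) (s : seq X) k :
  lists_of (map f s) k = map (map f) (lists_of s k).
Proof.
have E L : [seq x :: l | x <- map f s, l <- map (map f) L] =
    map (map f) [seq x :: l | x <- s, l <- L].
  elim: (s) => //= y t IHt; rewrite map_cat -[X in _ = _ ++ X]IHt -!map_comp.
  by [].
by elim: k => //= k ->.
Qed.

Lemma lookup_map (X : eqType) (Y : Type) (d : Y) (f : X -> Y) s x :
  x \in s -> lookup d [seq (y, f y) | y <- s] x = f x.
Proof.
elim: s => //= y s IHs; rewrite in_cons eq_sym; case: eqP => [->//|_] /=.
exact: IHs.
Qed.

Section CheckComplete.
Variables (K : fieldType) (n : nat).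
Variables (c : 'I_n -> 'I_n -> K) (d : 'I_n -> 'I_n -> {mpoly K[n]}).
Variables (A : algType K) (x : 'I_n -> A).
Hypothesis c_neq0 : forall i j : 'I_n, (i < j)%N -> c i j != 0.
Hypothesis A_pres : presented c d x.
Hypothesis x_basis : forall a : A, exists! p : {mpoly K[n]}, stdpoly x p = a.
Variable lt : rel 'X_{1..n}.
Hypothesis lt_adm : admissible d lt.
Variable ds : 'I_n -> 'I_n -> terms K n.
Hypothesis ds_d : forall i j : 'I_n, (i < j)%N -> poly_of_terms (ds i j) = d i j.
Variables (gs : terms K n).
Notation I := (input_data c ds gs).
Notation coef := (std_coef x_basis).
Notation coord := (coord x_basis).
Let g := stdpoly x (poly_of_terms gs).

(** Admissibility puts each monomial of [d i j] below [x_i x_j]; these finitely many pairs are given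
    to [weights_exist]. *)
Lemma weights_complete : exists w, weights_ok I w.
Proof.
pose V := flatten [seq [seq (a, (U_(p.1) + U_(p.2))%MM) | a <- msupp (d p.1 p.2)]
                  | p : 'I_n * 'I_n <- enum {: 'I_n * 'I_n} & (p.1 < p.2)%N].
have [|w [sw w0 Hw]] := weights_exist lt_adm.1 (V := V).
  move=> v /flattenP[s /mapP[[i j]]]; rewrite mem_filter /= => /andP[lt_ij _] ->.
  case/mapP => a da -> /=.
  have [d0|[b [_ low] lt_b]] := lt_adm.2 i j lt_ij; first by rewrite d0 msupp0 in da.
  have [->//|/(low _ da) ab] := eqVneq a b.
  exact: (mo_trans lt_adm.1 ab lt_b).
exists w; apply/andP; split; apply/allP => j; rewrite mem_iota add0n => /andP[_ lt_j].
  exact: w0.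
apply/allP => i; rewrite mem_iota add0n => /andP[_ lt_i].
have [//|lt_ij] := leqP j i; apply/allP => u.
rewrite (@in_poly_data _ _ c ds gs (Ordinal lt_i) (Ordinal lt_j)) // => us.
have [//|nz] := eqVneq; rewrite orFb.
have /mapP[v _ uE] := us; have -> : u.2 = of_mon v.2 by rewrite uE.
rewrite wdeg_of_mon.
have dv : v.2 \in msupp (d (Ordinal lt_i) (Ordinal lt_j)).
  by move: nz; rewrite uE /= (fcoef_of_terms x_basis) ds_d // -mcoeff_msupp.
have := Hw (v.2, (U_(Ordinal lt_i) + U_(Ordinal lt_j))%MM).
have U (k : 'I_n) : wsum w U_(k)%MM = nth 0%N w k.
  rewrite /wsum (bigD1 k) //= big1 ?addn0 ?mnm1E ?eqxx ?muln1 // => h /negbTE hk.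
  by rewrite mnm1E eq_sym hk muln0.
rewrite /= wsumD !U /=; apply; apply/flattenP.
exists [seq (a, (U_(Ordinal lt_i) + U_(Ordinal lt_j))%MM)
       | a <- msupp (d (Ordinal lt_i) (Ordinal lt_j))].
  apply/mapP; exists (Ordinal lt_i, Ordinal lt_j) => //.
  by rewrite mem_filter lt_ij mem_enum.
by apply/mapP; exists v.2.
Qed.

Variable w : seq nat.
Notation D := (bound I w).
Notation S := (mons I w).

Lemma size_mons l : l \in S -> size l = n.
Proof. by rewrite mem_lists_of => /andP[/eqP]. Qed.

Definition nf_terms (b : seq (seq nat)) : seq (K * seq nat) :=
  [seq ((coord (stdw x b))@_a, of_mon a) | a <- msupp (coord (stdw x b))].

Lemma nf_cert b : b \in lists_upto S D -> exists crt,
  fzero ((1, flatten (map mon_word b)) ::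
    [seq (- u.1, mon_word u.2) | u <- nf_terms b] ++ expand (grel I) crt).
Proof.
rewrite mem_lists_upto => /andP[_ /allP bS].
apply: (ideal_cert_exists ds_d gs A_pres); last by rewrite coordK.
apply/allP => k /flattenP[s /mapP[l /bS lS ->]].
by move/(allP (mon_word_letters l)); rewrite (size_mons lS).
Qed.

(** The table only has to exist for the search to stop, so its cofactors may be chosen
    classically. *)
Definition nf_cert_choice b :=
  match excluded_middle_informative (b \in lists_upto S D) with
  | left h => proj1_sig (constructive_indefinite_description _ (nf_cert h))
  | right _ => [::]
  end.

Definition nf_table :=
  [seq (b, (nf_terms b, nf_cert_choice b)) | b <- lists_upto S D].

Lemma nf_table_lookup b : b \in lists_upto S D ->
  lookup ([::], [::]) nf_table b = (nf_terms b, nf_cert_choice b).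
Proof. by move=> bS; rewrite (lookup_map _ (fun b => (nf_terms b, nf_cert_choice b))). Qed.

Lemma nf_table_ok : table_ok I S D nf_table.
Proof.
apply/allP => b bS; rewrite /nf nf_table_lookup //=; apply/andP; split.
  by apply/allP => _ /mapP[a _ ->] /=; rewrite size_of_mon.
rewrite /nf_cert_choice; case: excluded_middle_informative => [h|//].
by case: constructive_indefinite_description.
Qed.

Let S' : seq 'X_{1..n} := map (to_mon n) S.

Lemma mapS' : map (@of_mon n) S' = S.
Proof.
rewrite -map_comp -[RHS]map_id; apply/eq_in_map => l lS /=.
by rewrite to_monK // size_mons.
Qed.

Lemma S'_uniq : uniq S'.
Proof.
by rewrite map_inj_in_uniq ?mons_uniq // => l l' lS l'S ll';
  rewrite -(to_monK (size_mons lS)) ll' to_monK // size_mons.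
Qed.

Lemma stdw_of_mon b : stdw x (map (@of_mon n) b) = stdprod x b.
Proof.
rewrite /stdw weval_flatten big_map big_map; apply: eq_bigr => a _.
by rewrite weval_of_mon.
Qed.

Lemma fcoef_nf b m : b \in lists_of S' D ->
  fcoef (nf nf_table (map (@of_mon n) b)) (of_mon m) = coef (stdprod x b) m.
Proof.
move=> bS; rewrite /nf nf_table_lookup; last first.
  have : map (@of_mon n) b \in lists_of S D.
    by rewrite -mapS' lists_of_map map_f.
  by rewrite mem_lists_of mem_lists_upto => /andP[/eqP-> ->]; rewrite leqnn.
rewrite -(coef_feval_stdm x_basis) => [|u /mapP[a _ ->]]; last by rewrite size_of_mon.
congr coef; rewrite -stdw_of_mon -[RHS](coordK x_basis) /feval big_map.
by apply: eq_bigr => a _; rewrite /stdm of_monK.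
Qed.

(** Run the integrality argument with independent variables as coefficients. Membership in
    [prod_ideal] then gives cofactors of the product equations, and what is left vanishes by
    commutativity alone. *)
Lemma poly_complete : exists p pc, poly_ok I S D nf_table p pc.
Proof.
have [L [var [L_span L_free]]] := free_commutative_algebra K (nat * seq nat)%type.
pose X k (a : 'X_{1..n}) : L := var (k, of_mon a).
pose lw := weval var.
have [p p0 Hp] := annihilator c_neq0 A_pres x_basis lt_adm S'_uniq X D (coef g).
have zvalE b : zval X b = lw (zword (map (@of_mon n) b)).
  elim: b => [|a b IHb]; first by rewrite /lw /weval big_nil.
  rewrite /= IHb /lw /weval [RHS]big_cons; congr (_ * _); rewrite /X; congr (var (_, _)).
  by elim: b {IHb} => //= a' b' ->.
have prelE m : feval lw (prel I S D nf_table (of_mon m)) =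
    tail_coef x_basis S' X D m - (coef g m)%:A.
  rewrite feval_cons /= addrC [lw [::]]big_nil scaleNr; congr (_ - _ *: _); last first.
    by rewrite (fcoef_of_terms x_basis) coef_stdpoly.
  rewrite /feval big_map -mapS' lists_of_map big_map; apply: eq_big_seq => b bS.
  by rewrite fcoef_nf // zvalE.
have powE z : feval lw (powers (polyseq p) z) = horner_alg (lw z) p.
  rewrite /feval big_map -[in RHS](coefK p) poly_def linear_sum.
  rewrite -[k in iota _ k]subn0 -/(index_iota 0 (size p)) big_mkord.
  apply: eq_bigr => k _ /=.
  rewrite -mul_polyC rmorphM rmorphXn /= horner_algC horner_algX mulr_algl.
  by rewrite /lw weval_flatten big_nseq -Monoid.iteropE.
have cert b : exists pc, b \in lists_of S D ->
    fzero (powers (polyseq p) (zword b) ++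
      (expand (prel I S D nf_table) pc.2 ++ expand (@commutator K _) pc.1)).
  have [bS|_] := boolP (b \in lists_of S D); last by exists ([::], [::]).
  have /mapP[b' b'S bE] : b \in map (map (@of_mon n)) (lists_of S' D).
    by rewrite -lists_of_map mapS'.
  have [q qE] := Hp b' b'S.
  (* As [L] is commutative, the whole cofactor can stand on the right of the equation. *)
  have [c2 c2E] : exists c2, feval lw (expand (prel I S D nf_table) c2) =
      - horner_alg (zval X b') p.
    rewrite qE; elim: q {qE} => [|[f m] q [c2 IHc2]].
      by exists [::]; rewrite feval_nil big_nil oppr0.
    have [s fE] := L_span f.
    exists ([seq (- u.1, ([::], (of_mon m, u.2))) | u <- s] ++ c2).
    rewrite /expand map_cat flatten_cat feval_cat -!/(expand _ _) IHc2.
    rewrite big_cons opprD; congr (_ + _); rewrite feval_expand big_map /= prelE fE.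
    set R := _ - _; rewrite /feval mulr_suml -sumrN; apply: eq_bigr => u _.
    rewrite [weval var [::]]big_nil mul1r scaleNr -scalerAl; congr (- (_ *: _)).
    exact: mulrC.
  have [|c1 Hc1] := @commutator_cert K _ (powers (polyseq p) (zword b)
      ++ expand (prel I S D nf_table) c2).
    by apply: L_free; rewrite feval_cat c2E powE bE -zvalE subrr.
  by exists (c1, c2) => _; rewrite catA.
exists (polyseq p), [seq (b, proj1_sig (constructive_indefinite_description _ (cert b)))
                    | b <- lists_of S D].
apply/andP; split; first by rewrite -[nth _ _ _]/(lead_coef p) lead_coef_eq0.
apply/allP => b bS; rewrite (lookup_map _
  (fun b => proj1_sig (constructive_indefinite_description _ (cert b)))) //.
by case: constructive_indefinite_description => pc /=; apply.
Qed.

End CheckComplete.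

(** * Agreement of the encodings and assembly of the algorithm *)

Lemma enc_list_map (X Y : Type) (f : X -> Y) (e : Y -> tree) (e' : X -> tree) s :
  (forall x, e (f x) = e' x) -> enc_list e (map f s) = enc_list e' s.
Proof. by move=> E; elim: s => //= x s ->; rewrite E. Qed.

Lemma enc_upper_map (n : nat) (X Y : Type) (f : X -> Y) (e : Y -> tree)
    (e' : X -> tree) (F : 'I_n -> 'I_n -> X) : (forall x, e (f x) = e' x) ->
  enc_list (enc_list e) (upper (fun i j => f (F i j))) = enc_upper e' F.
Proof.
move=> E; have -> : upper (fun i j => f (F i j)) = map (map f) (upper F).
  by rewrite /upper -map_comp; apply: eq_map => j /=; rewrite -map_comp.
by apply: enc_list_map => t; apply: enc_list_map.
Qed.

Section Main.
Context (K : fieldType) (enc : K -> tree) {K_computable : computable_field enc}.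

Lemma code_of_terms n (s : terms K n) : code (of_terms s) = enc_terms enc s.
Proof. exact: enc_list_map. Qed.

Lemma code_input_data n (c : 'I_n -> 'I_n -> K) (ds : 'I_n -> 'I_n -> terms K n) gs :
  code (input_data c ds gs) = enc_input enc c ds gs.
Proof.
rewrite /enc_input -code_of_terms; congr (Node _ (Node _ (Node _ _))).
exact: (enc_upper_map _ (@code_of_terms n)).
Qed.

End Main.

Theorem mainTheorem1 (K : fieldType) (enc : K -> tree)
    (K_computable : computable_field enc)
    (K_roots : has_root_algorithm enc) :
  exists P : prog,
    forall (n : nat) (c : 'I_n -> 'I_n -> K)
           (d : 'I_n -> 'I_n -> {mpoly K[n]})
           (A : algType K) (x : 'I_n -> A)
           (A_Galg : G_algebra c d x)
           (lt : rel 'X_{1..n}) (lt_adm : admissible d lt)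
           (g : A) (g_nonscalar : nonscalar g) (g_monic : monic_for x lt g)
           (ds : 'I_n -> 'I_n -> terms K n)
           (ds_d : forall i j : 'I_n, (i < j)%N -> poly_of_terms (ds i j) = d i j)
           (gs : terms K n) (gs_g : stdpoly x (poly_of_terms gs) = g)
           (o : tree -> tree) (o_lt : ordering_oracle lt o),
      exists out : seq (seq (terms K n)),
        eval o P (enc_input enc c ds gs)
                 (enc_list (enc_list (enc_terms enc)) out) /\
        all_factorizations g
          [seq [seq stdpoly x (poly_of_terms t) | t <- f] | f <- out].
Proof.
have [P HP] := factorization_program K_roots.
exists P => n c d A x [c_neq0 _ A_pres x_basis] lt lt_adm g _ _ ds ds_d gs gs_g o _.
pose I := input_data c ds gs.
(* These weights, table and polynomial make the search stop; the primed ones below are those it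
   finds. *)
have [w w_ok] := weights_complete c x_basis lt_adm ds_d gs.
have [p [pc p_ok]] := poly_complete c_neq0 A_pres x_basis lt_adm ds_d gs w.
have [|[w' [tab' [p' pc']]] [V [Hcheck HV Hev]]] := HP o I.
  exists (w, (nf_table A_pres x_basis ds_d gs w, (p, pc))).
  by apply/and3P; split=> //; apply: nf_table_ok.
case/and3P: Hcheck => /= w'_ok tab'_ok p'_ok.
pose term (u : K * seq nat) : K * 'X_{1..n} := (u.1, to_mon n u.2).
set F := facts _ _ _ in Hev.
exists (map (map (map term)) F).
(* All exponent lists in the output have length [n], so reading them as monomials and encoding these
   again gives back the same trees. *)
have F_size f e u : f \in F -> e \in f -> u \in e -> size u.2 = n.
  rewrite mem_filter mem_lists_upto => /andP[_ /andP[_ /allP fW]] /fW.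
  rewrite inE mem_elements => /andP[/eqP eS _] /(map_f snd).
  by rewrite eS; apply: size_mons.
split.
  rewrite -code_input_data; have -> // : enc_list (enc_list (enc_terms enc))
    (map (map (map term)) F) = code F.
  have tE e : (forall u, u \in e -> size u.2 = n) ->
      enc_terms enc (map term e) = code e.
    elim: e => //= u e IHe Hu; rewrite IHe; last by move=> v ve; apply: Hu; rewrite inE ve orbT.
    by rewrite /enc_mon -/(of_mon _) to_monK // Hu ?mem_head.
  elim: (F) F_size => //= f t IHt Hf; rewrite IHt; last first.
    by move=> f' e u f't; apply: Hf; rewrite inE f't orbT.
  congr Node.
  have {}Hf : forall e u, e \in f -> u \in e -> size u.2 = n.
    by move=> e u; apply: Hf; rewrite mem_head.
  elim: f Hf => //= e f IHf Hf; rewrite tE; last by move=> u; apply: Hf; rewrite mem_head.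
  by congr Node; apply: IHf => e' u e'f; apply: Hf; rewrite inE e'f orbT.
have := facts_sound c_neq0 A_pres x_basis lt_adm ds_d gs_g w'_ok tab'_ok p'_ok HV.
set R := [seq _ | _ <- _]; set R' := [seq _ | _ <- _ ] => HR.
suff -> : R' = R by [].
rewrite /R' /R /F /facts -map_comp; apply: eq_map => f /=.
rewrite -map_comp; apply: eq_map => e /=.
by rewrite stdpoly_terms /feval big_map.
Qed.
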